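(* The maintenance scheduling problem with bounded number of intersections and singleton possessions can be solved in time $O(n^2)$, where $n$ is the number of jobs. That is, for every constant $\kappa>0$ there is an algorithm which solves every instance with singleton possessions and $\delta/\Delta\le\kappa$ in time $O(n^2)$ (the implied constant depending only on $\kappa$).
   Context: Maintenance scheduling problem: an instance consists of a corridor $[0,L]$ with $L>0$, positive rationals $\Delta$ (headway) and $\delta$ (travel time), a positive integer $m$, and a set $\mathcal J$ of $n$ jobs. The train paths are segments in the (time, location)-plane: the up-path $\ell^u_i$ is the segment from $(i\Delta,0)$ to $(i\Delta+\delta,L)$ and the down-path $\ell^d_i$ is the segment from $(i\Delta,L)$ to $(i\Delta+\delta,0)$, for $i=1,\dots,m$; $\mathcal P$ is the set of all these $2m$ paths. Each job $j$ is given by nonnegative rationals $r_j,d_j,p_j,l^s_j,l^e_j$ with $r_j+p_j\le d_j$ and $l^s_j\le l^e_j\le L$. If job $j$ is started at $s_j\in[r_j,d_j-p_j]$, then the set of cancelled paths, called a possession of $j$, is the set of all paths meeting the rectangle $[s_j,s_j+p_j]\times[l^s_j,l^e_j]$. Jobs with an empty possession are discarded, and for every remaining job $j$, $\mathcal R_j$ denotes the collection of inclusion-minimal possessions of $j$ (this does not change the problem). A solution selects $R_j\in\mathcal R_j$ for every job, and the objective is to minimise $|\bigcup_jR_j|$. Singleton possessions: every element of every $\mathcal R_j$ contains exactly one path. Bounded number of intersections: the number of intersections of each path with other paths is bounded by a constant; this is equivalent to $\delta/\Delta$ being bounded above by a constant (each path intersects at most $\lfloor 2\delta/\Delta\rfloor+1$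 other paths). Running time counts elementary arithmetic operations (including comparison and rounding) on the rational data of the instance. *)

(* Defs.v *)
From HB Require Import structures.
From mathcomp Require Import all_boot all_order all_algebra.
From mathcomp Require Import reals.

Set Implicit Arguments.
Unset Strict Implicit.
Unset Printing Implicit Defensive.

Import Order.TTheory GRing.Theory Num.Theory.
Local Open Scope ring_scope.

Record job := Job {
  release   : rat;   (* r_j *)
  deadline  : rat;   (* d_j *)
  duration  : rat;   (* p_j *)
  loc_start : rat;   (* l^s_j *)
  loc_end   : rat    (* l^e_j *)
}.

Record instance := Instance {
  corridor : rat;    (* L *)
  headway  : rat;    (* Delta *)
  travel   : rat;    (* delta *)
  npaths   : nat;    (* m, the number of paths in each direction *)
  njobs    : nat;    (* n *)
  job_of   : 'I_njobs -> job
}.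
Arguments job_of : clear implicits.

Definition valid_job (L : rat) (J : job) : Prop :=
  [/\ 0 <= release J, 0 <= deadline J, 0 <= duration J & 0 <= loc_start J] /\
  [/\ release J + duration J <= deadline J,
      loc_start J <= loc_end J & loc_end J <= L].

Definition valid_instance (I : instance) : Prop :=
  [/\ 0 < corridor I, 0 < headway I, 0 < travel I & (0 < npaths I)%N] /\
  forall j, valid_job (corridor I) (job_of I j).

(* (true, i) is the up-path and (false, i) the down-path of index i.+1: paths
   are numbered 1, ..., m, ordinals 0, ..., m - 1. *)
Definition train_path (I : instance) : finType := (bool * 'I_(npaths I))%type.

Definition path_num (I : instance) (P : train_path I) : nat := (P.2 : nat).+1.

Section Geometry.
Variables (R : realType) (I : instance).

Implicit Types (P : train_path I) (A : {set train_path I}) (j : 'I_(njobs I)).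

Definition on_path P (t x : R) : Prop :=
  exists lam : R,
    [/\ 0 <= lam <= 1,
        t = (path_num P)%:R * ratr (headway I) + lam * ratr (travel I) &
        x = (if P.1 then lam else 1 - lam) * ratr (corridor I)].

Definition cancels j (s : R) P : Prop :=
  exists t x : R,
    [/\ on_path P t x,
        s <= t <= s + ratr (duration (job_of I j)) &
        ratr (loc_start (job_of I j)) <= x <= ratr (loc_end (job_of I j))].

Definition possession j A : Prop :=
  exists s : R,
    ratr (release (job_of I j)) <= s
      <= ratr (deadline (job_of I j)) - ratr (duration (job_of I j)) /\
    forall P, P \in A <-> cancels j s P.

Definition discarded j : Prop := possession j set0.

(* Membership in R_j, for a job j that is not discarded. *)
Definition min_possession j A : Prop :=
  possession j A /\ forall B, possession j B -> B \subset A -> B = A.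

Definition singleton_possessions : Prop :=
  forall j, ~ discarded j -> forall A, min_possession j A -> #|A| = 1%N.

(* Discarded jobs get the value set0, which does not affect the objective. *)
Definition solution (S : 'I_(njobs I) -> {set train_path I}) : Prop :=
  forall j, (discarded j -> S j = set0) /\
            (~ discarded j -> min_possession j (S j)).

Definition objective (S : 'I_(njobs I) -> {set train_path I}) : nat :=
  #|\bigcup_(j < njobs I) S j|.

Definition optimal (S : 'I_(njobs I) -> {set train_path I}) : Prop :=
  solution S /\ forall S', solution S' -> (objective S <= objective S')%N.

End Geometry.

(* Computation model: a unit-cost random access machine on rationals, given as
   a structured language. The memory consists of scalar variables and of arrays
   with random access; both are named by numerals occurring in the program, so
   that a program uses finitely many of them. *)
Record store := Store {
  scal : nat -> rat;
  arr  : nat -> nat -> rat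
}.

Inductive expr :=
| EConst (q : rat)
| EVar (x : nat)
| EGet (a : nat) (e : expr)
| EAdd (e1 e2 : expr)
| ESub (e1 e2 : expr)
| EMul (e1 e2 : expr)
| EDiv (e1 e2 : expr)
| EFloor (e : expr).

Inductive test :=
| TLe (e1 e2 : expr)
| TNot (b : test)
| TAnd (b1 b2 : test).

Inductive prog :=
| Skip
| SetVar (x : nat) (e : expr)
| SetArr (a : nat) (i e : expr)
| Seq (c1 c2 : prog)
| If (b : test) (c1 c2 : prog)
| While (b : test) (c : prog).

(* Addresses are rounded down to a natural number (and to 0 if negative);
   division by 0 yields 0. *)
Fixpoint eval (st : store) (e : expr) : rat :=
  match e with
  | EConst q => q
  | EVar x => scal st x
  | EGet a e => arr st a (Num.truncn (eval st e))
  | EAdd e1 e2 => eval st e1 + eval st e2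
  | ESub e1 e2 => eval st e1 - eval st e2
  | EMul e1 e2 => eval st e1 * eval st e2
  | EDiv e1 e2 => eval st e1 / eval st e2
  | EFloor e => (Num.floor (eval st e))%:~R
  end.

Fixpoint evalt (st : store) (b : test) : bool :=
  match b with
  | TLe e1 e2 => eval st e1 <= eval st e2
  | TNot b => ~~ evalt st b
  | TAnd b1 b2 => evalt st b1 && evalt st b2
  end.

(* Every operation, comparison and memory access costs one unit. *)
Fixpoint ecost (e : expr) : nat :=
  match e with
  | EConst _ | EVar _ => 1
  | EGet _ e | EFloor e => (ecost e).+1
  | EAdd e1 e2 | ESub e1 e2 | EMul e1 e2 | EDiv e1 e2 =>
      (ecost e1 + ecost e2).+1
  end.

Fixpoint tcost (b : test) : nat :=
  match b with
  | TLe e1 e2 => (ecost e1 + ecost e2).+1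
  | TNot b => (tcost b).+1
  | TAnd b1 b2 => (tcost b1 + tcost b2).+1
  end.

Definition upd (T : Type) (f : nat -> T) (x : nat) (v : T) : nat -> T :=
  fun y => if y == x then v else f y.

Definition set_var (st : store) (x : nat) (v : rat) : store :=
  Store (upd (scal st) x v) (arr st).

Definition set_arr (st : store) (a i : nat) (v : rat) : store :=
  Store (scal st) (upd (arr st) a (upd (arr st a) i v)).

(* exec c st t st': from st, program c terminates in st' after t steps. *)
Inductive exec : prog -> store -> nat -> store -> Prop :=
| ExecSkip st : exec Skip st 1 st
| ExecSetVar x e st :
    exec (SetVar x e) st (ecost e).+1 (set_var st x (eval st e))
| ExecSetArr a i e st :
    exec (SetArr a i e) st (ecost i + ecost e).+1
         (set_arr st a (Num.truncn (eval st i)) (eval st e))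
| ExecSeq c1 c2 t1 t2 st st1 st2 :
    exec c1 st t1 st1 -> exec c2 st1 t2 st2 ->
    exec (Seq c1 c2) st (t1 + t2)%N st2
| ExecIfT b c1 c2 t st st' :
    evalt st b -> exec c1 st t st' ->
    exec (If b c1 c2) st (tcost b + t).+1 st'
| ExecIfF b c1 c2 t st st' :
    ~~ evalt st b -> exec c2 st t st' ->
    exec (If b c1 c2) st (tcost b + t).+1 st'
| ExecWhileT b c t1 t2 st st1 st2 :
    evalt st b -> exec c st t1 st1 -> exec (While b c) st1 t2 st2 ->
    exec (While b c) st (tcost b + t1 + t2).+1 st2
| ExecWhileF b c st :
    ~~ evalt st b -> exec (While b c) st (tcost b).+1 st.

Lemma exec_det c st t1 st1 t2 st2 :
  exec c st t1 st1 -> exec c st t2 st2 -> t1 = t2 /\ st1 = st2.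
Proof.
move=> H; elim: H t2 st2 => {c st t1 st1};
  intros; match goal with H : exec _ _ ?t ?s |- _ = ?t /\ _ = ?s =>
    inversion H; subst end;
  try (by match goal with
    H1 : is_true (evalt ?s ?b), H2 : is_true (~~ evalt ?s ?b) |- _ =>
      rewrite H1 in H2 end);
  repeat match goal with
    IH : forall t s, exec ?c ?s0 t s -> _ = t /\ _ = s, H : exec ?c ?s0 _ _ |- _ =>
      case: (IH _ _ H) => ? ?; subst; clear H end; by [].
Qed.

(* Scalars 0-4 hold L, Delta, delta, m, n; cell j of arrays 0-4 holds r_j, d_j,
   p_j, l^s_j, l^e_j; everything else is initially 0. *)
Definition input_scal (I : instance) (x : nat) : rat :=
  nth 0 [:: corridor I; headway I; travel I; (npaths I)%:R; (njobs I)%:R] x.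

Definition input_arr (I : instance) (a i : nat) : rat :=
  if insub i : option 'I_(njobs I) is Some j then
    let J := job_of I j in
    nth 0 [:: release J; deadline J; duration J; loc_start J; loc_end J] a
  else 0.

Definition input (I : instance) : store :=
  Store (input_scal I) (input_arr I).

(* When all possessions are singletons, the choice for job j is written in cell
   j of array 5: i for the i-th up-path, - i for the i-th down-path. Any other
   number, for instance 0, encodes the empty set. *)
Definition path_code (I : instance) (P : train_path I) : rat :=
  if P.1 then (path_num P)%:R else - (path_num P)%:R.

Definition output (I : instance) (st : store) :
    'I_(njobs I) -> {set train_path I} :=
  fun j => [set P | path_code P == arr st 5 j].
Arguments output : clear implicits.

(* Main.v *)
Require Import Defs.
From mathcomp Require Import all_boot all_order all_algebra.
From mathcomp Require Import reals zify ring lra.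
From mathcomp Require boolp.
Import Order.TTheory GRing.Theory Num.Theory.
Local Open Scope ring_scope.
Set Implicit Arguments. Unset Strict Implicit. Unset Printing Implicit Defensive.

(** For a job that is not discarded, a minimal possession is a single path, so
    choosing possessions means choosing a minimum hitting set of the sets of
    paths that form singleton possessions of the jobs. Two facts make this
    possible in quadratic time, although the number of paths is not bounded in
    terms of the number of jobs.

    Whether a path forms a possession of a job, and whether the job is
    discarded, is decided by boundedly many operations ([privateP],
    [discardP]). A path cancels the job for an interval of starting times; the
    intervals of one direction are translates of each other by multiples of the
    headway, and only the neighbours of an interval, or boundedly many ends of
    intervals, have to be inspected.

    The sets of paths are almost intervals of indices ([private_core]): with a
    path, the set of a job contains every path of either direction whose index
    is larger by at least B and stays B below the last index that the job can
    reach, where B depends only on kappa. Cut the indices into blocks of length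
    B. A job that is hit in block b is then hit by every path from block b + 2
    up to two blocks before its end. Hence a nonempty block of a hitting set,
    together with the two blocks around it, separates the picks before it from
    those after it: a hitting set is a route through such windows, and each
    step of the route can be checked on the two windows that it joins
    ([route_complete]). Moreover, picks that lie more than three blocks before
    the end of every job that they still have to hit can be exchanged for one
    pick closer to these ends ([localize], [gather_exists]). So only the
    windows in O(n) rows matter, with boundedly many steps from each of them.

    The program fills a table of shortest routes from the last row to the first
    one, spending time O(n) on each entry, and then follows the stored pointers
    from an empty window placed before all paths. Its loops are nested at most
    twice and none is iterated more than 4 n + 1 times, which bounds the
    running time ([cost_pow]). *)

(** * The possessions of one job *)

Module Track.

(** Reduces the existence of a starting time to finitely many comparisons; the
    weak bounds come from the interval of a path and the starting times,
    the strict ones from the intervals of other paths. *)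
Lemma between (l u : rat) (sl su : seq rat) :
  l <= u -> all (fun x => x < u) sl -> all (fun y => l < y) su ->
  all (fun x => all (fun y => x < y) su) sl ->
  exists s, [/\ l <= s <= u, all (fun x => x < s) sl & all (fun y => s < y) su].
Proof.
move=> lu Hsl Hsu Hss.
have [x [xu xl xsu]] : exists x, [/\ x < u, all (fun x' => x' <= x) sl &
    all (fun y => x < y) su].
  elim: sl Hsl Hss => [|a sl IH] /=.
    move=> _ _; exists (l - 1); split => //; first by lra.
    by apply: (sub_all _ Hsu) => z /=; lra.
  move=> /andP[au Hsl] /andP[asu Hss].
  have [x [xu xl xsu]] := IH Hsl Hss.
  have [ax|xa] := lerP a x; first by exists x; rewrite ax.
  exists a; rewrite lexx au asu; split=> //=.
  by apply: (sub_all _ xl) => z /=; lra.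
have [y [yl yh xy yu]] : exists y, [/\ l < y, all (fun y' => y <= y') su, x < y & y <= u + 1].
  elim: su Hsu {Hss} xsu => [|a su IH] /=.
    by move=> _ _; exists (u + 1); split => //; lra.
  move=> /andP[au Hsu] /andP[asu Hss].
  have [y [yl yh xy yu]] := IH Hsu Hss.
  have [ya|ay] := lerP y a; first by exists y; rewrite ya.
  exists a; rewrite lexx; split=> //=; last by lra.
  by apply: (sub_all _ yh) => z /=; lra.
have [xl'|lx] := ltrP x l.
  exists l; rewrite lexx lu; split => //.
    by apply: (sub_all _ xl) => z /=; lra.
have [yu'|uy] := lerP y u.
  exists ((x + y) / 2); split; first by lra.
    by apply: (sub_all _ xl) => z /=; lra.
  by apply: (sub_all _ yh) => z /=; lra.
exists u; rewrite lexx lu; split => //.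
by apply: (sub_all _ yh) => z /=; lra.
Qed.

Lemma intr_lt_pred (i j : int) : i < j -> i%:~R <= j%:~R - 1 :> rat.
Proof. by move=> ij; rewrite -[1]/(1%:~R) -intrB ler_int; lia. Qed.

Lemma intr_ltS (i j : int) : (i%:~R < j%:~R :> rat) -> i%:~R + 1 <= j%:~R :> rat.
Proof. by rewrite ltr_int => ?; rewrite -[1]/(1%:~R) -intrD ler_int; lia. Qed.

Lemma pred_neq (i : int) : i - 1 <> i.
Proof. lia. Qed.

Lemma succ_neq (i : int) : i + 1 <> i.
Proof. lia. Qed.

Lemma lt_intS (i j : int) : (i%:~R < j%:~R + 1 :> rat) -> i <= j.
Proof. by rewrite -[1 in X in _ < X]/(1%:~R) -intrD ltr_int; lia. Qed.

Lemma int_offset (a b : int) (n : nat) : a <= b -> b < a + n%:Z ->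
  exists2 o : nat, o \in iota 0 n & b%:~R = a%:~R + o%:R :> rat.
Proof.
move=> ab ba; exists (absz (b - a)); first by rewrite mem_iota; lia.
by rewrite -[_%:R]/(_%:Z%:~R) -intrD; congr _%:~R; lia.
Qed.

(** A path of direction [d] and index [i] meets the job exactly if the job
    starts between [start d i] and [finish d i]. Here [D] is the headway, [r]
    and [e] are the first and the last starting time, [dur] is the duration and
    [m] the number of paths of each direction; [lo d] and [hi d] are the delays
    after which a train of direction [d] reaches and leaves the locations of
    the job. *)
Section Tracks.
Variables (D dl r e dur m : rat) (lo hi : bool -> rat).
Implicit Types (d : bool) (i k q z : rat).

Definition start d i := i * D + lo d - dur.
Definition finish d i := i * D + hi d.
Definition last_start d z := (Num.floor ((z - lo d + dur) / D))%:~R : rat.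

(** The last path of the other direction whose interval starts no later than
    that of [i]. The offset does not depend on [i]. *)
Definition partner d i := i + (Num.floor ((lo d - lo (~~ d)) / D))%:~R.

(** The strict bounds that the neighbouring intervals put on the points covered
    by path [i] alone. Each is guarded by the existence of the neighbour; if the
    opposite neighbour has an index out of range, the nearest path replaces
    it. *)
Definition lows d i : seq (bool * rat) :=
  [:: (2 <= i, finish d (i - 1));
      ((1 <= partner d i) && (partner d i <= m), finish (~~ d) (partner d i));
      (m < partner d i, finish (~~ d) m)].
Definition highs d i : seq (bool * rat) :=
  [:: (i + 1 <= m, start d (i + 1));
      ((0 <= partner d i) && (partner d i + 1 <= m), start (~~ d) (partner d i + 1));
      (partner d i < 0, start (~~ d) 1)].
Definition private_test d i : bool :=
  [&& 1 <= i, i <= m, r <= finish d i, start d i <= e,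
      all (fun l => l.1 ==> ((l.2 < e) && (l.2 < finish d i))) (lows d i),
      all (fun h => h.1 ==> ((r < h.2) && (start d i < h.2))) (highs d i) &
      all (fun l => all (fun h => l.1 ==> (h.1 ==> (l.2 < h.2))) (highs d i))
          (lows d i)].

Definition covers (s : rat) (P : bool * int) : Prop :=
  1 <= (P.2%:~R : rat) <= m /\ start P.1 P.2%:~R <= s <= finish P.1 P.2%:~R.
Definition private (P : bool * int) : Prop :=
  exists s, [/\ r <= s <= e, covers s P & forall Q, covers s Q -> Q = P].
Definition uncovered s := forall P, ~ covers s P.

Variable kap : nat.

Definition covered_at z d : bool :=
  ((1 <= last_start d z) && (last_start d z <= m) && (z <= finish d (last_start d z)))
  || ((m < last_start d z) && (z <= finish d m)).
Definition covered_after z d : bool :=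
  ((1 <= last_start d z) && (last_start d z <= m) && (z < finish d (last_start d z)))
  || ((m < last_start d z) && (z < finish d m)).
Definition gap_after z : bool :=
  [&& r <= z, z < e, ~~ covered_after z true & ~~ covered_after z false].

(** Indices near the first starting time and near the last path, where
    [discardP] finds the interval that precedes an uncovered point. *)
Definition gap_candidates : seq rat :=
  [seq (Num.floor (r / D))%:~R - kap%:R + o%:R | o <- iota 0 kap.+2] ++
  [seq m - kap%:R + o%:R | o <- iota 0 kap.+1].
Definition discard_test : bool :=
  (~~ covered_at r true && ~~ covered_at r false) ||
  has (fun q => gap_after (finish true q) || gap_after (finish false q)) gap_candidates.

Hypotheses (D_gt0 : 0 < D) (dur_ge0 : 0 <= dur) (r_ge0 : 0 <= r) (re : r <= e).
Hypotheses (lo_ge0 : forall d, 0 <= lo d) (lo_hi : forall d, lo d <= hi d).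
Hypotheses (hi_dl : forall d, hi d <= dl).
Hypothesis widths : hi true - lo true = hi false - lo false.
Variable (mz : int).
Hypotheses (m_gt0 : 1 <= m) (m_int : m = mz%:~R).

Lemma width d d' : hi d - lo d = hi d' - lo d'.
Proof. by case: d; case: d'. Qed.

Lemma leD i k : i <= k -> i * D <= k * D.
Proof. by move=> ik; rewrite ler_wpM2r // ltW. Qed.

Lemma partnerP d i : 
  start (~~ d) (partner d i) <= start d i < start (~~ d) (partner d i + 1).
Proof.
rewrite /start /partner; set f := Num.floor _.
have /andP [] := floor_itv ((lo d - lo (~~ d)) / D); rewrite -/f.
rewrite ler_pdivlMr // ltr_pdivrMr // intrD; nra.
Qed.

Lemma partner_int d (i : int) : exists k : int, partner d i%:~R = k%:~R.
Proof. by eexists; rewrite /partner -intrD. Qed.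

(** Since all intervals have the same width, they end in the order in which
    they start. So the earlier intervals of a direction are avoided as soon as
    the last of them is, and likewise the later ones. *)
Lemma privateP d (i : int) : private (d, i) <-> private_test d i%:~R.
Proof.
have [k kE] := partner_int d i.
have := partnerP d i%:~R; rewrite kE => /andP[k1 k2].
have wd := width d (~~ d).
split.
  move: k1 k2; rewrite /private_test /lows /highs kE /start /finish /=.
  set I : rat := i%:~R; set kk : rat := k%:~R => k1 k2.
  case=> s [/andP[rs se] [/=]]; rewrite /start /finish -/I => /andP[I1 Im] /andP[xs sy] un.
  have ncL d' (j : int) (q : rat) : (d', j) <> (d, i) -> q = j%:~R ->
      1 <= q -> q <= m -> q * D + lo d' - dur <= s -> q * D + hi d' < s.
    move=> ne -> j1 jm h; case: (ltrP (j%:~R * D + hi d') s) => // h'.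
    by case: ne; apply: un; split=> /=; rewrite ?j1 // /start /finish h h'.
  have ncR d' (j : int) (q : rat) : (d', j) <> (d, i) -> q = j%:~R ->
      1 <= q -> q <= m -> s <= q * D + hi d' -> s < q * D + lo d' - dur.
    by move=> ne qE j1 jm h; case: ltrP => // /(ncL _ _ _ ne qE j1 jm); lra.
  have dn : (~~ d == d) = false by case: (d).
  have L1 : 2 <= I -> (I - 1) * D + hi d < s.
    by move=> ?; apply: (ncL d (i - 1)); [case; exact: pred_neq | rewrite intrB | lra..].
  have L2 : (1 <= kk) && (kk <= m) -> kk * D + hi (~~ d) < s.
    by move=> /andP[? ?]; apply: (ncL _ k) => //; [case=> /eqP; rewrite dn | lra..].
  have L3 : m < kk -> m * D + hi (~~ d) < s.
    move=> h1; have hD := leD (ltW h1).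
    by apply: (ncL _ mz) => //; [case=> /eqP; rewrite dn | lra..].
  have H1 : I + 1 <= m -> s < (I + 1) * D + lo d - dur.
    by move=> ?; apply: (ncR d (i + 1)); [case; exact: succ_neq | rewrite intrD | lra..].
  have H2 : (0 <= kk) && (kk + 1 <= m) -> s < (kk + 1) * D + lo (~~ d) - dur.
    have := lo_hi (~~ d); move=> ? /andP[? ?]; apply: (ncR _ (k + 1));
      [by case=> /eqP; rewrite dn | by rewrite intrD | lra..].
  have H3 : kk < 0 -> s < 1 * D + lo (~~ d) - dur.
    move=> h; have := lo_hi (~~ d) => ?.
    have := @intr_ltS k 0 h; rewrite -/kk => /leD ?.
    by apply: (ncR _ 1); [case=> /eqP; rewrite dn | | lra..].
  have rY : r <= I * D + hi d by lra.
  have Xe : I * D + lo d - dur <= e by lra.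
  rewrite I1 Im rY Xe /=; apply/and3P; split.
  - by rewrite !andbT; apply/and3P; split; apply/implyP; [move=> /L1|move=> /L2|move=> /L3]; lra.
  - by rewrite !andbT; apply/and3P; split; apply/implyP; [move=> /H1|move=> /H2|move=> /H3]; lra.
  - rewrite !andbT; apply/and3P; split; apply/and3P; split;
      apply/implyP => hl; apply/implyP => hh;
      by [exact: lt_trans (L1 hl) (H1 hh) | exact: lt_trans (L1 hl) (H2 hh)
        | exact: lt_trans (L1 hl) (H3 hh) | exact: lt_trans (L2 hl) (H1 hh)
        | exact: lt_trans (L2 hl) (H2 hh) | exact: lt_trans (L2 hl) (H3 hh)
        | exact: lt_trans (L3 hl) (H1 hh) | exact: lt_trans (L3 hl) (H2 hh)
        | exact: lt_trans (L3 hl) (H3 hh)].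
rewrite /private_test; set lw := lows _ _; set hg := highs _ _.
move=> /and5P[I1 Im rY Xe /and3P[Hl Hh Hlh]].
have filt (s : seq (bool * rat)) (P : pred rat) :
   all P (map snd (filter fst s)) = all (fun l => l.1 ==> P l.2) s.
  by elim: s => //= -[[] x] s /= ->.
set I : rat := i%:~R; set kk : rat := k%:~R.
have [] := @between (Num.max r (I * D + lo d - dur)) (Num.min e (I * D + hi d))
   (map snd (filter fst lw)) (map snd (filter fst hg)).
- have rY' : r <= I * D + hi d := rY.
  have Xe' : I * D + lo d - dur <= e := Xe.
  by rewrite ge_max !le_min re rY' Xe' /= -addrA lerD2l lerBlDr ler_wpDr ?lo_hi.
- rewrite filt; apply: (sub_all _ Hl) => l /implyP h; apply/implyP => /h.
  by rewrite /= lt_min.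
- rewrite filt; apply: (sub_all _ Hh) => l /implyP h; apply/implyP => /h.
  by rewrite /= gt_max.
- rewrite filt; apply: (sub_all _ Hlh) => l /allP h; apply/implyP => hl.
  by rewrite filt; apply/allP => x /h /implyP /(_ hl).
move=> s [ls]; rewrite !filt => sl sh.
exists s; split.
- by move: ls; rewrite ge_max le_min; lra.
- rewrite /covers /= /start /finish -/I.
  by move: ls; rewrite ge_max le_min; lra.
move=> [d' j] [/= /andP[j1 jm]]; rewrite /start /finish => /andP[xs sy].
move: sl sh; rewrite /lw /hg /lows /highs kE /start /finish -/I -/kk /= !andbT => /and3P[/implyP L1 /implyP L2 /implyP L3] /and3P[/implyP H1 /implyP H2 /implyP H3].
have [?|dd'] := eqVneq d d'.
  subst d'; congr pair.
  have [ij|ij|->//] := ltrgtP j i; exfalso.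
    have h := intr_lt_pred ij; rewrite -/I in h.
    have {}L1 := L1 (ltac:(lra)); have := leD h; lra.
  have h := intr_lt_pred ij; rewrite -/I in h.
  have {}H1 := H1 (ltac:(lra)); have := leD h; lra.
have d'E : d' = ~~ d by move: dd'; case: (d); case: (d').
subst d'; exfalso.
have [jk|kj] := lerP j%:~R kk.
  have jk' := leD jk; have [mk|km] := ltrP m kk.
    by have := L3 mk; have := leD jm; lra.
  have {}L2 := L2 (ltac:(lra)); lra.
have jk' := intr_ltS kj; have jkD := leD jk'.
have [k0|k0] := ltrP kk 0.
  by have := H3 k0; have := leD j1; lra.
have {}H2 := H2 (ltac:(lra)); lra.
Qed.

Lemma last_startP d z : start d (last_start d z) <= z < start d (last_start d z + 1).
Proof.
rewrite /start /last_start; set f := Num.floor _.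
have /andP [] := floor_itv ((z - lo d + dur) / D); rewrite -/f.
rewrite ler_pdivlMr // ltr_pdivrMr // intrD; set F : rat := f%:~R.
by rewrite -[1%:~R]/(1 : rat); lra.
Qed.

Lemma ltD i k : i * D < k * D -> i < k.
Proof. by rewrite ltr_pM2r. Qed.

Lemma leD_inv i k : i * D <= k * D -> i <= k.
Proof. by rewrite ler_pM2r. Qed.

Hypothesis dl_le : dl <= kap%:R * D.

(** The formula [last_start] may exceed the number of paths; this is the second
    case for the index of the latest path. *)
Lemma latestP d z : 
  (forall P, P.1 = d -> 1 <= (P.2%:~R : rat) <= m -> ~ start d P.2%:~R <= z) \/
  exists f : int, [/\ 1 <= (f%:~R : rat) <= m, start d f%:~R <= z,
    (f%:~R == last_start d z) && (last_start d z <= m) || (m < last_start d z) && (f%:~R == m) &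
    forall i : int, (i%:~R : rat) <= m -> start d i%:~R <= z -> i%:~R <= f%:~R :> rat].
Proof.
have D0 := D_gt0.
have /andP[f1 f2] := last_startP d z.
set f := last_start d z in f1 f2 *.
have fE : f = (Num.floor ((z - lo d + dur) / D))%:~R by [].
set fz := Num.floor _ in fE.
have le_f (i : int) : start d i%:~R <= z -> i%:~R <= f.
  move=> h; rewrite fE ler_int; apply: lt_intS; rewrite -fE.
  by apply: ltD; move: h f2; rewrite /start; lra.
have [F1|F1] := lerP 1 f; last first.
  left=> -[_ i] /= _ /andP[i1 im] /le_f; lra.
right; have [mf|fm] := ltrP m f.
  exists mz; rewrite -m_int m_gt0 lexx eqxx ?orbT /=; split=> //.
  by have := leD (ltW mf); move: f1; rewrite /start; lra.
exists fz; rewrite -fE F1 fm eqxx; split=> //.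
by move=> i im /le_f.
Qed.

(** Among the intervals that have started, the latest one ends last. *)
Lemma covered_atP d s : covered_at s d <-> exists i : int, covers s (d, i).
Proof.
have D0 := D_gt0.
have [none|[f [/andP[f1 fm] fs fE fmax]]] := latestP d s.
  have /andP[h1 _] := last_startP d s.
  have ln : ~~ (1 <= last_start d s).
    apply/negP => l1; have [mf|fm] := ltrP m (last_start d s).
      apply: (none (d, mz)) => //=; rewrite -m_int ?m_gt0 ?lexx //.
      by have := leD (ltW mf); move: h1; rewrite /start; lra.
    by apply: (none (d, Num.floor ((s - lo d + dur) / D))) => //=; apply/andP.
  rewrite /covered_at (negbTE ln) /=.
  have -> : (m < last_start d s) = false by apply/negbTE; have := m_gt0; lra.
  by split=> // -[i [/= im /andP[c _]]]; case: (none (d, i) erefl im c).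
have -> : covered_at s d = (s <= finish d f%:~R).
  rewrite /covered_at; case/orP: fE => /andP[]; last first.
    by move=> mf /eqP ->; rewrite mf [last_start d s <= m]leNgt mf andbF.
  by move=> /eqP <- fm'; rewrite f1 fm ltNge fm orbF.
split=> [sf|[i [/= /andP[i1 im] /andP[c1 c2]]]].
  by exists f; split; rewrite /= ?f1 // fs.
by have := leD (fmax _ im c1); move: c2; rewrite /finish; lra.
Qed.

Lemma covered_afterP d z (i : int) : ~~ covered_after z d ->
  1 <= (i%:~R : rat) <= m -> start d i%:~R <= z -> finish d i%:~R <= z.
Proof.
move=> nc im sz; have [none|[f [/andP[f1 fm] fs fE fmax]]] := latestP d z.
  by have := none (d, i) erefl im.
have /andP[_ im'] := im; have := leD (fmax _ im' sz).
suff : finish d f%:~R <= z by rewrite /finish; lra.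
rewrite leNgt; apply: contra nc => h; rewrite /covered_after.
case/orP: fE => /andP[]; last first.
  by move=> mf /eqP fE; rewrite -fE h andbT; rewrite fE mf orbT.
by move=> /eqP <- fm'; rewrite f1 fm h.
Qed.

Lemma uncoveredP s : uncovered s <-> ~~ covered_at s true && ~~ covered_at s false.
Proof.
split=> [u|/andP[/negP n1 /negP n2] [[] i] c].
  by apply/andP; split; apply/negP => /covered_atP[i]; exact: u.
  by apply: n1; apply/covered_atP; exists i.
by apply: n2; apply/covered_atP; exists i.
Qed.

(** No interval starts between [z] and the next start of either direction, so
    half way to that start nothing is covered. *)
Lemma gap_after_uncovered z : gap_after z -> exists s, r <= s <= e /\ uncovered s.
Proof.
case/and4P=> rz ze nt nf.
have [/andP[_ t2] /andP[_ f2]] := (last_startP true z, last_startP false z).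
set nt' := start true _ in t2; set nf' := start false _ in f2.
pose s := (z + Num.min e (Num.min nt' nf')) / 2.
have mz' : z < Num.min e (Num.min nt' nf') by rewrite !lt_min ze t2 f2.
have me : Num.min e (Num.min nt' nf') <= e by rewrite ge_min lexx.
have mt : Num.min e (Num.min nt' nf') <= nt' by rewrite !ge_min lexx orbT.
have mf : Num.min e (Num.min nt' nf') <= nf' by rewrite !ge_min lexx !orbT.
exists s; split; first by rewrite /s; lra.
have zs : z < s by rewrite /s; lra.
have snt : s < nt' by rewrite /s; lra.
have snf : s < nf' by rewrite /s; lra.
have key d : s < start d (last_start d z + 1) -> ~~ covered_after z d ->
    forall i : int, ~ covers s (d, i).
  move=> h n i [/= im /andP[c1 c2]].
  have : i%:~R <= last_start d z.
    rewrite ler_int; apply: lt_intS; apply: ltD.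
    by move: h c1; rewrite /start /last_start; lra.
  move=> /leD il; have /andP[l1 _] := last_startP d z.
  have := covered_afterP n im; move: il l1 c2; rewrite /start /finish => il l1 c2.
  by move=> /(_ ltac:(lra)); lra.
by move=> [[] i]; [apply: (key true) | apply: (key false)].
Qed.

(** One headway before an uncovered point only the last path of a direction can
    be in the way: the interval of any other path has a translate that would
    cover the point itself. *)
Lemma shift_uncovered s : r <= s <= e -> uncovered s -> exists s',
  [/\ r <= s' <= e, uncovered s' &
      s' < r + D \/ exists d, start d m <= s' - D <= finish d m].
Proof.
have D0 := D_gt0; have m1 := m_gt0.
move=> rse us; have [n sn] : exists n : nat, s < r + n%:R * D.
  exists (Num.bound ((s - r) / D)); rewrite addrC -ltrBlDr -ltr_pdivrMr //.
  apply: archi_boundP.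
  by rewrite divr_ge0 ?(ltW D0) // subr_ge0; case/andP: rse.
elim: n s rse us sn => [|n IH] s /andP[rs se] us sn.
  by move: sn; rewrite mul0r addr0; lra.
have [sD|Ds] := ltrP s (r + D); first by exists s; rewrite rs se; split=> //; left.
have [u'|] := boolP (~~ covered_at (s - D) true && ~~ covered_at (s - D) false).
  apply: (IH (s - D)); [lra | exact/uncoveredP |].
  by move: sn; rewrite -natr1; lra.
rewrite negb_and !negbK => c.
have [d [i [/= /andP[i1 im] /andP[c1 c2]]]] : exists d, exists i : int, covers (s - D) (d, i).
  by case/orP: c => /covered_atP[i]; [exists true, i | exists false, i].
exists s; split=> //; first lra.
right; exists d.
have [|mi] := ltrP i%:~R m; last first.
  have <- : i%:~R = m by apply: le_anti; rewrite im mi.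
  by rewrite c1 c2.
rewrite m_int => /intr_ltS; rewrite -m_int => im'.
case: (us (d, i + 1)); split=> /=; rewrite intrD; first lra.
by move: c1 c2; rewrite /start /finish; lra.
Qed.

(** An uncovered point can be moved back until it meets the end of an interval
    or the first starting time. By [shift_uncovered] this end belongs to a path
    near the first starting time or near the last path. *)
Lemma discardP : (exists s, r <= s <= e /\ uncovered s) <-> discard_test.
Proof.
have D0 := D_gt0; have m1 := m_gt0; have k1 := dl_le.
split=> [[s0 [rse0 us0]]|]; last first.
  case/orP=> [/uncoveredP u|/hasP[q _ /orP[]]]; try exact: gap_after_uncovered.
  by exists r; rewrite lexx re.
have [s [/andP[rs se] us near]] := shift_uncovered rse0 us0.
have [//|cr] := boolP (~~ covered_at r true && ~~ covered_at r false).
  by rewrite /discard_test => ->.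
apply/orP; right.
(* the last interval of either direction that has ended in [r, s) *)
have [d [f [f1 rf fs fmax]]] : exists d (f : int), [/\ 1 <= (f%:~R : rat) <= m,
    r <= finish d f%:~R, finish d f%:~R < s &
    forall d' (i : int), 1 <= (i%:~R : rat) <= m -> start d' i%:~R <= s ->
      finish d' i%:~R <= finish d f%:~R].
  have last d : (forall i : int, 1 <= (i%:~R : rat) <= m -> ~ start d i%:~R <= s) \/
      exists f : int, [/\ 1 <= (f%:~R : rat) <= m, finish d f%:~R < s &
        forall i : int, 1 <= (i%:~R : rat) <= m -> start d i%:~R <= s ->
          finish d i%:~R <= finish d f%:~R].
    have [none|[f [f1 fs _ fmax]]] := latestP d s.
      by left=> i; apply: (none (d, i)).
    right; exists f; split=> // [|i /andP[_ im] si].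
      by rewrite ltNge; apply/negP => h; apply: (us (d, f)); rewrite /covers /= fs h.
    by have := leD (fmax i im si); rewrite /finish; lra.
  have [d0 [i0 [/= im0 /andP[c1 c2]]]] : exists d, exists i : int, covers r (d, i).
    move: cr; rewrite negb_and !negbK.
    by case/orP => /covered_atP[i]; [exists true, i | exists false, i].
  have c1s := le_trans c1 rs.
  have [none0|[f0 [v0 fs0 max0]]] := last d0; first by case: (none0 i0).
  have rf0 := le_trans c2 (max0 _ im0 c1s).
  have [none1|[f1 [v1 fs1 max1]]] := last (~~ d0).
    exists d0, f0; split=> // d' i im si.
    have [dE|ne] := eqVneq d' d0; first by subst d'; apply: max0 im si.
    have dE : d' = ~~ d0 by move: ne; case: (d'); case: (d0).
    by case: (none1 i) => //; rewrite -dE.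
  have dd d' : d' = d0 \/ d' = ~~ d0 by case: (d'); case: (d0); auto.
  have [le01|/ltW le10] := lerP (finish d0 f0%:~R) (finish (~~ d0) f1%:~R).
    exists (~~ d0), f1; split=> //; first exact: le_trans rf0 le01.
    move=> d' i im si; case: (dd d') => dE; subst d'; last exact: max1 im si.
    exact: le_trans (max0 _ im si) le01.
  exists d0, f0; split=> //.
  move=> d' i im si; case: (dd d') => dE; subst d'; first exact: max0 im si.
  exact: le_trans (max1 _ im si) le10.
have gap : gap_after (finish d f%:~R).
  have after d' : ~~ covered_after (finish d f%:~R) d'.
    apply/negP => ca.
    suff [i [im si fi]] : exists i : int, [/\ 1 <= (i%:~R : rat) <= m,
        start d' i%:~R <= finish d f%:~R & finish d f%:~R < finish d' i%:~R].
      by have := fmax d' i im (le_trans si (ltW fs)); rewrite leNgt fi.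
    have /andP[l1 _] := last_startP d' (finish d f%:~R).
    move: ca; rewrite /covered_after => /orP[/andP[lm fl]|/andP[ml fl]].
      by exists (Num.floor ((finish d f%:~R - lo d' + dur) / D)).
    exists mz; rewrite -m_int m_gt0 lexx; split=> //.
    by have := leD (ltW ml); move: l1; rewrite /start; lra.
  by rewrite /gap_after rf (lt_le_trans fs se) !after.
apply/hasP; exists f%:~R; last by case: d gap {rf fs fmax} => ->; rewrite ?orbT.
rewrite mem_cat; case/andP: f1 => f1 fm; have hd := hi_dl d; have l0 := lo_ge0 d.
have lh := lo_hi d.
move: rf fs; rewrite /finish => rf fs; apply/orP.
case: near => [sr|[d' /andP[s1 s2]]].
  left; set g := Num.floor (r / D).
  have /andP[g1 g2] := floor_itv (r / D); rewrite -/g in g1 g2.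
  move: g1 g2; rewrite ler_pdivlMr // ltr_pdivrMr // intrD => g1 g2.
  have [||o oi ->] := @int_offset (g - kap%:Z) f kap.+2.
  - apply: lt_intS; rewrite intrB; apply: ltD.
    by rewrite -[kap%:Z%:~R]/(kap%:R : rat); lra.
  - rewrite -(ltr_int rat); apply: ltD; rewrite !intrD intrN.
    by rewrite -[kap%:Z%:~R]/(kap%:R : rat) -[kap.+2%:Z%:~R]/(kap.+2%:R : rat) -addn2 natrD; lra.
  - by rewrite intrB; apply/mapP; exists o.
right; have fl : finish d' m <= finish d f%:~R.
  rewrite m_int; apply: fmax; rewrite -m_int ?m_gt0 ?lexx //; lra.
have [||o oi ->] := @int_offset (mz - kap%:Z) f kap.+1.
- apply: lt_intS; rewrite intrB -m_int; apply: ltD.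
  have := lo_hi d'; have := lo_ge0 d'.
  by rewrite -[kap%:Z%:~R]/(kap%:R : rat); move: fl; rewrite /finish; lra.
- rewrite -(ltr_int rat) !intrD intrN -m_int.
  by rewrite -[kap%:Z%:~R]/(kap%:R : rat) -[kap.+1%:Z%:~R]/(kap.+1%:R : rat) -addn1 natrD; lra.
- by rewrite intrB -m_int; apply/mapP; exists o.
Qed.
(** Intervals at least as wide as their spacing leave no gaps between them. *)
Lemma wide_covered d (s : rat) : D <= hi d - lo d + dur -> D + dl - dur <= s ->
  s <= m * D -> exists i : int, covers s (d, i).
Proof.
move=> wD s1 s2; have /andP[f1 f2] := last_startP d s.
move: f1 f2; rewrite /last_start; set f := Num.floor _; set F : rat := f%:~R.
rewrite /start => f1 f2; have := hi_dl d; have := lo_hi d; have := lo_ge0 d.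
move=> l0 lh hd.
have F0 : 0 < F.
  rewrite -(ltrD2r 1) add0r; apply: ltD; lra.
have F1 : 1 <= F by have := @intr_ltS 0 f F0; rewrite add0r.
have [Fm|mF] := lerP F m.
  exists f; split=> /=; first by rewrite -/F Fm; lra.
  by rewrite /start /finish -/F; lra.
exists mz; rewrite /covers /= -m_int m_gt0 lexx; split=> //.
by have := leD (ltW mF); rewrite /start /finish; lra.
Qed.

(** Away from the first and the last trains, wide intervals of both directions
    overlap everywhere, and no point is covered by a single path. *)
Lemma private_wide P : private P -> D <= hi true - lo true + dur ->
  exists s, [/\ r <= s <= e, covers s P & s < D + dl - dur \/ m * D < s].
Proof.
case=> s [rse sP un] wD; exists s; split=> //.
have [?|s1] := ltrP s (D + dl - dur); first by left.
have [?|s2] := ltrP (m * D) s; first by right.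
have [i1 c1] := wide_covered wD s1 s2.
have wD' : D <= hi false - lo false + dur by move: widths; lra.
have [i2 c2] := wide_covered wD' s1 s2.
by have := un _ c1; rewrite -(un _ c2).
Qed.

Hypothesis singles : forall s : rat, r <= s <= e -> exists2 P, covers s P & private P.
Variable B : rat.
Hypothesis B_ge : 2 * kap%:R + 3 <= B.

(** If the intervals are at least one headway wide, the premises contradict each
    other. By [private_wide] the given path is near the first trains, which
    bounds the duration because starting times are nonnegative; then the job
    can also start near [y], far from both ends of the timetable, where no path
    is alone.

    Otherwise the intervals of one direction are disjoint, and the whole
    interval of [y] is available to the job. It is only useless if it coincides
    with an interval of the other direction; but then these two paths would be
    cancelled together, with no singleton possession inside. *)
Lemma private_core dx (ix : int) dy (iy : int) :
  private (dx, ix) -> ix%:~R + B <= iy%:~R -> iy%:~R + B <= m ->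
  (iy%:~R + B) * D <= e + dur -> private (dy, iy).
Proof.
move=> px xy ym ye.
have BD := leD B_ge; have xyD := leD xy; have ymD := leD ym.
have kD : 0 <= kap%:R * D by rewrite mulr_ge0 // ltW.
move: xyD ymD xy ym ye; set x : rat := ix%:~R; set y : rat := iy%:~R => xyD ymD xy ym ye.
have D0 := D_gt0; have p0 := dur_ge0; have r0 := r_ge0; have m1 := m_gt0.
have dk := dl_le.
have k0 : 0 <= kap%:R :> rat by [].
have Bk := B_ge.
have [sx [/andP[rsx sxe] [/= /andP[x1 xm]] /andP[xs sx'] unx]] := px.
rewrite -/x in x1 xm; move: xs sx'; rewrite /start /finish -/x => xs sx'.
have x1D := leD x1.
have [wD|wD] := ltrP (hi dy - lo dy + dur) D; last first.
  have wD' : D <= hi true - lo true + dur by move: wD (width true dy); lra.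
  exfalso.
  have [s [/andP[rs se] [/= /andP[_ _]]]] := private_wide px wD'.
  rewrite /start /finish -/x => /andP[xs1 xs2] [sl|sr]; last first.
    by have := hi_dl dx; lra.
  have lx0 : 0 <= lo dx by [].
  have [|[dz iz]] := singles (s := y * D); first by lra.
  case=> /= /andP[z1 zm]; rewrite /start /finish => /andP[zs sz] pz.
  have [s' [/andP[rs' se'] [/= _]]] := private_wide pz wD'.
  rewrite /start /finish; set zz : rat := iz%:~R in z1 zm zs sz *.
  move=> /andP[zs1 zs2].
  have := hi_dl dz; have := lo_ge0 dz.
  by move=> ? ? [sl'|sr']; lra.
have lx0 := lo_ge0 dx; have hx := hi_dl dx; have lhx := lo_hi dx.
have ly0 := lo_ge0 dy; have hy := hi_dl dy; have lhy := lo_hi dy.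
have lz0 := lo_ge0 (~~ dy); have hz := hi_dl (~~ dy); have lhz := lo_hi (~~ dy).
have wdt := width dy (~~ dy).
have [K kE] := partner_int dy iy; have := partnerP dy y.
rewrite /start kE; set kk : rat := K%:~R => /andP[k1 k2].
have kky : kk <= m - 1 by apply: leD_inv; lra.
have kk1 : 1 <= kk by apply: leD_inv; lra.
have rsy : r <= y * D + lo dy - dur by lra.
have ney : kk * D + lo (~~ dy) < y * D + lo dy.
  rewrite lt_neqAle andbC; apply/andP; split; first by lra.
  (* intervals that start together also end together, by [width] *)
  apply/eqP => same; have [|[dz iz]] := singles (s := y * D + lo dy - dur); first by lra.
  case=> /= /andP[z1 zm]; rewrite /start /finish; set zz : rat := iz%:~R.
  move=> /andP[zs sz] [s [_ [/= _ c] un]].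
  move: c; rewrite /start /finish -/zz => /andP[c1 c2].
  have dn : (dy == ~~ dy) = false by case: (dy).
  have yz : dz = dy -> zz = y.
    move=> ?; subst dz; apply: le_anti; apply/andP; split; first by apply: leD_inv; lra.
    by rewrite ler_int; apply: lt_intS; rewrite -/y -/zz; apply: ltD; lra.
  have kz : dz = ~~ dy -> zz = kk.
    move=> ?; subst dz; apply: le_anti; apply/andP; split.
      by rewrite ler_int; apply: lt_intS; rewrite -/kk -/zz; apply: ltD; lra.
    by rewrite ler_int; apply: lt_intS; rewrite -/kk -/zz; apply: ltD; lra.
  have [dE|dE] : dz = dy \/ dz = ~~ dy by case: (dz); case: (dy); auto.
    have zE := yz dE; rewrite dE in c1 c2; rewrite zE in c1 c2.
    have cK : covers s (~~ dy, K).
      by split=> /=; [rewrite -/kk; lra | rewrite /start /finish -/kk; lra].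
    by have /(congr1 fst)/= := un _ cK; rewrite dE => /esym/eqP; rewrite dn.
  have zE := kz dE; rewrite dE in c1 c2; rewrite zE in c1 c2.
  have cy : covers s (dy, iy).
    by split=> /=; [rewrite -/y; lra | rewrite /start /finish -/y; lra].
  by have /(congr1 fst)/= := un _ cy; rewrite dE => /eqP; rewrite dn.
apply/privateP; rewrite /private_test /lows /highs kE -/y -/kk /=.
rewrite /start /finish !andbT.
have -> : (m < kk) = false by apply/negbTE; lra.
have -> : (kk < 0) = false by apply/negbTE; lra.
have -> : (1 <= kk <= m) by lra.
have -> : (0 <= kk) && (kk + 1 <= m) by lra.
have -> : 2 <= y by lra.
have -> : y + 1 <= m by lra.
rewrite /= !andbT.
by repeat (apply/andP; split); lra.
Qed.
End Tracks.

End Track.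
Import Track.

Local Close Scope ring_scope.

(** * Hitting sets along the block order *)

Module Blocks.

Section Hitting.
Variables (B n : nat) (act : nat -> bool) (hb : nat -> nat)
  (H : nat -> bool -> nat -> bool).

(** The picks in one block: direction and position within the block. *)
Definition pattern := {set bool * 'I_B}.

(** Picks in the blocks [g], [g + 1] and [g + 2], for a window at row [g]; the
    block in the middle is called its centre. *)
Definition window := (pattern * pattern * pattern)%type.
Implicit Types (X : nat -> pattern) (Y : pattern) (s : window) (j g h : nat).

Definition hit j b Y := [exists x in Y, H j x.1 (b * B + x.2)].
Definition window_hit j g s :=
  [|| hit j g s.1.1, hit j g.+1 s.1.2 | hit j g.+2 s.2].
Definition pending g s j := [&& act j, g.+3 <= hb j & ~~ window_hit j g s].

(** The value 0 can stand for the absence of pending jobs, because a pending job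
    does not end in block 0. *)
Definition first_pending g s :=
  foldl (fun h j => if pending g s j && ((h == 0) || (hb j < h)) then hb j else h)
    0 (iota 0 n).

(** By [localize], nonempty blocks are needed only up to three blocks before the
    end of a job; so these rows suffice, and there are at most four per job. *)
Definition relevant g :=
  has (fun j => [&& act j, g < hb j & hb j <= g + 4]) (iota 0 n).

(** If the block after the centre is empty, the next centre has to be one of the
    last four blocks up to the end of the first pending job; [gather_exists]
    justifies this restriction. *)
Definition follows g s g' s' :=
  [&& s'.1.2 != set0,
      (if s.2 == set0 then
         [&& g.+2 <= g', g' < first_pending g s, first_pending g s <= g' + 4
           & s'.1.1 == set0]
       else [&& g' == g.+1, s'.1.1 == s.1.2 & s'.1.2 == s.2]) &
      all (fun j => pending g s j && (hb j <= g'.+2) ==> window_hit j g' s')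
        (iota 0 n)].
Definition final g s := (s.2 == set0) && (first_pending g s == 0).

(** The length counts the picks of the centres only: every nonempty block is the
    centre of exactly one window. *)
Inductive route : nat -> window -> nat -> Prop :=
| RouteEnd g s : final g s -> route g s #|s.1.2|
| RouteStep g s g' s' c : follows g s g' s' -> relevant g' -> route g' s' c ->
    route g s (#|s.1.2| + c).

Lemma first_pendingP g s :
  (first_pending g s = 0 /\ forall j, j < n -> ~~ pending g s j) \/
  (exists2 j, j < n & [/\ pending g s j, first_pending g s = hb j &
     forall i, i < n -> pending g s i -> hb j <= hb i]).
Proof.
rewrite /first_pending; elim: n => [|k IH]; first by left.
rewrite -addn1 iotaD add0n foldl_cat /=; set h := foldl _ _ _ in IH *.
have [pk|npk] := boolP (pending g s k); rewrite /= ?addn1.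
  have k0 : 0 < hb k by case/and3P: pk => _; lia.
  case: IH => [[-> none]|[j jk [pj hE min]]]; right.
    exists k => //; split=> // i; rewrite ltnS leq_eqVlt => /orP[/eqP-> //|ik].
    by rewrite (negbTE (none i ik)).
  have j0 : 0 < hb j by case/and3P: pj => _; lia.
  rewrite hE -[hb j == 0]negbK -lt0n j0 /=; case: ltnP => hkj.
    exists k => //; split=> // i; rewrite ltnS leq_eqVlt => /orP[/eqP-> //|ik].
    by move=> /(min i ik); lia.
  exists j; first by lia.
  split=> // i; rewrite ltnS leq_eqVlt => /orP[/eqP-> //|]; exact: min.
case: IH => [[-> none]|[j jk [pj hE min]]]; [left|right].
  by split=> // i; rewrite ltnS leq_eqVlt => /orP[/eqP-> //|]; exact: none.
exists j; first by lia.
split=> // i; rewrite ltnS leq_eqVlt => /orP[/eqP->|]; last exact: min.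
by rewrite (negbTE npk).
Qed.

Hypothesis B_gt0 : 0 < B.
Hypothesis H_hb : forall j d q, j < n -> act j -> H j d q -> q %/ B <= hb j.
(* the block form of [private_core] *)
Hypothesis H_core : forall j d q d' q', j < n -> act j -> H j d q ->
  (q %/ B).+2 <= q' %/ B -> (q' %/ B).+2 <= hb j -> H j d' q'.
Hypothesis hb_ge6 : forall j, j < n -> act j -> 6 <= hb j.

Lemma hitP j b Y : reflect (exists2 x, x \in Y & H j x.1 (b * B + x.2)) (hit j b Y).
Proof. exact: (iffP exists_inP). Qed.

Lemma blockE b (r : 'I_B) : (b * B + r) %/ B = b.
Proof. by rewrite divnMDl // divn_small // addn0. Qed.

Lemma hit_le j b Y : j < n -> act j -> hit j b Y -> b <= hb j.
Proof. by move=> jn aj /hitP[x _ /(H_hb jn aj)]; rewrite blockE. Qed.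

Lemma hit_nonempty j b Y : hit j b Y -> Y != set0.
Proof. by case/hitP=> x xY _; apply/set0Pn; exists x. Qed.

Lemma hit_core j b Y c Z : j < n -> act j -> hit j b Y -> b.+2 <= c ->
  c.+2 <= hb j -> Z != set0 -> hit j c Z.
Proof.
move=> jn aj /hitP[x _ Hx] bc ch /set0Pn[z zZ]; apply/hitP; exists z => //.
by apply: (H_core z.1 jn aj Hx); rewrite !blockE.
Qed.

Variable M : nat.
Hypothesis hb_lt : forall j, j < n -> act j -> hb j < M.

Definition hitting X := forall j, j < n -> act j -> exists b, hit j b (X b).
Definition localized X := forall b, X b != set0 -> relevant b.-1 /\ 3 <= b < M.
Definition weight X g := \sum_(g <= b < M) #|X b|.

Lemma relevantP g : reflect (exists2 j, j < n & [&& act j, g < hb j & hb j <= g + 4])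
  (relevant g).
Proof.
apply: (iffP hasP) => -[j]; first by rewrite mem_iota => jn ?; exists j.
by move=> jn ?; exists j; rewrite // mem_iota.
Qed.

Lemma weightS X g : g < M -> weight X g = #|X g| + weight X g.+1.
Proof. by move=> gM; rewrite /weight big_ltn. Qed.

Lemma sum_indicator a b c : \sum_(a <= i < b) (i == c) <= 1.
Proof.
have -> : \sum_(a <= i < b) (i == c) = \sum_(a <= i < b | i == c) 1.
  by rewrite [RHS]big_mkcond; apply: eq_bigr => i _; case: eqP.
by rewrite sum1_count (count_uniq_mem c (iota_uniq _ _)) leq_b1.
Qed.

(** Exchanges all picks that lie from block [a] on and more than three blocks
    before [h] for one pick in block [h - 2]. *)
Definition gather X a h (z : bool * 'I_B) : nat -> pattern := fun b =>
  if (a <= b) && (b + 3 < h) then set0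
  else if b == h - 2 then z |: X b else X b.

Lemma gather_weight X a h z c a' : a <= c -> c + 3 < h -> X c != set0 ->
  a' <= c -> c < M -> weight (gather X a h z) a' <= weight X a'.
Proof.
move=> ac ch Xc a'c cM; rewrite -(leq_add2r 1).
have h1 : weight (gather X a h z) a' + \sum_(a' <= b < M) (b == c) <=
    weight X a' + \sum_(a' <= b < M) (b == h - 2).
  rewrite /weight -!big_split /=; apply: leq_sum => b _; rewrite /gather.
  have [->|bc] := eqVneq b c; first by rewrite ac ch /= cards0 add0n ltn_addr // card_gt0.
  case: ifP => [_|_]; first by rewrite cards0.
  case: eqP => _; last by [].
  by rewrite addn0 cardsU1 addnC leq_add2l leq_b1.
have h2 : 1 <= \sum_(a' <= b < M) (b == c).
  by rewrite (bigD1_seq c) ?mem_index_iota ?a'c ?iota_uniq //= eqxx.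
have := sum_indicator a' M (h - 2); lia.
Qed.

(** A job ending at [h] or later that is hit by a moved pick contains all of
    block [h - 2]. *)
Lemma gather_hit X a h z j b : j < n -> act j -> h <= hb j -> hit j b (X b) ->
  exists b', hit j b' (gather X a h z b').
Proof.
move=> jn aj hj hit1; have [/andP[ab bh]|nin] := boolP ((a <= b) && (b + 3 < h)).
  exists (h - 2); apply: (hit_core jn aj hit1); [lia | lia |].
  rewrite /gather eqxx; case: ifP => [|_]; first by lia.
  by apply/set0Pn; exists z; rewrite setU11.
exists b; rewrite /gather (negbTE nin).
by case: eqP => // _; move/hitP: hit1 => [x xX Hx]; apply/hitP; exists x; rewrite // inE xX orbT.
Qed.

(** A job that goes on beyond the window and contains a pick before it would
    contain the whole centre. *)
Lemma hit_late X g s j b : s = (X g, X g.+1, X g.+2) ->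
  X g.+1 != set0 \/ (forall b, b < g.+2 -> X b = set0) ->
  j < n -> pending g s j -> hit j b (X b) -> g.+3 <= b.
Proof.
move=> -> Xg jn /and3P[aj gj]; rewrite /window_hit /= => nw hb'.
have [//|bg] := leqP g.+3 b.
have [E|bg2] := eqVneq b g.+2; first by rewrite -E hb' !orbT in nw.
have [E|bg1] := eqVneq b g.+1; first by rewrite -E hb' !orbT in nw.
have [E|bg0] := eqVneq b g; first by rewrite -E hb' in nw.
case: Xg => [Xg|Xg]; last first.
  by have := hit_nonempty hb'; rewrite Xg ?eqxx //; lia.
have hg : hit j g.+1 (X g.+1) by apply: (hit_core jn aj hb') => //; lia.
by rewrite hg orbT in nw.
Qed.

Lemma weight_lt X b : localized X -> X b != set0 -> weight X b.+1 < weight X b.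
Proof.
move=> loc Xb; have [_ /andP[_ bM]] := loc _ Xb.
by rewrite (weightS X bM) -[X in X < _]add0n ltn_add2r card_gt0.
Qed.

Lemma localized_relevant X g : localized X -> X g.+1 != set0 -> relevant g.
Proof. by move=> loc /loc[]. Qed.

Lemma weight_le X a b : a <= b -> weight X b <= weight X a.
Proof.
move=> ab; have [bM|Mb] := leqP b M; last by rewrite /weight big_geq // ltnW.
by rewrite /weight (big_cat_nat (n := b) (m := a)) //= leq_addl.
Qed.

Lemma weight_center X g : localized X -> #|X g.+1| + weight X g.+2 <= weight X g.+1.
Proof.
move=> loc; have [gM|Mg] := ltnP g.+1 M; first by rewrite (weightS X gM).
have -> : X g.+1 = set0.
  by apply/eqP; apply/negPn/negP => /loc[_ /andP[_]]; lia.
by rewrite cards0 /weight !big_geq // ltnW.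
Qed.

Lemma first_pending_witness g s : first_pending g s != 0 ->
  exists2 j, j < n & [/\ pending g s j, first_pending g s = hb j &
     forall i, i < n -> pending g s i -> hb j <= hb i].
Proof. by case: (first_pendingP g s) => [[-> _]|]. Qed.

(** Take [h] to be the end of the first pending job. Any job ending before
    [h] is hit by the window or ends within it, so it does not depend on the
    later picks. *)
Lemma gather_exists X g s : hitting X -> localized X -> s = (X g, X g.+1, X g.+2) ->
  X g.+1 != set0 \/ (forall b, b < g.+2 -> X b = set0) ->
  first_pending g s != 0 ->
  exists X', [/\ hitting X', localized X', forall b, b < g.+3 -> X' b = X b,
    weight X' g.+2 <= weight X g.+2 &
    forall b, g.+3 <= b -> b + 3 < first_pending g s -> X' b = set0].
Proof.
move=> hX loc sE Xg /first_pending_witness[j0 j0n [pj0 hE hmin]].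
set h := first_pending g s in hE *.
have [/hasP[c]|none] := boolP (has (fun c => X c != set0) (index_iota g.+3 (h - 3))).
  rewrite mem_index_iota => /andP[gc ch] Xc.
  have ch3 : c + 3 < h by lia.
  have /set0Pn[z zX] := Xc; exists (gather X g.+3 h z); split.
  - move=> j jn aj; have [b hjb] := hX j jn aj.
    have [hj|jh] := leqP h (hb j); first exact: (gather_hit g.+3 z jn aj hj hjb).
    have npj : ~~ pending g s j.
      by apply/negP => /(hmin j jn); rewrite -hE leqNgt jh.
    move: npj; rewrite /pending aj /=.
    have same b' : b' < g.+3 -> gather X g.+3 h z b' = X b'.
      by move=> b'g; rewrite /gather leqNgt b'g /=; case: eqP => // ?; lia.
    have [gj|jg] /= := leqP g.+3 (hb j); last first.
      move=> _; exists b; rewrite same //.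
      exact: leq_ltn_trans (hit_le jn aj hjb) jg.
    rewrite negbK sE /window_hit /= => /or3P[] w.
    + by exists g; rewrite same //; lia.
    + by exists g.+1; rewrite same //; lia.
    + by exists g.+2; rewrite same //; lia.
  - move=> b; rewrite /gather; case: ifP => [_|_]; first by rewrite eqxx.
    case: (b =P h - 2) => [-> _|_]; last exact: loc.
    have /and3P[a0 _ _] := pj0; have hM := hb_lt j0n a0; rewrite -hE in hM.
    split; last by lia.
    by apply/relevantP; exists j0 => //; rewrite a0 -hE; lia.
  - move=> b bg; rewrite /gather leqNgt bg /=; case: eqP => // ?; lia.
  - have [_ /andP[_ cM]] := loc _ Xc.
    apply: (gather_weight z gc ch3 Xc) => //; lia.
  - by move=> b gb bh; rewrite /gather gb bh.
exists X; split=> // b gb bh; apply/eqP; apply: contraNT none => Xb.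
by apply/hasP; exists b; rewrite // mem_index_iota gb; lia.
Qed.

(** Induction along the nonempty blocks. A job that ends between two centres is
    hit by one of the two windows around them, by [hit_late]. *)
Theorem route_complete N X g s : weight X g.+2 < N ->
  hitting X -> localized X -> s = (X g, X g.+1, X g.+2) ->
  X g.+1 != set0 \/ (forall b, b < g.+2 -> X b = set0) ->
  exists2 c, route g s c & c <= weight X g.+1.
Proof.
elim: N X g s => [//|N IH] X g s wN hX loc sE Xg.
have s2E : s.2 = X g.+2 by rewrite sE.
have s1E : s.1.2 = X g.+1 by rewrite sE.
have [X2|X2] := eqVneq (X g.+2) set0; last first.
  have [|||||c rc cw] := IH X g.+1 (X g.+1, X g.+2, X g.+3) => //.
  - exact: leq_trans (weight_lt loc X2) _.
  - by left.
  exists (#|s.1.2| + c); last by rewrite s1E; have := weight_center g loc; lia.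
  apply: RouteStep rc; last exact: localized_relevant X2.
  rewrite /follows /= s2E (negbTE X2) s1E !eqxx /=.
  apply/allP => j; rewrite mem_iota add0n => /= jn; apply/implyP => /andP[pj hj].
  have /and3P[aj gj _] := pj; have [b hjb] := hX j jn aj.
  have gb := hit_late sE Xg jn pj hjb; have bj := hit_le jn aj hjb.
  have bE : b = g.+3 by lia.
  by rewrite /window_hit /= -bE hjb !orbT.
have [h0|h0] := eqVneq (first_pending g s) 0.
  exists #|s.1.2|; first by apply: RouteEnd; rewrite /final s2E X2 h0 !eqxx.
  by rewrite s1E; have := weight_center g loc; lia.
have [X' [hX' loc' same w' emp]] := gather_exists hX loc sE Xg h0.
have [j0 j0n [pj0 hE hmin]] := first_pending_witness h0.
have sE' : s = (X' g, X' g.+1, X' g.+2) by rewrite sE !same //; lia.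
have Xg' : X' g.+1 != set0 \/ (forall b, b < g.+2 -> X' b = set0).
  case: Xg => Xg; first by left; rewrite same.
  by right=> b bg; rewrite same ?Xg //; lia.
have /and3P[aj0 gj0 _] := pj0.
have [b0 hb0] := hX' j0 j0n aj0.
have gb0 := hit_late sE' Xg' j0n pj0 hb0; have b0j := hit_le j0n aj0 hb0.
(* the next nonempty block is the next centre *)
have ex : exists b, (g.+3 <= b) && (X' b != set0).
  by exists b0; rewrite gb0 (hit_nonempty hb0).
pose b1 := ex_minn ex; have [/andP[gb1 Xb1] b1min] : (g.+3 <= b1) && (X' b1 != set0) /\
   forall b, (g.+3 <= b) && (X' b != set0) -> b1 <= b.
  by rewrite /b1; case: ex_minnP.
have b10 : b1 <= b0 by apply: b1min; rewrite gb0 (hit_nonempty hb0).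
case: b1 b1min gb1 Xb1 b10 => // g' b1min gb1 Xb1 b10.
have X'g' : X' g' = set0.
  have [E|ne] := eqVneq g' g.+2; first by rewrite E same.
  by apply/eqP; apply: contraTT isT => X'g'; have := b1min g'; rewrite X'g' andbT; lia.
have hg : first_pending g s <= g' + 4.
  by rewrite leqNgt; apply: contra Xb1 => hg; rewrite emp ?eqxx //; lia.
have [|||||c rc cw] := IH X' g' (X' g', X' g'.+1, X' g'.+2) => //.
- apply: leq_trans (weight_lt loc' Xb1) _.
  have := weight_le X' (a := g.+2) (b := g'.+1); lia.
- by left.
exists (#|s.1.2| + c); last first.
  rewrite s1E; have := weight_center g loc; have := weight_le X' (a := g.+2) (b := g'.+1); lia.
apply: RouteStep rc; last exact: localized_relevant Xb1.
rewrite /follows /= s2E X2 eqxx Xb1 X'g' eqxx hg hE /=; apply/andP; split.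
  by apply/and3P; split=> //; lia.
apply/allP => j; rewrite mem_iota add0n => /= jn; apply/implyP => /andP[pj hj].
have /and3P[aj gj _] := pj; have [b hjb] := hX' j jn aj.
have gb := hit_late sE' Xg' jn pj hjb; have bj := hit_le jn aj hjb.
have := b1min b; rewrite gb (hit_nonempty hjb) => /(_ isT) g'b.
rewrite /window_hit /=; have [bE|ne] := eqVneq b g'.+1; first by rewrite -bE hjb !orbT.
have bE : b = g'.+2 by lia.
by rewrite -bE hjb !orbT.
Qed.

(** A pick more than three blocks before the end of every job that it hits can
    be replaced by one that is two blocks before the first of these ends. *)
Lemma localize (S : seq (bool * nat)) : exists X, [/\ localized X,
   forall j x, j < n -> act j -> x \in S -> H j x.1 x.2 -> exists b, hit j b (X b) &
   weight X 0 <= size S].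
Proof.
elim: S => [|x S [X [loc hX wX]]].
  exists (fun=> set0); split=> //; first by move=> b; rewrite eqxx.
  by rewrite /weight big1 // => i _; rewrite cards0.
have add y : relevant (y.2 %/ B).-1 -> 3 <= y.2 %/ B < M ->
    exists X', [/\ localized X', forall j, j < n -> H j y.1 y.2 -> exists b, hit j b (X' b),
     forall j b, hit j b (X b) -> hit j b (X' b) & weight X' 0 <= (size S).+1].
  move=> rel bM; pose z : bool * 'I_B := (y.1, Ordinal (ltn_pmod y.2 B_gt0)).
  exists (fun b => if b == y.2 %/ B then z |: X b else X b); split.
  - by move=> b; case: (b =P y.2 %/ B) => [-> _|_]; [|exact: loc].
  - move=> j jn Hj; exists (y.2 %/ B); rewrite eqxx; apply/hitP; exists z.
      by rewrite setU11.
    by rewrite /= -divn_eq.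
  - move=> j b /hitP[w wX' Hw]; apply/hitP; exists w => //.
    by case: eqP => // _; rewrite inE wX' orbT.
  - apply: leq_trans (_ : \sum_(0 <= b < M) #|X b| + 1 <= _); last by rewrite addn1.
    apply: leq_trans (_ : \sum_(0 <= b < M) (#|X b| + (b == y.2 %/ B)) <= _).
      by apply: leq_sum => b _; case: eqP => _; rewrite ?addn0 // cardsU1 addnC leq_add2l leq_b1.
    by rewrite big_split /= leq_add2l sum_indicator.
have [/hasP[j0]|none] := boolP (has (fun j => act j && H j x.1 x.2) (iota 0 n)); last first.
  exists X; split=> //; last exact: leqW.
  move=> j y jn aj; rewrite inE => /orP[/eqP->|yS Hy]; last exact: hX yS Hy.
  by move=> Hx; case/hasP: none; exists j; rewrite ?mem_iota // aj.
rewrite mem_iota add0n => /= j0n /andP[aj0 Hj0].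
have ex : exists h, has (fun j => [&& act j, H j x.1 x.2 & hb j == h]) (iota 0 n).
  by exists (hb j0); apply/hasP; exists j0; rewrite ?mem_iota // aj0 Hj0 eqxx.
case: (ex_minnP ex) => h /hasP[j1]; rewrite mem_iota add0n => /= j1n /and3P[aj1 Hj1 /eqP hE] hmin.
have {}hmin j : j < n -> act j -> H j x.1 x.2 -> h <= hb j.
  by move=> jn aj Hj; apply: hmin; apply/hasP; exists j; rewrite ?mem_iota // aj Hj eqxx.
have h6 := hb_ge6 j1n aj1; have hM := hb_lt j1n aj1; rewrite hE in h6 hM.
have xh := H_hb j1n aj1 Hj1; rewrite hE in xh.
have [near|far] := leqP h (x.2 %/ B + 3).
  have [||X' [loc' h1 h2 w']] := add x; [|lia|].
    by apply/relevantP; exists j1; rewrite // aj1 hE; lia.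
  exists X'; split=> // j y jn aj; rewrite inE => /orP[/eqP->|yS Hy]; first exact: h1.
  by have [b /h2 hb'] := hX j y jn aj yS Hy; exists b.
pose y : bool * nat := (true, (h - 2) * B).
have yE : y.2 %/ B = h - 2 by rewrite mulnK.
have [||X' [loc' h1 h2 w']] := add y; rewrite ?yE; [|lia|].
  by apply/relevantP; exists j1; rewrite // aj1 hE; lia.
exists X'; split=> // j w jn aj; rewrite inE => /orP[/eqP->|wS Hw]; last first.
  by have [b /h2 hb'] := hX j w jn aj wS Hw; exists b.
move=> Hx; apply: h1 => //; apply: (H_core _ jn aj Hx); rewrite yE; first lia.
have := hmin j jn aj Hx; lia.
Qed.

Theorem route_optimal (S : seq (bool * nat)) :
  (forall j, j < n -> act j -> exists2 x, x \in S & H j x.1 x.2) ->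
  exists2 c, route 0 (set0, set0, set0) c & c <= size S.
Proof.
move=> hS; have [X [loc hX wX]] := localize S.
have emp b : b < 3 -> X b = set0.
  by move=> b3; apply/eqP; apply: contraTT isT => /loc[_]; lia.
have [|||||c rc cw] := @route_complete (weight X 2).+1 X 0 (set0, set0, set0) => //.
- by move=> j jn aj; have [x xS Hx] := hS j jn aj; apply: hX xS Hx.
- by rewrite !emp.
- by right=> b b2; apply: emp; lia.
exists c => //; apply: leq_trans cw (leq_trans _ wX); exact: weight_le.
Qed.
End Hitting.

End Blocks.
Import Blocks.

(** * Reasoning about programs and their running time *)

Definition TTrue := TLe (EConst 0) (EConst 0).
Definition TOr b1 b2 := TNot (TAnd (TNot b1) (TNot b2)).
Definition TImp b1 b2 := TNot (TAnd b1 (TNot b2)).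
Definition TLt e1 e2 := TNot (TLe e2 e1).
Definition TEq e1 e2 := TAnd (TLe e1 e2) (TLe e2 e1).
Definition TAll := foldr TAnd TTrue.
Definition THas := foldr TOr (TNot TTrue).
Definition ENat (k : nat) := EConst k%:R.
Definition seqs := foldr Seq Skip.

Lemma evalt_And st b1 b2 : evalt st (TAnd b1 b2) = evalt st b1 && evalt st b2.
Proof. by []. Qed.

Lemma evalt_Not st b : evalt st (TNot b) = ~~ evalt st b.
Proof. by []. Qed.

Lemma evalt_Le st e1 e2 : evalt st (TLe e1 e2) = (eval st e1 <= eval st e2)%R.
Proof. by []. Qed.

Lemma evalt_Or st b1 b2 : evalt st (TOr b1 b2) = evalt st b1 || evalt st b2.
Proof. by rewrite /= negb_and !negbK. Qed.

Lemma evalt_Imp st b1 b2 : evalt st (TImp b1 b2) = (evalt st b1 ==> evalt st b2).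
Proof. by rewrite /= negb_and negbK implybE. Qed.

Lemma evalt_Lt st e1 e2 : evalt st (TLt e1 e2) = (eval st e1 < eval st e2)%R.
Proof. by rewrite /= ltNge. Qed.

Lemma evalt_Eq st e1 e2 : evalt st (TEq e1 e2) = (eval st e1 == eval st e2).
Proof. by rewrite /= eq_le. Qed.

Lemma evalt_Has st (T : Type) (f : T -> test) l :
  evalt st (THas (map f l)) = has (fun x => evalt st (f x)) l.
Proof. by elim: l => // x l IH; rewrite [map _ _]/= [THas _]/(TOr _ _) evalt_Or IH. Qed.

Section WP.
Variable M : nat.

(** A bound for the running time under the assumption that every execution of
    a loop makes at most [M] iterations. *)
Fixpoint cost (c : prog) : nat :=
  match c with
  | Skip => 1
  | SetVar _ e => (ecost e).+1
  | SetArr _ i e => (ecost i + ecost e).+1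
  | Seq c1 c2 => cost c1 + cost c2
  | If b c1 c2 => (tcost b + (cost c1 + cost c2)).+1
  | While b c => M.+1 * (tcost b + cost c).+1
  end.

(** Total correctness, with the time bound determined by the program. *)
Definition wp (c : prog) (Q : store -> Prop) (st : store) : Prop :=
  exists t st', [/\ exec c st t st', t <= cost c & Q st'].

Lemma wp_mono c (Q R : store -> Prop) st :
  wp c Q st -> (forall st', Q st' -> R st') -> wp c R st.
Proof. by case=> t [st' [e le q]] QR; exists t, st'; split=> //; apply: QR. Qed.

Lemma wp_skip (Q : store -> Prop) st : Q st -> wp Skip Q st.
Proof. by exists 1, st; split=> //; constructor. Qed.

Lemma wp_var x e (Q : store -> Prop) st :
  Q (set_var st x (eval st e)) -> wp (SetVar x e) Q st.
Proof. by eexists; eexists; split; [constructor| |eassumption]. Qed.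

Lemma wp_arr a i e (Q : store -> Prop) st :
  Q (set_arr st a (Num.truncn (eval st i)) (eval st e)) -> wp (SetArr a i e) Q st.
Proof. by eexists; eexists; split; [constructor| |eassumption]. Qed.

Lemma wp_seq c1 c2 Q st : wp c1 (wp c2 Q) st -> wp (Seq c1 c2) Q st.
Proof.
case=> t1 [st1 [e1 l1 [t2 [st2 [e2 l2 q]]]]]; exists (t1 + t2), st2; split=> //.
  by econstructor; eassumption.
exact: leq_add.
Qed.

Lemma wp_if b c1 c2 Q st : (evalt st b -> wp c1 Q st) ->
  (~~ evalt st b -> wp c2 Q st) -> wp (If b c1 c2) Q st.
Proof.
move=> h1 h2; have [eb|eb] := boolP (evalt st b).
  have [t [st' [e l q]]] := h1 eb; exists (tcost b + t).+1, st'; split=> //=.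
    exact: ExecIfT.
  by rewrite ltnS leq_add2l; apply: leq_trans l (leq_addr _ _).
have [t [st' [e l q]]] := h2 eb; exists (tcost b + t).+1, st'; split=> //=.
  exact: ExecIfF.
by rewrite ltnS leq_add2l; apply: leq_trans l (leq_addl _ _).
Qed.

(** The number [k] bounds the remaining iterations. *)
Lemma wp_while b c (Inv : nat -> store -> Prop) k st (Q : store -> Prop) :
  k <= M -> Inv k st ->
  (forall k st, Inv k st -> evalt st b ->
     wp c (fun st' => exists2 k', k' < k & Inv k' st') st) ->
  (forall k st, Inv k st -> ~~ evalt st b -> Q st) ->
  wp (While b c) Q st.
Proof.
move=> kM inv body post.
suff [t [st' [e l q]]] : exists t st',
    [/\ exec (While b c) st t st', t <= k.+1 * (tcost b + cost c).+1 & Q st'].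
  by exists t, st'; split=> //; apply: leq_trans l _; rewrite [cost _]/= leq_mul2r ltnS kM orbT.
move: {kM}k {-2}k (leqnn k) st inv => K; elim: K => [|K IH] k kK st inv.
  have -> : k = 0 by lia.
  have [eb|eb] := boolP (evalt st b).
    by have [t [st' [_ _ [k']]]] := body _ _ inv eb; lia.
  exists (tcost b).+1, st; split; [exact: ExecWhileF | | exact: post inv eb].
  by rewrite mul1n ltnS leq_addr.
have [eb|eb] := boolP (evalt st b); last first.
  exists (tcost b).+1, st; split; [exact: ExecWhileF | | exact: post inv eb].
  by rewrite mulSn; apply: leq_trans (leq_addr _ _); rewrite ltnS leq_addr.
have [t1 [st1 [e1 l1 [k' k'k inv']]]] := body _ _ inv eb.
have k'K : k' <= K by lia.
have [t2 [st2 [e2 l2 q]]] := IH k' k'K st1 inv'.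
exists (tcost b + t1 + t2).+1, st2; split=> //; first exact: ExecWhileT e1 e2.
have l3 : k'.+1 * (tcost b + cost c).+1 <= k * (tcost b + cost c).+1.
  by rewrite leq_mul2r k'k orbT.
rewrite mulSn; lia.
Qed.

(** A syntactic check, from which [exec_frame] derives what an execution leaves
    unchanged. *)
Fixpoint writes (vs ars : pred nat) (c : prog) : bool :=
  match c with
  | Skip => true
  | SetVar x _ => vs x
  | SetArr a _ _ => ars a
  | Seq c1 c2 | If _ c1 c2 => writes vs ars c1 && writes vs ars c2
  | While _ c => writes vs ars c
  end.

Definition frame (vs ars : pred nat) st st' :=
  (forall x, ~~ vs x -> scal st' x = scal st x) /\
  (forall a, ~~ ars a -> arr st' a = arr st a).

Lemma exec_frame vs ars c st t st' : exec c st t st' -> writes vs ars c ->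
  frame vs ars st st'.
Proof.
elim=> {c st t st'} //=.
- move=> x e st vx; split=> //= y; rewrite /upd; case: eqP => // ->.
  by rewrite vx.
- move=> a i e st aa; split=> //= y; rewrite /upd; case: eqP => // ->.
  by rewrite aa.
- move=> c1 c2 t1 t2 st st1 st2 _ h1 _ h2 /andP[/h1[f1 g1] /h2[f2 g2]].
  by split=> x nx; rewrite ?f2 ?g2 // ?f1 ?g1.
- by move=> b c1 c2 t st st' _ _ h /andP[/h].
- by move=> b c1 c2 t st st' _ _ h /andP[_ /h].
- move=> b c t1 t2 st st1 st2 _ _ h1 _ h2 w; have [f1 g1] := h1 w.
  by have [f2 g2] := h2 w; split=> x nx; rewrite ?f2 ?g2 // ?f1 ?g1.
Qed.

Lemma wp_frame vs ars c Q st : writes vs ars c -> wp c Q st ->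
  wp c (fun st' => Q st' /\ frame vs ars st st') st.
Proof.
by move=> w [t [st' [e l q]]]; exists t, st'; split=> //; split=> //; apply: exec_frame e w.
Qed.

Lemma writes_sub (vs vs' ars ars' : pred nat) c : subpred vs vs' -> subpred ars ars' ->
  writes vs ars c -> writes vs' ars' c.
Proof.
move=> sv sa; elim: c => //=; try by [move=> x e /sv | move=> a i e /sa].
- by move=> c1 h1 c2 h2 /andP[/h1-> /h2->].
- by move=> _ c1 h1 c2 h2 /andP[/h1-> /h2->].
Qed.

Lemma writes_seqs vs ars (T : Type) (f : T -> prog) l :
  all (fun x => writes vs ars (f x)) l -> writes vs ars (seqs (map f l)).
Proof. by elim: l => //= x l IH /andP[-> /IH]. Qed.

Lemma wp_seqs (T : Type) (f : T -> prog) (Inv : seq T -> store -> Prop) l st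
    (Q : store -> Prop) :
  Inv [::] st ->
  (forall l1 x l2 st, l = l1 ++ x :: l2 -> Inv l1 st -> wp (f x) (Inv (rcons l1 x)) st) ->
  (forall st', Inv l st' -> Q st') -> wp (seqs (map f l)) Q st.
Proof.
move=> i0 step post; move: i0.
suff H l2 : forall l1 st, l = l1 ++ l2 -> Inv l1 st -> wp (seqs (map f l2)) Q st.
  by move=> i0; apply: (H l [::] st).
elim: l2 => [|x l2 IH] l1 st' lE inv /=.
  by apply: wp_skip; apply: post; rewrite lE cats0.
apply: wp_seq; apply: wp_mono (step _ _ _ _ lE inv) _ => st2.
by apply: IH; rewrite cat_rcons.
Qed.

(** All loops over the jobs can share variable 5, since none of them contains
    another one; variable 4 holds the number of jobs. *)
Definition For (body : prog) : prog :=
  Seq (SetVar 5 (EConst 0))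
    (While (TLt (EVar 5) (EVar 4)) (Seq body (SetVar 5 (EAdd (EVar 5) (EConst 1))))).

Lemma wp_for n body (Inv : nat -> store -> Prop) st (Q : store -> Prop) :
  n <= M -> scal st 4 = n%:R%R ->
  (forall j st v, Inv j st -> Inv j (set_var st 5 v)) ->
  writes [pred x | (x != 5) && (x != 4)] xpredT body ->
  Inv 0 st ->
  (forall j st, j < n -> scal st 5 = j%:R%R -> Inv j st -> wp body (Inv j.+1) st) ->
  (forall st', Inv n st' -> Q st') -> wp (For body) Q st.
Proof.
move=> nM s4 irr wr i0 step post; apply: wp_seq; apply: wp_var => /=.
pose I2 k st' := exists j, [/\ j + k = n, scal st' 5 = j%:R%R, scal st' 4 = n%:R%R & Inv j st'].
apply: (@wp_while _ _ I2 n) => //.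
- by exists 0; split=> //; apply: irr.
- move=> k st1 [j [jk s5 s4' inv]] ev.
  have jn : j < n by move: ev; rewrite evalt_Lt /= s5 s4' ltr_nat.
  apply: wp_seq; apply: wp_mono (wp_frame wr (step j st1 jn s5 inv)) _ => st2 [inv2 [f _]].
  apply: wp_var; exists k.-1; first by lia.
  exists j.+1; split; first by lia.
  + by rewrite /= /upd eqxx f // s5 natr1.
  + by rewrite /= /upd /= f.
  + exact: irr.
- move=> k st1 [j [jk s5 s4' inv]]; rewrite evalt_Lt /= s5 s4' ltr_nat => jn.
  by apply: post; have <- : j = n by lia.
Qed.

Fixpoint depth (c : prog) : nat :=
  match c with
  | Skip | SetVar _ _ | SetArr _ _ _ => 0
  | Seq c1 c2 | If _ c1 c2 => maxn (depth c1) (depth c2)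
  | While _ c => (depth c).+1
  end.
End WP.

(** The factor [cost 0 c] depends on the program only. *)
Lemma cost_pow M c d : depth c <= d -> cost M c <= cost 0 c * M.+1 ^ d.
Proof.
have pos k : 0 < M.+1 ^ k by rewrite expn_gt0.
elim: c d => /=; try by move=> *; rewrite leq_pmulr.
- by move=> c1 h1 c2 h2 d; rewrite geq_max => /andP[/h1 l1 /h2 l2]; rewrite mulnDl leq_add.
- move=> b c1 h1 c2 h2 d; rewrite geq_max => /andP[/h1 l1 /h2 l2].
  by rewrite mulSn !mulnDl -add1n !leq_add // ?leq_pmulr.
- move=> b c h [//|d] /h l; rewrite mul1n expnS mulnCA leq_mul2l /=.
  by rewrite mulSn mulnDl -add1n !leq_add // ?leq_pmulr.
Qed.

(** * Evaluating the tests of a job *)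

Notation vJob := 5 (only parsing).
Notation vRow := 6 (only parsing).
Notation vPend := 7 (only parsing).
Notation vTarget := 8 (only parsing).
Notation vOk := 9 (only parsing).
Notation vBest := 10 (only parsing).
Notation vPrev := 11 (only parsing).
Notation vCode := 12 (only parsing).
Notation vTmp := 13 (only parsing).
Notation vCur := 14 (only parsing).
Notation vNext := 15 (only parsing).
Notation aOut := 5 (only parsing).
Notation aAct := 6 (only parsing).
Notation aEnd := 7 (only parsing).

(** Data of the current job. The tests below are copies of [private_test] and
    [discard_test] in the language of programs. *)
Definition eJob a := EGet a (EVar vJob).
Definition eRel := eJob 0.
Definition eEnd := ESub (eJob 1) (eJob 2).
Definition eLo (d : bool) := if d then EDiv (EMul (eJob 3) (EVar 2)) (EVar 0)
  else ESub (EVar 2) (EDiv (EMul (eJob 4) (EVar 2)) (EVar 0)).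
Definition eHi (d : bool) := if d then EDiv (EMul (eJob 4) (EVar 2)) (EVar 0)
  else ESub (EVar 2) (EDiv (EMul (eJob 3) (EVar 2)) (EVar 0)).
Definition eStart d i := ESub (EAdd (EMul i (EVar 1)) (eLo d)) (eJob 2).
Definition eFinish d i := EAdd (EMul i (EVar 1)) (eHi d).
Definition eLast d z :=
  EFloor (EDiv (EAdd (ESub z (eLo d)) (eJob 2)) (EVar 1)).
Definition ePartner d i := EAdd i (EFloor (EDiv (ESub (eLo d) (eLo (~~ d))) (EVar 1))).

Definition tLows d i : seq (test * expr) :=
  let k := ePartner d i in
  [:: (TLe (ENat 2) i, eFinish d (ESub i (ENat 1)));
      (TAnd (TLe (ENat 1) k) (TLe k (EVar 3)), eFinish (~~ d) k);
      (TLt (EVar 3) k, eFinish (~~ d) (EVar 3))].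
Definition tHighs d i : seq (test * expr) :=
  let k := ePartner d i in
  [:: (TLe (EAdd i (ENat 1)) (EVar 3), eStart d (EAdd i (ENat 1)));
      (TAnd (TLe (ENat 0) k) (TLe (EAdd k (ENat 1)) (EVar 3)),
       eStart (~~ d) (EAdd k (ENat 1)));
      (TLt k (ENat 0), eStart (~~ d) (ENat 1))].
Definition tPrivate d i : test :=
  TAnd (TLe (ENat 1) i) (TAnd (TLe i (EVar 3)) (TAnd (TLe eRel (eFinish d i))
    (TAnd (TLe (eStart d i) eEnd)
    (TAnd (TAll [seq TImp l.1 (TAnd (TLt l.2 eEnd) (TLt l.2 (eFinish d i))) | l <- tLows d i])
    (TAnd (TAll [seq TImp h.1 (TAnd (TLt eRel h.2) (TLt (eStart d i) h.2)) | h <- tHighs d i])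
       (TAll [seq TAll [seq TImp l.1 (TImp h.1 (TLt l.2 h.2)) | h <- tHighs d i]
             | l <- tLows d i])))))).

Definition tCoveredAt z d :=
  let f := eLast d z in
  TOr (TAnd (TAnd (TLe (ENat 1) f) (TLe f (EVar 3))) (TLe z (eFinish d f)))
      (TAnd (TLt (EVar 3) f) (TLe z (eFinish d (EVar 3)))).
Definition tCoveredAfter z d :=
  let f := eLast d z in
  TOr (TAnd (TAnd (TLe (ENat 1) f) (TLe f (EVar 3))) (TLt z (eFinish d f)))
      (TAnd (TLt (EVar 3) f) (TLt z (eFinish d (EVar 3)))).
Definition tGapAfter z :=
  TAnd (TLe eRel z) (TAnd (TLt z eEnd)
    (TAnd (TNot (tCoveredAfter z true)) (TNot (tCoveredAfter z false)))).
Definition eCandidates (k : nat) : seq expr :=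
  [seq EAdd (ESub (EFloor (EDiv eRel (EVar 1))) (ENat k)) (ENat o) | o <- iota 0 k.+2] ++
  [seq EAdd (ESub (EVar 3) (ENat k)) (ENat o) | o <- iota 0 k.+1].
Definition tDiscard k :=
  TOr (TAnd (TNot (tCoveredAt eRel true)) (TNot (tCoveredAt eRel false)))
    (THas [seq TOr (tGapAfter (eFinish true q)) (tGapAfter (eFinish false q))
          | q <- eCandidates k]).

(** Cells beyond the last job contain 0, as if they belonged to the default
    job. *)
Definition jobn (I : instance) (j : nat) : job :=
  if insub j is Some o then @job_of I o else Job 0 0 0 0 0.

Section Data.
Variables (I : instance) (j : nat).
Definition jD := headway I.
Definition jr := release (jobn I j).
Definition jdur := duration (jobn I j).
Definition je := (deadline (jobn I j) - jdur)%R.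
Definition jm : rat := (npaths I)%:R%R.
Definition jlo (d : bool) : rat := (if d then loc_start (jobn I j) * travel I / corridor I
  else travel I - loc_end (jobn I j) * travel I / corridor I)%R.
Definition jhi (d : bool) : rat := (if d then loc_end (jobn I j) * travel I / corridor I
  else travel I - loc_start (jobn I j) * travel I / corridor I)%R.
End Data.

Definition inputs (I : instance) st :=
  (forall x, x < 5 -> scal st x = input_scal I x) /\
  (forall a i, a < 5 -> arr st a i = input_arr I a i).

Lemma inputs_job I st a j : inputs I st -> a < 5 ->
  arr st a j = nth 0%R [:: release (jobn I j); deadline (jobn I j); duration (jobn I j);
     loc_start (jobn I j); loc_end (jobn I j)] a.
Proof.
case=> _ h a5; rewrite h // /input_arr /jobn; case: insub => //.
by case: a a5 => [|[|[|[|[|]]]]].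
Qed.

Lemma eval_ops st : ((forall a b, eval st (EAdd a b) = (eval st a + eval st b)%R) *
  (forall a b, eval st (ESub a b) = (eval st a - eval st b)%R) *
  (forall a b, eval st (EMul a b) = (eval st a * eval st b)%R) *
  (forall a b, eval st (EDiv a b) = (eval st a / eval st b)%R) *
  (forall a, eval st (EFloor a) = (Num.floor (eval st a))%:~R%R) *
  (forall k, eval st (ENat k) = k%:R%R) *
  (forall a b, evalt st (TLe a b) = (eval st a <= eval st b)%R) *
  (forall a b, evalt st (TLt a b) = (eval st a < eval st b)%R) *
  (forall a b, evalt st (TAnd a b) = evalt st a && evalt st b) *
  (forall a b, evalt st (TOr a b) = evalt st a || evalt st b) *
  (forall a b, evalt st (TImp a b) = (evalt st a ==> evalt st b)) *
  (forall a, evalt st (TNot a) = ~~ evalt st a))%type.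
Proof.
by do !split=> // *; rewrite ?evalt_Lt ?evalt_Or ?evalt_Imp.
Qed.

Section Eval.
Variables (I : instance) (st : store) (j : nat).
Hypotheses (inp : inputs I st) (vj : scal st vJob = j%:R%R).
Local Open Scope ring_scope.

Lemma eval_job a : eval st (eJob a) = arr st a j.
Proof. by rewrite /= vj natrK. Qed.

Lemma eval_rel : eval st eRel = jr I j.
Proof. by rewrite eval_job (inputs_job _ inp). Qed.

Lemma eval_end : eval st eEnd = je I j.
Proof. by rewrite /eEnd eval_ops !eval_job !(inputs_job _ inp). Qed.

Lemma eval_lo d : eval st (eLo d) = jlo I j d.
Proof.
by case: inp => s _; case: d; rewrite /eLo !eval_ops !eval_job !(inputs_job _ inp) // /= !s.
Qed.

Lemma eval_hi d : eval st (eHi d) = jhi I j d.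
Proof.
by case: inp => s _; case: d; rewrite /eHi !eval_ops !eval_job !(inputs_job _ inp) // /= !s.
Qed.

Lemma eval_dur : eval st (eJob 2) = jdur I j.
Proof. by rewrite eval_job (inputs_job _ inp). Qed.

Lemma eval_D : eval st (EVar 1) = jD I. Proof. by case: inp => s _; rewrite /= s. Qed.

Lemma eval_m : eval st (EVar 3) = jm I. Proof. by case: inp => s _; rewrite /= s. Qed.

Definition evalE := (eval_ops st, eval_rel, eval_end, eval_lo, eval_hi, eval_dur, eval_D, eval_m).

Lemma eval_start d i : eval st (eStart d i) = start (jD I) (jdur I j) (jlo I j) d (eval st i).
Proof. by rewrite /eStart !evalE. Qed.

Lemma eval_finish d i : eval st (eFinish d i) = finish (jD I) (jhi I j) d (eval st i).
Proof. by rewrite /eFinish !evalE. Qed.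

Lemma eval_last d z :
  eval st (eLast d z) = last_start (jD I) (jdur I j) (jlo I j) d (eval st z).
Proof. by rewrite /eLast !evalE. Qed.

Lemma eval_partner d i : eval st (ePartner d i) = partner (jD I) (jlo I j) d (eval st i).
Proof. by rewrite /ePartner !evalE. Qed.

Definition trackE := (evalE, eval_start, eval_finish, eval_last, eval_partner).

Lemma evalt_private d i : evalt st (tPrivate d i) =
  private_test (jD I) (jr I j) (je I j) (jdur I j) (jm I) (jlo I j) (jhi I j) d (eval st i).
Proof.
by rewrite /tPrivate !trackE /private_test /lows /highs /= /start /finish lexx.
Qed.

Lemma evalt_gap z : evalt st (tGapAfter z) =
  gap_after (jD I) (jr I j) (je I j) (jdur I j) (jm I) (jlo I j) (jhi I j) (eval st z).
Proof. by rewrite /tGapAfter !trackE. Qed.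

Lemma evalt_discard k : evalt st (tDiscard k) =
  discard_test (jD I) (jr I j) (je I j) (jdur I j) (jm I) (jlo I j) (jhi I j) k.
Proof.
rewrite /tDiscard evalt_Or evalt_Has /discard_test.
congr (_ || _); first by rewrite !trackE.
have -> : gap_candidates (jD I) (jr I j) (jm I) k = map (eval st) (eCandidates k).
  rewrite /eCandidates /gap_candidates map_cat -!map_comp; congr (_ ++ _).
    by apply: eq_map => o; rewrite /comp !evalE.
  by apply: eq_map => o; rewrite /comp !evalE.
rewrite has_map; apply: eq_has => q.
by rewrite evalt_Or !evalt_gap !eval_finish.
Qed.
End Eval.

Lemma floor_natr (x : rat) : (0 <= x)%R -> (Num.floor x)%:~R%R = (Num.truncn x)%:R%R :> rat.
Proof.
move=> x0; rewrite truncn_floor x0 -[(_%:R)%R]/((`|Num.floor x|%N)%:~R)%R gez0_abs //.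
by rewrite floor_ge0.
Qed.

Lemma floor_divn (a b : nat) : 0 < b -> (Num.floor (a%:R / b%:R : rat))%:~R%R = (a %/ b)%:R%R :> rat.
Proof.
move=> b0; rewrite floor_natr ?divr_ge0 ?ler0n //; congr _%:R%R.
have b0' : (0 < b%:R :> rat)%R by rewrite ltr0n.
apply/eqP; rewrite eqn_leq truncn_le_nat ltr_pdivrMr // -natrM ltr_nat.
rewrite truncn_ge_nat ?divr_ge0 ?ler0n // ler_pdivlMr // -natrM ler_nat.
by rewrite leq_divM -ltn_divLR // ltnSn.
Qed.

Lemma upd_eq (T : Type) (f : nat -> T) x v : upd f x v x = v.
Proof. by rewrite /upd eqxx. Qed.

Lemma upd_ne (T : Type) (f : nat -> T) x v y : y != x -> upd f x v y = f y.
Proof. by rewrite /upd => /negbTE ->. Qed.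

Section Prepare.
Variables (I : instance) (k : nat).
Hypothesis valid : valid_instance I.
Notation B := (2 * k + 3).

Definition active j := ~~ discard_test (jD I) (jr I j) (je I j) (jdur I j) (jm I) (jlo I j) (jhi I j) k.

(** A path of index [i] is under way only after [i] headways, so a job cannot
    meet it if its deadline is earlier. *)
Definition last_index j := minn (npaths I) (Num.truncn (deadline (jobn I j) / headway I)%R).

(** Indices are shifted by six blocks. Then every job ends in block 6 or later,
    the centres of relevant rows are in block 3 or later, and the blocks of the
    window at row 0 are empty. *)
Definition end_block j := (last_index j + 6 * B) %/ B.
Definition single j (d : bool) (q : nat) : bool :=
  private_test (jD I) (jr I j) (je I j) (jdur I j) (jm I) (jlo I j) (jhi I j) d (q%:R - (6 * B)%:R)%R.

Lemma valid_jobn j : valid_job (corridor I) (jobn I j).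
Proof.
case: valid => -[L0 _ _ _] v; rewrite /jobn; case: insub => [o|]; first exact: v.
by split; split=> //=; rewrite ?ltW // addr0.
Qed.

Definition prepared st :=
  [/\ inputs I st, forall j, j < njobs I -> arr st aAct j = (active j)%:R%R &
      forall j, j < njobs I -> arr st aEnd j = (end_block j)%:R%R].

Lemma prepared_frame st st' :
  frame (fun x => 4 < x) (fun a => (4 < a) && (a != aAct) && (a != aEnd)) st st' -> prepared st -> prepared st'.
Proof.
move=> [f g] [[s i] p1 p2]; split; first split.
- by move=> x x5; rewrite f ?s // -leqNgt.
- by move=> a j a5; rewrite g ?i //; lia.
- by move=> j jn; rewrite g ?p1.
- by move=> j jn; rewrite g ?p2.
Qed.

Definition prepare_job : prog :=
  Seq (If (tDiscard k) (SetArr aAct (EVar vJob) (ENat 0)) (SetArr aAct (EVar vJob) (ENat 1)))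
  (Seq (SetArr aEnd (EVar vJob) (EFloor (EDiv (eJob 1) (EVar 1))))
  (Seq (If (TLe (EVar 3) (eJob aEnd)) (SetArr aEnd (EVar vJob) (EVar 3)) Skip)
       (SetArr aEnd (EVar vJob) (EFloor (EDiv (EAdd (eJob aEnd) (ENat (6 * B))) (ENat B)))))).

Lemma wp_prepare_job M j st : scal st vJob = j%:R%R -> inputs I st ->
  wp M prepare_job (fun st' => [/\ arr st' aAct j = (active j)%:R%R,
     arr st' aEnd j = (end_block j)%:R%R &
     forall i, i != j -> arr st' aAct i = arr st aAct i /\ arr st' aEnd i = arr st aEnd i]) st.
Proof.
move=> vj inp.
have vjK : Num.truncn (scal st vJob) = j by rewrite vj natrK.
have D0 : (0 < headway I)%R by case: valid => -[].
have [d0 m3] : (0 <= deadline (jobn I j))%R /\ scal st 3 = jm I.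
  by split; [have [[]] := valid_jobn j | case: inp => ->].
pose T := Num.truncn (deadline (jobn I j) / headway I)%R.
have dE (st' : store) : inputs I st' -> scal st' vJob = j%:R%R ->
    eval st' (EFloor (EDiv (eJob 1) (EVar 1))) = T%:R%R.
  move=> inp' vj'; rewrite !(eval_ops st') (eval_job vj') (inputs_job _ inp') //.
  by rewrite (eval_D inp') /= floor_natr // divr_ge0 // ltW.
pose st1 := set_arr st aAct j (active j)%:R%R.
apply: wp_seq; apply: (@wp_mono _ _ (fun st' => st' = st1)).
  apply: wp_if; rewrite (evalt_discard inp vj) => dis; apply: wp_arr;
    by rewrite /= vjK /st1 /active ?dis ?(negbTE dis).
move=> _ ->; have inp1 : inputs I st1.
  case: inp => s i; split=> // a i0 a5; rewrite /= -i //.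
  by rewrite /upd; case: eqP => // ?; lia.
apply: wp_seq; apply: wp_arr; rewrite dE //=  vjK.
set st2 := set_arr _ _ _ _.
pose st3 := set_arr st1 aEnd j (last_index j)%:R%R.
have e2 : eval st2 (eJob aEnd) = T%:R%R by rewrite /st2 /= vjK !upd_eq.
apply: wp_seq; apply: (@wp_mono _ _ (fun st' => [/\ scal st' = scal st, arr st' aAct =1 arr st1 aAct,
    arr st' aEnd j = (last_index j)%:R%R & forall i, i != j -> arr st' aEnd i = arr st aEnd i])).
  apply: wp_if; rewrite (eval_ops st2) e2 /= m3 ler_nat => mT.
    apply: wp_arr; rewrite /= m3 vjK; split=> //.
      by rewrite !upd_eq /last_index (minn_idPl mT).
    by move=> i ij; rewrite /upd /= !(negbTE ij).
  apply: wp_skip; split=> //.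
    by rewrite /= !upd_eq /last_index (minn_idPr _) // ltnW // ltnNge.
  by move=> i ij; rewrite /st2 /= /upd /= (negbTE ij).
move=> st4 [s4 a6 a7 a7']; apply: wp_arr; rewrite /= s4 vjK.
split.
- by rewrite upd_ne // a6 /= !upd_eq.
- by rewrite !upd_eq a7 -natrD floor_divn //; lia.
- move=> i ij; rewrite /upd /= (negbTE ij) a6 a7' //.
  by rewrite /= /upd /= (negbTE ij).
Qed.

Definition prepare : prog := For prepare_job.

Lemma wp_prepare M st : njobs I <= M -> inputs I st ->
  wp M prepare (fun st' => prepared st' /\ forall a, a != aAct -> a != aEnd -> arr st' a = arr st a) st.
Proof.
move=> nM inp; have n4 : scal st 4 = (njobs I)%:R%R by case: inp => ->.
have wr : writes (pred1 vJob) (fun a => (a == aAct) || (a == aEnd)) prepare by [].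
pose Inv j st' := [/\ inputs I st',
     forall i, i < j -> arr st' aAct i = (active i)%:R%R &
     forall i, i < j -> arr st' aEnd i = (end_block i)%:R%R].
have main : wp M prepare (Inv (njobs I)) st.
  apply: (@wp_for M (njobs I) _ Inv) => //.
  - move=> j st1 v [[s i] h1 h2]; split=> //; split=> // x x5.
    by rewrite /= /upd; case: eqP => [?|_]; [lia | exact: s].
  - move=> j st1 jn vj [inp1 h1 h2].
    have wr' : writes (pred0) (fun a => (a == aAct) || (a == aEnd)) prepare_job by [].
    apply: wp_mono (wp_frame wr' (wp_prepare_job M vj inp1)) _ => st2 [[p1 p2 p3] [f g]].
    split.
    + case: inp1 => s i; split=> [x x5|a i0 a5]; first by rewrite f // s.
      by rewrite g ?i //; lia.
    + move=> i; rewrite ltnS leq_eqVlt => /orP[/eqP-> //|ij].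
      by have [|-> _] := p3 i; [lia | exact: h1].
    + move=> i; rewrite ltnS leq_eqVlt => /orP[/eqP-> //|ij].
      by have [|_ ->] := p3 i; [lia | exact: h2].
apply: wp_mono (wp_frame wr main) _ => st' [[h1 h2 h3] [_ g]]; split=> // a a6 a7.
by apply: g; rewrite negb_or a6.
Qed.
End Prepare.

Lemma single_ge I k j d q : single I k j d q -> 6 * (2 * k + 3) < q.
Proof.
rewrite /single /private_test => /andP[]; rewrite lerBrDr => h _.
by rewrite -(ltr_nat rat); apply: lt_le_trans h; rewrite ltrDr ltr01.
Qed.

Lemma end_block_ge I k j : 6 <= end_block I k j.
Proof. by rewrite leq_divRL ?addn3 // -addn3 leq_addl. Qed.

Lemma end_block_lt I k j : end_block I k j < npaths I + (6 * (2 * k + 3) + 1).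
Proof.
rewrite addnA addn1 ltnS; apply: leq_trans (leq_div _ _) _.
by rewrite leq_add2r geq_minl.
Qed.

(** * The algorithm *)

Lemma foldl_iotaS (T : Type) (f : T -> nat -> T) z j :
  foldl f z (iota 0 j.+1) = f (foldl f z (iota 0 j)) j.
Proof. by rewrite -addn1 iotaD foldl_cat. Qed.

Lemma all_iotaS (f : pred nat) j : all f (iota 0 j.+1) = all f (iota 0 j) && f j.
Proof. by rewrite -addn1 iotaD all_cat /= andbT. Qed.

Lemma improve_le (v w u : nat) : (v == 0) || (w < v) -> 0 < w -> 0 < v <= u -> 0 < w <= u.
Proof. lia. Qed.

Section Code.
Variable k : nat.
Notation B := (2 * k + 3).
Notation window := (window B).
Notation pattern := (pattern B).

Definition eIndex ev o r :=
  ESub (EAdd (EMul (EAdd ev (ENat o)) (ENat B)) (ENat r)) (ENat (6 * B)).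
Definition tHit ev o (Y : pattern) :=
  THas [seq tPrivate x.1 (eIndex ev o x.2) | x : bool * 'I_B <- enum Y].
Definition tWindow ev (s : window) :=
  TOr (tHit ev 0 s.1.1) (TOr (tHit ev 1 s.1.2) (tHit ev 2 s.2)).
Definition tPending s :=
  TAnd (TLe (ENat 1) (eJob aAct))
    (TAnd (TLe (EAdd (EVar vRow) (ENat 3)) (eJob aEnd)) (TNot (tWindow (EVar vRow) s))).

(** Each window pattern has three arrays indexed by rows: the length of a
    shortest route increased by 1, or 0 if there is none, and the row and the
    pattern of the next window. *)
Definition aVal (s : window) := 8 + 3 * enum_rank s.
Definition aNext (s : window) := 9 + 3 * enum_rank s.
Definition aCode (s : window) := 10 + 3 * enum_rank s.

Definition pending_job s :=
  If (TAnd (tPending s) (TOr (TEq (EVar vPend) (ENat 0)) (TLt (eJob aEnd) (EVar vPend))))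
     (SetVar vPend (eJob aEnd)) Skip.
Definition find_pending s := Seq (SetVar vPend (ENat 0)) (For (pending_job s)).
Definition check_job s s' :=
  If (TAnd (tPending s) (TAnd (TLe (eJob aEnd) (EAdd (EVar vTarget) (ENat 2)))
       (TNot (tWindow (EVar vTarget) s'))))
     (SetVar vOk (ENat 0)) Skip.
Definition check s s' := Seq (SetVar vOk (ENat 1)) (For (check_job s s')).

(** The row of the next window: the offset [o] counts down from the end of the
    first pending job if the block after the centre is empty. *)
Definition eTarget (s : window) o :=
  if s.2 == set0 then ESub (EVar vPend) (ENat o.+1) else EAdd (EVar vRow) (ENat 1).
Definition gap (s : window) := if s.2 == set0 then 2 else 1.
Definition compatible (s s' : window) :=
  (s'.1.2 != set0) &&
  (if s.2 == set0 then s'.1.1 == set0 else (s'.1.1 == s.1.2) && (s'.1.2 == s.2)).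
Definition candidates s : seq (nat * window) :=
  [seq x <- [seq (o, s') | o <- iota 0 4, s' <- enum {: window}] | compatible s x.2].
Definition eValue (s : window) (x : nat * window) :=
  EAdd (EGet (aVal x.2) (EVar vTarget)) (ENat #|s.1.2|).
Definition improve s x :=
  If (TAnd (TLe (ENat 1) (EVar vOk))
       (TOr (TEq (EVar vBest) (ENat 0)) (TLt (eValue s x) (EVar vBest))))
     (Seq (SetVar vBest (eValue s x))
     (Seq (SetVar vNext (EVar vTarget)) (SetVar vCode (ENat (enum_rank x.2)))))
     Skip.
Definition try_candidate s (x : nat * window) :=
  Seq (SetVar vTarget (eTarget s x.1))
    (If (TAnd (TLe (EAdd (EVar vRow) (ENat (gap s))) (EVar vTarget))
              (TLt (ENat 0) (EGet (aVal x.2) (EVar vTarget))))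
        (Seq (check s x.2) (improve s x)) Skip).

(** The next row 0 marks the end of a route. *)
Definition init_best (s : window) :=
  Seq (SetVar vNext (ENat 0))
    (If (if s.2 == set0 then TEq (EVar vPend) (ENat 0) else TNot TTrue)
       (SetVar vBest (ENat #|s.1.2|.+1)) (SetVar vBest (ENat 0))).
Definition save_best s :=
  Seq (SetArr (aVal s) (EVar vRow) (EVar vBest))
  (Seq (SetArr (aNext s) (EVar vRow) (EVar vNext))
       (SetArr (aCode s) (EVar vRow) (EVar vCode))).
Definition solve_window s :=
  Seq (find_pending s) (Seq (init_best s)
    (Seq (seqs [seq try_candidate s x | x <- candidates s]) (save_best s))).
Definition solve_row := seqs [seq solve_window s | s <- enum {: window}].

Definition prev_job :=
  If (TAnd (TLe (ENat 1) (eJob aAct)) (TLt (eJob aEnd) (EAdd (EVar vRow) (ENat 4))))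
    (Seq (If (TLe (eJob aEnd) (EVar vRow)) (SetVar vTmp (ESub (eJob aEnd) (ENat 1)))
             (SetVar vTmp (ESub (EVar vRow) (ENat 1))))
         (If (TLt (EVar vPrev) (EVar vTmp)) (SetVar vPrev (EVar vTmp)) Skip))
    Skip.

(** Only relevant rows are visited, so that the number of rows does not depend on
    the number of paths; finding the next one takes one pass over the jobs. *)
Definition prev_row :=
  Seq (SetVar vPrev (ENat 0)) (Seq (For prev_job) (SetVar vRow (EVar vPrev))).
Definition fill_table :=
  Seq (SetVar vRow (EAdd (EVar 3) (ENat (6 * B + 1))))
    (While (TLt (ENat 0) (EVar vRow)) (Seq prev_row solve_row)).
End Code.

Section WalkCode.
Variable k : nat.
Notation B := (2 * k + 3).
Notation window := (window B).
Notation pattern := (pattern B).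

(** The window at row 0, from which all routes start. *)
Definition no_picks : window := (set0, set0, set0).
Definition eOut (d : bool) i := if d then i else ESub (ENat 0) i.
Definition mark_pick (x : bool * 'I_B) :=
  If (tPrivate x.1 (eIndex k (EVar vRow) 1 x.2))
     (SetArr aOut (EVar vJob) (eOut x.1 (eIndex k (EVar vRow) 1 x.2))) Skip.
Definition mark_job (s : window) :=
  If (TLe (ENat 1) (eJob aAct)) (seqs [seq mark_pick x | x <- enum s.1.2]) Skip.

(** The names of arrays are constants of the program. The window found in memory
    is therefore compared with all windows in turn. *)
Definition visit (s : window) :=
  If (TEq (EVar vCur) (ENat (enum_rank s)))
     (Seq (For (mark_job s))
     (Seq (SetVar vNext (EGet (aNext s) (EVar vRow))) (SetVar vCode (EGet (aCode s) (EVar vRow)))))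
     Skip.
Definition walk :=
  Seq (SetVar vRow (ENat 0)) (Seq (SetVar vCur (ENat (enum_rank no_picks)))
  (Seq (SetVar vNext (ENat 1))
    (While (TLt (ENat 0) (EVar vNext))
       (Seq (seqs [seq visit s | s <- enum {: window}])
       (Seq (SetVar vRow (EVar vNext)) (SetVar vCur (EVar vCode))))))).
Definition pick_code (x : bool * nat) : rat :=
  if x.1 then (x.2%:R - (6 * B)%:R)%R else (- (x.2%:R - (6 * B)%:R))%R.
End WalkCode.

Definition scheduler (k : nat) : prog := Seq (prepare k) (Seq (fill_table k) (walk k)).

Lemma scheduler_depth k : depth (scheduler k) <= 2.
Proof.
have flat (T : Type) (f : T -> prog) l d : (forall x, depth (f x) <= d) -> depth (seqs (map f l)) <= d.
  by move=> h; elim: l => //= x l IH; rewrite geq_max h.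
have row : depth (solve_row k) <= 1.
  apply: (flat _ _ _ _) => s; rewrite /solve_window /init_best; case: (s.2 == set0);
    rewrite /= !geq_max /=; apply/andP; split=> //; exact: (flat _ _ _ _).
have visits : depth (seqs [seq visit s | s <- enum {: window (2 * k + 3)}]) <= 1.
  by apply: (flat _ _ _ _) => s; rewrite /= !geq_max /= !andbT ltnS flat.
rewrite /scheduler /fill_table /walk; move: row visits.
move: (solve_row k) (seqs _) => r v rd vd.
by rewrite /= !geq_max /= !ltnS !geq_max rd vd.
Qed.

(** * Correctness of the program *)

Section Verify.
Variables (I : instance) (k M : nat).
Notation B := (2 * k + 3).
Notation n := (njobs I).
Notation window := (Blocks.window B).
Notation pattern := (Blocks.pattern B).
Notation act := (active I k).
Notation hb := (end_block I k).
Notation H := (single I k).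
Notation hit := (Blocks.hit H).
Notation window_hit := (Blocks.window_hit H).
Notation pending := (Blocks.pending act hb H).
Notation first_pending := (Blocks.first_pending n act hb H).
Notation relevant := (Blocks.relevant n act hb).
Notation follows := (Blocks.follows n act hb H).
Notation final := (Blocks.final n act hb H).
Notation route := (Blocks.route n act hb H).
Notation prepared := (prepared I k).
Hypothesis M_ge : n * 4 < M.
Implicit Types (s : window) (st : store) (j g : nat).

Lemma nM : n <= M.
Proof. by apply: leq_trans (ltnW M_ge); rewrite leq_pmulr. Qed.

Lemma prepared_inputs st : prepared st -> inputs I st. Proof. by case. Qed.

Lemma eval_act st j : prepared st -> scal st vJob = j%:R%R -> j < n ->
  eval st (eJob aAct) = (act j)%:R%R.
Proof. by move=> [_ p _] vj jn; rewrite (eval_job vj) p. Qed.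

Lemma eval_end_block st j : prepared st -> scal st vJob = j%:R%R -> j < n ->
  eval st (eJob aEnd) = (hb j)%:R%R.
Proof. by move=> [_ _ p] vj jn; rewrite (eval_job vj) p. Qed.

Lemma evalt_act st j : prepared st -> scal st vJob = j%:R%R -> j < n ->
  evalt st (TLe (ENat 1) (eJob aAct)) = act j.
Proof.
by move=> p vj jn; rewrite (eval_ops st) (eval_act p vj jn) /= ler_nat; case: (act j).
Qed.

Lemma eval_index st ev g o r : eval st ev = g%:R%R ->
  eval st (eIndex k ev o r) = (((g + o) * B + r)%:R - (6 * B)%:R)%R.
Proof. by move=> e; rewrite /eIndex !(eval_ops st) e -natrD -natrM -natrD. Qed.

Lemma evalt_hit st ev o (Y : pattern) j g : prepared st -> scal st vJob = j%:R%R ->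
  eval st ev = g%:R%R -> evalt st (tHit ev o Y) = hit j (g + o) Y.
Proof.
move=> p vj e; rewrite /tHit evalt_Has.
apply/hasP/exists_inP => -[x xY]; rewrite ?mem_enum in xY *;
  rewrite ?(evalt_private (prepared_inputs p) vj) ?(eval_index _ _ e) => hx;
  exists x; rewrite ?mem_enum ?(evalt_private (prepared_inputs p) vj) ?(eval_index _ _ e) //.
Qed.

Lemma evalt_window st ev s j g : prepared st -> scal st vJob = j%:R%R ->
  eval st ev = g%:R%R -> evalt st (tWindow ev s) = window_hit j g s.
Proof.
move=> p vj e; rewrite /tWindow !evalt_Or !(evalt_hit _ _ p vj e).
by rewrite addn0 addn1 addn2.
Qed.

Lemma evalt_pending st s j g : prepared st -> scal st vJob = j%:R%R -> j < n ->
  scal st vRow = g%:R%R -> evalt st (tPending s) = pending g s j.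
Proof.
move=> p vj jn row; rewrite /tPending evalt_And evalt_And evalt_Not.
rewrite (evalt_window s p vj (g := g)) // (evalt_act p vj jn) evalt_Le (eval_end_block p vj jn).
by rewrite /Blocks.pending /= row -natrD addn3 ler_nat.
Qed.

Definition safe_arrays (a : nat) := (4 < a) && (a != aAct) && (a != aEnd).

Definition pending_step g s (h j : nat) : nat :=
  if pending g s j && ((h == 0) || (hb j < h)) then hb j else h.

Lemma wp_find_pending s st g : prepared st -> scal st vRow = g%:R%R ->
  wp M (find_pending s) (fun st' => scal st' vPend = (first_pending g s)%:R%R) st.
Proof.
move=> p row; apply: wp_seq; apply: wp_var.
pose Inv j st' := [/\ prepared st', scal st' vRow = g%:R%R &
  scal st' vPend = (foldl (pending_step g s) 0 (iota 0 j))%:R%R].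
have n4 : scal st 4 = n%:R%R by case: p => -[-> ].
apply: (@wp_for M n _ Inv _ _ nM) => //; last by move=> st' [].
- by move=> j st' v [p' row' h]; split=> //; apply: prepared_frame p'; split=> // x; rewrite /= /upd; case: eqP => // ->.
- by split=> //=; apply: prepared_frame p; split=> // x; rewrite /= /upd; case: eqP => // ->.
move=> j st' jn vj [p' row' h].
set f := foldl _ _ _ in h.
have condE : evalt st' (TAnd (tPending s) (TOr (TEq (EVar vPend) (ENat 0)) (TLt (eJob aEnd) (EVar vPend))))
   = pending g s j && ((f == 0) || (hb j < f)).
  rewrite evalt_And evalt_Or evalt_Eq evalt_Lt.
  rewrite (evalt_pending s p' vj jn row') (eval_end_block p' vj jn) /= h.
  by rewrite ltr_nat pnatr_eq0.
apply: wp_if; rewrite condE => c; [apply: wp_var | apply: wp_skip]; split=> //.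
- by apply: prepared_frame p'; split=> // x; rewrite /= /upd; case: eqP => // ->.
- rewrite foldl_iotaS -/f /pending_step c /= upd_eq -/(eval st' (eJob aEnd)).
  exact: eval_end_block.
- by rewrite foldl_iotaS -/f /pending_step (negbTE c).
Qed.

Definition check_ok g s g' s' j := pending g s j && (hb j <= g'.+2) ==> window_hit j g' s'.

Lemma prepared_var st x v : 4 < x -> prepared st -> prepared (set_var st x v).
Proof.
move=> x4; apply: prepared_frame; split=> // y; rewrite -leqNgt => y4.
by rewrite /= upd_ne //; apply: contraTneq x4 => <-; rewrite -leqNgt.
Qed.

Lemma wp_check s s' st g g' : prepared st -> scal st vRow = g%:R%R ->
  scal st vTarget = g'%:R%R ->
  wp M (check s s') (fun st' => scal st' vOk = (all (check_ok g s g' s') (iota 0 n))%:R%R) st.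
Proof.
move=> p row tgt; apply: wp_seq; apply: wp_var.
pose Inv j st' := [/\ prepared st', scal st' vRow = g%:R%R, scal st' vTarget = g'%:R%R &
  scal st' vOk = (all (check_ok g s g' s') (iota 0 j))%:R%R].
have n4 : scal st 4 = n%:R%R by case: p => -[-> ].
apply: (@wp_for M n _ Inv _ _ nM) => //; last by move=> st' [].
- by move=> j st' v [p' row' tgt' h]; split=> //; apply: prepared_var.
- by split=> //; apply: prepared_var.
move=> j st' jn vj [p' row' tgt' h].
have condE : evalt st' (TAnd (tPending s) (TAnd (TLe (eJob aEnd) (EAdd (EVar vTarget) (ENat 2)))
       (TNot (tWindow (EVar vTarget) s')))) = ~~ check_ok g s g' s' j.
  rewrite evalt_And (evalt_pending s p' vj jn row') evalt_And evalt_Not evalt_Le.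
  rewrite (eval_end_block p' vj jn).
  rewrite (evalt_window s' p' vj (g := g')) //= tgt' -natrD addn2 ler_nat.
  by rewrite /check_ok negb_imply andbA.
apply: wp_if; rewrite condE => c; [apply: wp_var | apply: wp_skip]; split=> //.
- exact: prepared_var.
- by rewrite all_iotaS (negbTE c) andbF /= upd_eq.
- by rewrite all_iotaS (negPn c) andbT.
Qed.

Definition table := nat -> nat -> rat.
Definition optimal_value g s v := forall c, route g s c -> 0 < v <= c.+1.

(** [A] is the memory of arrays. Pointers lead to later rows, so they survive
    when earlier rows are filled ([pointer_ext]). *)
Definition pointer (A : table) g s v (nx cd : rat) : Prop :=
  [/\ nx = 0%R, final g s & v = #|s.1.2|.+1] \/
  exists g' s' v', [/\ nx = g'%:R%R, cd = (enum_rank s')%:R%R,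
    follows g s g' s' /\ relevant g', A (aVal s') g' = v'%:R%R & 0 < v' /\ v = v' + #|s.1.2|].
Definition solved (A : table) g s := exists v : nat, [/\ A (aVal s) g = v%:R%R,
   optimal_value g s v, 0 < v -> route g s v.-1 &
   0 < v -> pointer A g s v (A (aNext s) g) (A (aCode s) g)].

(** Irrelevant rows are skipped and keep the value 0, which means that no route
    enters them. *)
Definition filled (A : table) g0 := forall g s, g0 <= g ->
  if relevant g || (g == 0) then solved A g s else A (aVal s) g = 0%R.

Definition is_target g s o g' :=
  if s.2 == set0 then g' + o.+1 == first_pending g s else g' == g.+1.

(** The state after the candidates of [l] have been tried. *)
Record trial (A : table) g s (l : seq (nat * window)) (st : store) : Prop := Trial {
  trial_prepared : prepared st;
  trial_row : scal st vRow = g%:R%R;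
  trial_pend : scal st vPend = (first_pending g s)%:R%R;
  trial_arr : forall a, arr st a = A a;
  trial_best : exists v : nat, [/\ scal st vBest = v%:R%R,
    0 < v -> pointer A g s v (scal st vNext) (scal st vCode),
    0 < v -> route g s v.-1,
    final g s -> 0 < v <= #|s.1.2|.+1 &
    forall x g' v', x \in l -> is_target g s x.1 g' -> g + gap s <= g' ->
      A (aVal x.2) g' = v'%:R%R -> 0 < v' -> follows g s g' x.2 ->
      0 < v <= v' + #|s.1.2|] }.

Lemma filled_value A g0 g s : filled A g0 -> g0 <= g -> exists v : nat,
  A (aVal s) g = v%:R%R /\
  (0 < v -> 0 < g -> relevant g /\ route g s v.-1).
Proof.
move=> fA gg; have := fA g s gg; case: ifP => [rg [v [Av _ r _]]|_ ->].
  by exists v; split=> // v0 g0'; split; [move: rg; case: (g) g0' => // ? _; rewrite orbF | apply: r].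
by exists 0.
Qed.

Lemma target_eval g s o st : scal st vRow = g%:R%R ->
  scal st vPend = (first_pending g s)%:R%R ->
  (forall g', is_target g s o g' -> eval st (eTarget s o) = g'%:R%R) /\
  ((g + gap s)%:R <= eval st (eTarget s o) ->
     exists2 g', is_target g s o g' & eval st (eTarget s o) = g'%:R)%R.
Proof.
move=> row pend; rewrite /is_target /eTarget /gap; case: ifP => _ /=; rewrite ?row ?pend.
  split=> [g' /eqP <-|h]; first by rewrite natrD addrK.
  have le : o.+1 <= first_pending g s.
    rewrite -(ler_nat rat); have : (0 <= (g + 2)%:R :> rat)%R by rewrite ler0n.
    by move/le_trans => /(_ _ h); rewrite subr_ge0.
  by exists (first_pending g s - o.+1); [rewrite subnK | rewrite natrB].
split=> [g' /eqP ->|h]; first by rewrite natr1.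
by exists g.+1; rewrite // natr1.
Qed.

(** The program tests only the jobs; the other conditions of [follows] hold by
    the choice of the candidates, and relevance of the target because its value
    is positive. *)
Lemma wp_try A g s l x st : x \in candidates s -> filled A g.+1 ->
  trial A g s l st -> wp M (try_candidate s x) (trial A g s (rcons l x)) st.
Proof.
move=> xc fA [p row pend arrE [v [vE ptr rt fin opt]]].
have [to_t from_t] := target_eval x.1 row pend.
have gap0 : 0 < gap s by rewrite /gap; case: ifP.
set t := eval st (eTarget s x.1) in to_t from_t.
apply: wp_seq; apply: wp_var; rewrite -/t.
set st1 := set_var st vTarget t.
have p1 : prepared st1 by apply: prepared_var.
have row1 : scal st1 vRow = g%:R%R by [].
have tt1 : scal st1 vTarget = t by rewrite /= upd_eq.
have e1 : eval st1 (EGet (aVal x.2) (EVar vTarget)) = A (aVal x.2) (Num.truncn t).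
  by rewrite [LHS]/= arrE upd_eq.
apply: wp_if; rewrite evalt_And evalt_Le evalt_Lt e1 => c; last first.
  apply: wp_skip; split=> //; exists v; split=> // y g' v'.
  rewrite mem_rcons inE => /orP[/eqP->|]; last exact: opt.
  move=> tg gg Av v'0; case/negP: c; rewrite [eval st1 (EVar vTarget)]tt1 !(eval_ops st1) [eval st1 (EVar vRow)]row1 (to_t _ tg) natrK Av.
  by rewrite -natrD ler_nat gg ltr0n.
move: c; rewrite [eval st1 (EVar vTarget)]tt1 !(eval_ops st1) [eval st1 (EVar vRow)]row1 -natrD => /andP[/[dup] gt /from_t[g' tg tE]].
rewrite tE natrK; have gg' : g + gap s <= g' by move: gt; rewrite tE ler_nat.
have [|v' [Av' rv']] := filled_value x.2 fA (g := g'); first by lia.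
rewrite Av' ltr0n => v'0; have [|rel' rt'] := rv' v'0; first by lia.
apply: wp_seq.
have wr : writes [pred y | (y == vJob) || (y == vOk)] pred0 (check s x.2) by [].
have tgt1 : scal st1 vTarget = g'%:R%R by rewrite tt1.
apply: wp_mono (wp_frame wr (wp_check s x.2 p1 row1 tgt1)) _ => st2 [ok2 [f2 a2]].
have p2 : prepared st2.
  apply: prepared_frame p1; split=> y; last by move=> _; apply: a2.
  by move=> y4; apply: f2; apply/norP; split; apply: contraNN y4 => /eqP->.
have arr2 a : arr st2 a = A a by rewrite a2 //= arrE.
have row2 : scal st2 vRow = g%:R%R by rewrite f2.
have tgt2 : scal st2 vTarget = g'%:R%R by rewrite f2.
have best2 : scal st2 vBest = v%:R%R by rewrite f2.
have next2 : scal st2 vNext = scal st vNext by rewrite f2.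
have code2 : scal st2 vCode = scal st vCode by rewrite f2.
have pend2 : scal st2 vPend = (first_pending g s)%:R%R by rewrite f2.
have val2 : eval st2 (eValue s x) = (v' + #|s.1.2|)%:R%R.
  by rewrite /= tgt2 natrK arr2 Av' natrD.
have folE : follows g s g' x.2 = all (check_ok g s g' x.2) (iota 0 n).
  move: xc; rewrite mem_filter /compatible => /andP[/andP[ne comp] /allpairsP[[o s'] /= [o4 _ xE]]].
  rewrite /Blocks.follows ne /=; move: tg comp gg'; rewrite /is_target /gap xE /=.
  case: ifP => _; last by move=> /eqP -> ->; rewrite eqxx.
  move=> /eqP <- -> gg'; rewrite addn2 in gg'; rewrite gg'.
  rewrite -[X in X < _]addn0 ltn_add2l /=.
  have o3 : o < 4 by move: o4; rewrite !inE; lia.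
  by rewrite leq_add2l o3.
have uniq_t g'' : is_target g s x.1 g'' -> g'' = g'.
  by move=> /to_t; rewrite tE => /eqP; rewrite eqr_nat => /eqP.
have okE : evalt st2 (TLe (ENat 1) (EVar vOk)) = follows g s g' x.2.
  by rewrite evalt_Le /= ok2 ler_nat folE; case: all.
apply: wp_if; rewrite evalt_And okE evalt_Or evalt_Eq evalt_Lt val2 /= best2 pnatr_eq0 ltr_nat => c.
  have /andP[fol better] := c.
  have w0 : 0 < v' + #|s.1.2| by rewrite addn_gt0 v'0.
  have rtx : route g s (v' + #|s.1.2|).-1.
    have -> : (v' + #|s.1.2|).-1 = #|s.1.2| + v'.-1.
      by rewrite addnC -!subn1 addnBA.
    exact: RouteStep rt'.
  apply: wp_seq; apply: wp_var; rewrite val2.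
  apply: wp_seq; apply: wp_var; apply: wp_var; split=> //.
  - by do 3!(apply: prepared_var => //).
  - exists (v' + #|s.1.2|); split=> //.
    + by move=> _; right; exists g', x.2, v'; split.
    + by move=> /fin; apply: improve_le better w0.
    + move=> y g'' v''; rewrite mem_rcons inE => /orP[/eqP->|yl].
        move=> /uniq_t -> _; rewrite Av' => /eqP; rewrite eqr_nat => /eqP <- _ _.
        by rewrite w0 leqnn.
      move=> h1 h2 h3 h4 h5; apply: improve_le better w0 _.
      exact: opt h1 h2 h3 h4 h5.
apply: wp_skip; split=> //; exists v; rewrite next2 code2; split=> // y g'' v''.
rewrite mem_rcons inE => /orP[/eqP->|yl]; last exact: opt.
move=> /uniq_t -> _; rewrite Av' => /eqP; rewrite eqr_nat => /eqP <- _ fol.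
by move: c; rewrite fol /= negb_or -leqNgt -lt0n.
Qed.

Lemma follows_lt g s g' s' : follows g s g' s' -> g < g'.
Proof.
case/and3P=> _ + _; case: ifP => _; last by case/and3P=> /eqP->.
by case/and4P=> /ltnW.
Qed.

Lemma follows_candidate g s g' s' : follows g s g' s' ->
  exists2 o, (o, s') \in candidates s & is_target g s o g' /\ g + gap s <= g'.
Proof.
rewrite /Blocks.follows /is_target /gap => /and3P[ne].
case: ifP => s2.
  case/and4P=> gg lt le e _; exists (first_pending g s - g'.+1); last first.
    by rewrite addn2 gg -subSn // subSS subnKC // ltnW.
  rewrite mem_filter; apply/andP; split; first by rewrite /compatible /= ne s2 e.
  apply: allpairs_f; last by rewrite mem_enum.
  by rewrite mem_iota /=; lia.
case/and3P=> /eqP-> e1 e2 _; exists 0; last by rewrite eqxx addn1 leqnn.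
rewrite mem_filter; apply/andP; split; first by rewrite /compatible /= ne s2 e1 e2.
by apply: allpairs_f; rewrite ?mem_enum.
Qed.

Lemma pointer_ext (A A' : table) g s v nx cd : (forall a i, g < i -> A' a i = A a i) ->
  pointer A g s v nx cd -> pointer A' g s v nx cd.
Proof.
move=> ext [|[g' [s' [v' [h1 h2 [h3 h3'] h4 h5]]]]]; [by left|right].
by exists g', s', v'; split=> //; rewrite ext // (follows_lt h3).
Qed.

Lemma solved_ext (A A' : table) g s : (forall a i, g < i -> A' a i = A a i) ->
  (forall a, a \in [:: aVal s; aNext s; aCode s] -> A' a g = A a g) ->
  solved A g s -> solved A' g s.
Proof.
move=> ext same [v [h1 h2 h3 h4]]; exists v; split=> //.
  by rewrite same // inE eqxx.
move=> /h4 p; rewrite !same ?inE ?eqxx ?orbT //; exact: pointer_ext p.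
Qed.

Lemma arr_set_arr st a i v b j :
  arr (set_arr st a i v) b j = if (b == a) && (j == i) then v else arr st b j.
Proof. by rewrite /= /upd; case: eqP => // ->. Qed.

Lemma aVal_small s a : a < 8 -> [/\ a != aVal s, a != aNext s & a != aCode s].
Proof. by rewrite /aVal /aNext /aCode; split; lia. Qed.

(** The first step of any route leads to a candidate ([follows_candidate]), and
    the value stored there is optimal already. *)
Lemma wp_solve_window A g s st : (forall a, arr st a = A a) ->
  prepared st -> scal st vRow = g%:R%R -> filled A g.+1 ->
  wp M (solve_window s) (fun st' => [/\ prepared st', scal st' vRow = g%:R%R,
    solved (arr st') g s &
    forall a i, (i != g) || (a \notin [:: aVal s; aNext s; aCode s]) -> arr st' a i = arr st a i]) st.
Proof.
move=> arrE p row fA; apply: wp_seq.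
have wr : writes [pred x | (x == vJob) || (x == vPend)] pred0 (find_pending s) by [].
apply: wp_mono (wp_frame wr (wp_find_pending s p row)) _ => st1 [pend1 [f1 a1]].
have p1 : prepared st1.
  apply: prepared_frame p; split=> y; last by move=> _; apply: a1.
  by move=> y4; apply: f1; apply/norP; split; apply: contraNN y4 => /eqP->.
have row1 : scal st1 vRow = g%:R%R by rewrite f1.
have arr1 a : arr st1 a = A a by rewrite a1 //= arrE.
apply: wp_seq; apply: wp_mono (_ : wp M _ (trial A g s [::]) st1) _.
  apply: wp_seq; apply: wp_var; set st2 := set_var _ _ _.
  have p2 : prepared st2 by apply: prepared_var.
  have pend2 : scal st2 vPend = (first_pending g s)%:R%R := pend1.
  have finE : evalt st2 (if s.2 == set0 then TEq (EVar vPend) (ENat 0) else TNot TTrue) = final g s.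
    rewrite /Blocks.final; case: ifP => _; last by rewrite evalt_Not evalt_Le lexx.
    by rewrite evalt_Eq [eval st2 (EVar _)]pend2 (eval_ops st2) eqr_nat.
  apply: wp_if; rewrite finE => fin; apply: wp_var; split=> //; try exact: prepared_var.
    exists #|s.1.2|.+1; split=> //.
    - by move=> _; left.
    - by move=> _; apply: RouteEnd.
    - by rewrite leqnn.
  by exists 0; split=> // fin'; rewrite fin' in fin.
move=> st2 t0; apply: wp_seq.
apply: (@wp_seqs _ _ _ (trial A g s)) t0 _ _.
  by move=> l1 x l2 st3 lE; apply: wp_try => //; rewrite lE mem_cat mem_head orbT.
move=> st3 [p3 row3 _ arr3 [v [vE ptr rt fin opt]]].
have rowK : Num.truncn (scal st3 vRow) = g by rewrite row3 natrK.
pose st4 := set_arr (set_arr (set_arr st3 (aVal s) g (scal st3 vBest))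
  (aNext s) g (scal st3 vNext)) (aCode s) g (scal st3 vCode).
apply: (@wp_mono _ _ (eq st4)).
  by apply: wp_seq; apply: wp_arr; apply: wp_seq; apply: wp_arr; apply: wp_arr; rewrite /= !rowK.
move=> _ <-.
have [v_n v_c n_c] : [/\ aVal s != aNext s, aVal s != aCode s & aNext s != aCode s].
  by rewrite /aVal /aNext /aCode; split; lia.
have other a i : (i != g) || (a \notin [:: aVal s; aNext s; aCode s]) ->
    arr st4 a i = arr st3 a i.
  rewrite -negb_and !inE => h; rewrite /st4 !arr_set_arr.
  by do 3!(case: ifP => [/andP[/eqP aE /eqP iE]|_]; first by rewrite aE iE !eqxx ?orbT in h).
have V4 : arr st4 (aVal s) g = v%:R%R.
  by rewrite /st4 !arr_set_arr (negbTE v_c) (negbTE v_n) !eqxx vE.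
have N4 : arr st4 (aNext s) g = scal st3 vNext.
  by rewrite /st4 !arr_set_arr (negbTE n_c) !eqxx.
have C4 : arr st4 (aCode s) g = scal st3 vCode.
  by rewrite /st4 !arr_set_arr !eqxx.
split=> //.
- apply: prepared_frame p3; split=> // a sa.
  have a8 : a < 8 by move: sa; rewrite !negb_and !negbK -leqNgt; lia.
  have [n1 n2 n3] := aVal_small s a8.
  by rewrite /st4 /= /upd (negbTE n1) (negbTE n2) (negbTE n3).
- exists v; split=> //; last first.
    move=> v0; have := ptr v0; rewrite -N4 -C4; apply: pointer_ext => a i gi.
    by rewrite other ?arr3 // gtn_eqF.
  move=> c rc; inversion rc as [g1 s1 fin1 E1 E2 E3|g1 s1 g' s' c' fol rel rc' E1 E2 E3].
    exact: fin.
  have [o xc [tg gg]] := follows_candidate fol.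
  have := fA g' s' (follows_lt fol); rewrite rel => -[v' [Av' ov' _ _]].
  have /andP[v'0 v'c] := ov' _ rc'.
  have /andP[-> vle] := opt _ _ _ xc tg gg Av' v'0 fol.
  by apply: leq_trans vle _; rewrite addnC -addnS leq_add2l.
- by move=> a i h; rewrite other // arr3 arrE.
Qed.

Lemma has_iotaS (f : pred nat) j : has f (iota 0 j.+1) = has f (iota 0 j) || f j.
Proof. by rewrite -addn1 iotaD has_cat /= orbF. Qed.

Lemma arrays_neq s s' : s != s' ->
  [/\ aVal s' \notin [:: aVal s; aNext s; aCode s], aNext s' \notin [:: aVal s; aNext s; aCode s]
    & aCode s' \notin [:: aVal s; aNext s; aCode s]].
Proof.
move=> ne; have : enum_rank s != enum_rank s' :> nat.
  by apply: contraNneq ne => /val_inj/enum_rank_inj ->.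
rewrite /aVal /aNext /aCode !inE; move: (nat_of_ord _) (nat_of_ord _) => x y.
by move=> xy; split; lia.
Qed.

Lemma wp_solve_row g st : prepared st -> scal st vRow = g%:R%R -> filled (arr st) g.+1 ->
  wp M (solve_row k) (fun st' => [/\ prepared st', scal st' vRow = g%:R%R,
    forall s, solved (arr st') g s & forall a i, i != g -> arr st' a i = arr st a i]) st.
Proof.
move=> p row fA.
pose Inv (l : seq window) st' := [/\ prepared st', scal st' vRow = g%:R%R,
  forall s, s \in l -> solved (arr st') g s & forall a i, i != g -> arr st' a i = arr st a i].
apply: (@wp_seqs _ _ _ Inv) => //; last first.
  by move=> st' [h1 h2 h3 h4]; split=> // s; apply: h3; rewrite mem_enum.
move=> l1 s l2 st1 lE [p1 row1 sol1 arr1].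
have fA1 : filled (arr st1) g.+1.
  move=> g' s' gg; have := fA g' s' gg; case: ifP => _; last by rewrite arr1 // gtn_eqF.
  have same a i : g < i -> arr st1 a i = arr st a i by move=> gi; rewrite arr1 // gtn_eqF.
  by apply: solved_ext => a *; apply: same => //; apply: ltn_trans gg _.
apply: wp_mono (wp_solve_window s (fun=> erefl) p1 row1 fA1) _ => st2 [p2 row2 sol2 arr2].
split=> // [s'|a i ig]; last by rewrite arr2 ?ig // arr1.
rewrite mem_rcons inE; have [-> //|ne] := eqVneq s' s; move=> /= /sol1.
rewrite eq_sym in ne; have [n1 n2 n3] := arrays_neq ne.
apply: solved_ext => [a i gi|a ain]; apply: arr2; first by rewrite gtn_eqF.
apply/orP; right; move: ain; rewrite in_cons => /orP[/eqP->//|].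
by rewrite in_cons => /orP[/eqP->//|]; rewrite mem_seq1 => /eqP->.
Qed.

Definition prev_step g (acc j : nat) : nat :=
  if act j && (hb j < g + 4) then maxn acc (minn (hb j) g).-1 else acc.
Definition previous g := foldl (prev_step g) 0 (iota 0 n).

Lemma prevP g : 0 < g ->
  [/\ previous g < g, (previous g == 0) || relevant (previous g) &
      forall g', g' < g -> relevant g' -> g' <= previous g].
Proof.
move=> g0; rewrite /previous /Blocks.relevant.
suff H m : [/\ foldl (prev_step g) 0 (iota 0 m) < g,
   (foldl (prev_step g) 0 (iota 0 m) == 0) ||
     has (fun j => [&& act j, foldl (prev_step g) 0 (iota 0 m) < hb j & hb j <= foldl (prev_step g) 0 (iota 0 m) + 4]) (iota 0 m) &
   forall g', g' < g -> has (fun j => [&& act j, g' < hb j & hb j <= g' + 4]) (iota 0 m) ->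
      g' <= foldl (prev_step g) 0 (iota 0 m)] by apply: H.
elim: m => [|m [IH1 IH2 IH3]]; first by split.
rewrite foldl_iotaS; set f := foldl _ _ _ in IH1 IH2 IH3 *.
have h6 := end_block_ge I k m.
rewrite /prev_step; case: ifP => [/andP[am hg]|nam]; last first.
  split=> //; first by rewrite has_iotaS; case/orP: IH2 => ->; rewrite ?orbT.
  move=> g' gg; rewrite has_iotaS => /orP[|/and3P[am g1 g2]]; first exact: IH3.
  by move: nam; rewrite am; lia.
split.
- by rewrite gtn_max IH1; lia.
- rewrite has_iotaS; case: (leqP f (minn (hb m) g).-1) => fm.
    by rewrite am /=; apply/orP; right; apply/orP; right; lia.
  by case/orP: IH2 => ->; rewrite ?orbT.
- move=> g' gg; rewrite has_iotaS leq_max => /orP[h|/and3P[_ g1 g2]].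
    by rewrite IH3.
  by apply/orP; right; lia.
Qed.

Lemma wp_prev_row g st : prepared st -> scal st vRow = g%:R%R -> 0 < g ->
  wp M prev_row (fun st' => scal st' vRow = (previous g)%:R%R) st.
Proof.
move=> p row g0; apply: wp_seq; apply: wp_var.
pose Inv j st' := [/\ prepared st', scal st' vRow = g%:R%R &
  scal st' vPrev = (foldl (prev_step g) 0 (iota 0 j))%:R%R].
have n4 : scal st 4 = n%:R%R by case: p => -[-> ].
apply: wp_seq; apply: (@wp_for M n _ Inv _ _ nM) => //.
- by move=> j st' v [p' row' h]; split=> //; apply: prepared_var.
- by split=> //; apply: prepared_var.
- move=> j st' jn vj [p' row' h].
  set f := foldl _ _ _ in h; have h6 := end_block_ge I k j.
  have post v st2 : prepared st2 -> scal st2 vRow = g%:R%R -> scal st2 vPrev = v%:R%R ->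
     v = prev_step g f j -> Inv j.+1 st2.
    by move=> h1 h2 h3 h4; split=> //; rewrite foldl_iotaS -/f -h4.
  apply: wp_if; rewrite evalt_And (evalt_act p' vj jn) evalt_Lt (eval_end_block p' vj jn)
    (eval_ops st') [eval st' (EVar _)]row' (eval_ops st') -natrD ltr_nat => c; last first.
    by apply: wp_skip; apply: (post f) => //; rewrite /prev_step (negbTE c).
  pose t := (minn (hb j) g).-1.
  apply: wp_seq; apply: (@wp_mono _ _ (fun st2 => st2 = set_var st' vTmp t%:R%R)).
    apply: wp_if; rewrite evalt_Le (eval_end_block p' vj jn) [eval st' (EVar _)]row' ler_nat => le;
      apply: wp_var; rewrite (eval_ops st') ?(eval_end_block p' vj jn) ?[eval st' (EVar _)]row' (eval_ops st') /t.
      by rewrite (minn_idPl le) -subn1 natrB // (leq_trans _ h6).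
    have gl : g <= hb j by rewrite ltnW // ltnNge.
    by rewrite (minn_idPr gl) -subn1 natrB.
  move=> _ ->; set st2 := set_var _ _ _.
  have p2 : prepared st2 by apply: prepared_var.
  have e1 : scal st2 vTmp = t%:R%R by rewrite /st2 /= upd_eq.
  have e2 : scal st2 vPrev = f%:R%R := h.
  have pE : prev_step g f j = maxn f t by rewrite /prev_step c.
  apply: wp_if; rewrite evalt_Lt [eval st2 (EVar vTmp)]e1 [eval st2 (EVar vPrev)]e2 ltr_nat => le.
    apply: wp_var; apply: (post t); first exact: prepared_var.
    - exact: row'.
    - by rewrite /= upd_eq.
    - by rewrite pE (maxn_idPr (ltnW le)).
  by apply: wp_skip; apply: (post f) => //; rewrite pE (maxn_idPl _) // leqNgt.
move=> st' [_ _ h]; apply: wp_var; by rewrite /= upd_eq h.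
Qed.

(** Bounds the number of remaining iterations: a relevant row is [hb j - o - 1]
    for some job [j] and some [o < 4], see [relevant_row]. *)
Definition rows_below g := #|[pred x : 'I_n * 'I_4 | hb x.1 - x.2.+1 < g]|.

Lemma rows_below_le g : rows_below g <= n * 4.
Proof. by apply: leq_trans (max_card _) _; rewrite card_prod !card_ord. Qed.

Lemma relevant_row g : relevant g -> exists2 x : 'I_n * 'I_4, hb x.1 - x.2.+1 = g & True.
Proof.
case/hasP=> j; rewrite mem_iota => /= jn /and3P[_ g1 g2].
have o4 : hb j - g.+1 < 4 by lia.
by exists (Ordinal jn, Ordinal o4) => //=; lia.
Qed.

Lemma rows_below_lt g g' : relevant g -> g < g' -> rows_below g < rows_below g'.
Proof.
move=> /relevant_row[x xg _] gg; apply: proper_card; apply/properP; split.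
  by apply/subsetP => y; rewrite !inE => /ltn_trans; apply.
by exists x; rewrite !inE xg ?ltnn.
Qed.

Lemma wp_fill st : prepared st -> (forall a i, 7 < a -> arr st a i = 0%R) ->
  wp M (fill_table k) (fun st' => [/\ prepared st', filled (arr st') 0 &
    arr st' aOut = arr st aOut]) st.
Proof.
move=> p zero; apply: wp_seq; apply: wp_var.
have e3 : scal st 3 = (npaths I)%:R%R by case: p => -[->].
rewrite (eval_ops st) [eval st (EVar 3)]e3 (eval_ops st) -natrD.
set top := npaths I + (6 * B + 1).
pose Inv m st' := exists g, [/\ [/\ prepared st', scal st' vRow = g%:R%R & m = rows_below g + (0 < g)],
  filled (arr st') g, forall g' s, g' < g -> arr st' (aVal s) g' = 0%R &
  arr st' aOut = arr st aOut].
apply: (@wp_while _ _ _ Inv (rows_below top + (0 < top))).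
- by have := rows_below_le top; case: (0 < top); lia.
- exists top; split=> //; [by split=> //; apply: prepared_var| |by move=> g' s _; apply: zero].
  move=> g s tg; case: ifP => [|_]; last exact: zero.
  case/orP=> [/hasP[j _ /and3P[_ g1 _]]|/eqP g0].
    by have := leq_ltn_trans (leq_trans g1 (ltnW (end_block_lt I k j))) (leq_ltn_trans tg (ltnSn g)); rewrite ltnn.
  by move: tg; rewrite g0 /top addn1 addnS.
- move=> m st1 [g [[p1 row1 mE] fil1 zero1 out1]] ev.
  have g0 : 0 < g by move: ev; rewrite evalt_Lt [eval st1 (EVar _)]row1 (eval_ops st1) ltr_nat.
  have [pg prel pmax] := prevP g0.
  have wr1 : writes [pred x | x \in [:: vJob; vRow; vPrev; vTmp]] pred0 prev_row by [].
  apply: wp_seq; apply: wp_mono (wp_frame wr1 (wp_prev_row p1 row1 g0)) _.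
  move=> st2 [row2 [f2 a2]].
  have p2 : prepared st2.
    apply: prepared_frame p1; split=> y; last by move=> _; apply: a2.
    by move=> y4; apply: f2; rewrite !inE; apply: contraNN y4 => /or4P[] /eqP->.
  have arr2 a : arr st2 a = arr st1 a by rewrite a2.
  have fil2 : filled (arr st2) (previous g).+1.
    move=> g' s pg'; have [gg|gg] := leqP g g'.
      have := fil1 g' s gg; rewrite arr2; case: ifP => // _.
      by apply: solved_ext => *; rewrite arr2.
    rewrite arr2 zero1 //; case: ifP => // /orP[rel|/eqP g'0].
      by have := pmax g' gg rel; rewrite leqNgt pg'.
    by move: pg'; rewrite g'0.
  have wr3 : writes predT (fun a => 7 < a) (solve_row k).
    apply: writes_seqs; apply/allP => s _.
    do 2!(apply/andP; split=> //); apply/andP; split=> //.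
    by apply: writes_seqs; apply/allP.
  apply: wp_mono (wp_frame wr3 (wp_solve_row p2 row2 fil2)) _ => st3 [[p3 row3 sol3 arr3] [_ out3]].
  exists (rows_below (previous g) + (0 < previous g)).
    rewrite mE g0 addn1; case/orP: prel => [/eqP->|rel].
      have -> : rows_below 0 = 0 by apply: eq_card0 => x; rewrite inE ltn0.
      by [].
    by rewrite ltnS; apply: leq_trans (rows_below_lt rel pg); case: (0 < previous g); rewrite ?addn1 ?addn0.
  exists (previous g); split=> //.
  + move=> g' s pg'; have [->|ne] := eqVneq g' (previous g); first by rewrite orbC prel.
    have lt : previous g < g' by rewrite ltn_neqAle eq_sym ne.
    have := fil2 g' s lt; rewrite arr3 //; case: ifP => // _.
    have same a i : previous g < i -> arr st3 a i = arr st2 a i by move=> h; rewrite arr3 // gtn_eqF.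
    by apply: solved_ext => a *; apply: same => //; apply: ltn_trans lt _.
  + move=> g' s g'p; rewrite arr3 ?ltn_eqF // arr2 zero1 //; exact: ltn_trans pg.
  + by rewrite out3 // arr2.
- move=> m st1 [g [[p1 row1 mE] fil1 zero1 out1]].
  rewrite evalt_Lt [eval st1 (EVar _)]row1 (eval_ops st1) ltr_nat -eqn0Ngt => /eqP gE.
  by rewrite gE in fil1.
Qed.

Lemma prepared_arr st a i v : safe_arrays a -> prepared st -> prepared (set_arr st a i v).
Proof.
move=> sa; apply: prepared_frame; split=> // b nb.
by rewrite /= upd_ne //; apply: contraNneq nb => ->.
Qed.

Definition picks g (Y : pattern) : seq (bool * nat) :=
  [seq (x.1, g * B + x.2) | x : bool * 'I_B <- enum Y].

Definition assigned (E : seq (bool * nat)) (out : nat -> rat) j :=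
  exists2 x, x \in E & H j x.1 x.2 /\ out j = pick_code k x.

Definition marked g s (old out : nat -> rat) j :=
  if act j && hit j g.+1 s.1.2 then assigned (picks g.+1 s.1.2) out j else out j = old j.

Lemma hit_picks j g Y : hit j g Y = has (fun x => H j x.1 x.2) (picks g Y).
Proof.
rewrite /Blocks.hit /picks has_map; apply/exists_inP/hasP => -[x xY hx]; exists x => //.
  by rewrite mem_enum.
by rewrite mem_enum in xY.
Qed.

Lemma wp_mark_job s g st j : prepared st -> scal st vJob = j%:R%R -> scal st vRow = g%:R%R ->
  j < n -> wp M (mark_job s) (fun st' => marked g s (arr st aOut) (arr st' aOut) j /\
     forall i, i != j -> arr st' aOut i = arr st aOut i) st.
Proof.
move=> p vj row jn.
apply: wp_if; rewrite (evalt_act p vj jn) => aj; last first.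
  by apply: wp_skip; rewrite /marked (negbTE aj).
pose done (l : seq (bool * 'I_B)) (out : nat -> rat) :=
  if has (fun x : bool * 'I_B => H j x.1 (g.+1 * B + x.2)) l
  then exists2 x : bool * 'I_B, x \in l & H j x.1 (g.+1 * B + x.2) /\ out j = pick_code k (x.1, g.+1 * B + x.2)
  else out j = arr st aOut j.
pose Inv (l : seq (bool * 'I_B)) st' := [/\ prepared st', scal st' = scal st,
   forall i, i != j -> arr st' aOut i = arr st aOut i & done l (arr st' aOut)].
apply: (@wp_seqs _ _ _ Inv) => //.
  move=> l1 x l2 st1 _ [p1 s1 o1 d1].
  have vj1 : scal st1 vJob = j%:R%R by rewrite s1.
  have row1 : eval st1 (EVar vRow) = g%:R%R by rewrite /= s1.
  have idx : eval st1 (eIndex k (EVar vRow) 1 x.2) = ((g.+1 * B + x.2)%:R - (6 * B)%:R)%R.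
    by rewrite -(addn1 g); apply: eval_index.
  have condE : evalt st1 (tPrivate x.1 (eIndex k (EVar vRow) 1 x.2)) = H j x.1 (g.+1 * B + x.2).
    by rewrite (evalt_private (prepared_inputs p1) vj1) idx.
  have has_rcons' : has (fun x : bool * 'I_B => H j x.1 (g.+1 * B + x.2)) (rcons l1 x) =
     H j x.1 (g.+1 * B + x.2) || has (fun x : bool * 'I_B => H j x.1 (g.+1 * B + x.2)) l1.
    by rewrite has_rcons.
  apply: wp_if; rewrite condE => c.
    have outE : eval st1 (eOut x.1 (eIndex k (EVar vRow) 1 x.2)) = pick_code k (x.1, g.+1 * B + x.2).
      by rewrite /eOut /pick_code /=; case: ifP => _; [exact: idx | rewrite -idx -[RHS]sub0r].
    apply: wp_arr; rewrite outE [eval st1 (EVar vJob)]vj1 natrK; split=> //.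
    - exact: prepared_arr p1.
    - by move=> i ij; rewrite arr_set_arr (negbTE ij) andbF o1.
    - rewrite /done has_rcons' c; exists x; first by rewrite mem_rcons mem_head.
      by split=> //; rewrite arr_set_arr !eqxx.
  apply: wp_skip; split=> //; rewrite /done has_rcons' (negbTE c) /=.
  move: d1; rewrite /done; case: ifP => // _ [y yl hy]; exists y => //.
  by rewrite mem_rcons inE yl orbT.
move=> st' [_ _ o1 d1]; split=> //; rewrite /marked aj /= hit_picks /picks has_map.
move: d1; rewrite /done /=; rewrite -[has (preim _ _) _]/(has (fun x : bool * 'I_B => H j x.1 (g.+1 * B + x.2)) (enum s.1.2)).
case: ifP => // _ [x xl [hx ox]]; exists (x.1, g.+1 * B + x.2) => //.
by apply/mapP; exists x.
Qed.

Lemma wp_mark s g st : prepared st -> scal st vRow = g%:R%R ->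
  wp M (For (mark_job s)) (fun st' => [/\ prepared st', scal st' vRow = g%:R%R &
    (forall j, j < n -> marked g s (arr st aOut) (arr st' aOut) j) /\
    (forall j, n <= j -> arr st' aOut j = arr st aOut j)]) st.
Proof.
move=> p row.
have n4 : scal st 4 = n%:R%R by case: p => -[-> ].
pose Inv j st' := [/\ prepared st', scal st' vRow = g%:R%R &
   (forall i, i < j -> marked g s (arr st aOut) (arr st' aOut) i) /\
    (forall i, j <= i -> arr st' aOut i = arr st aOut i)].
have wr : writes pred0 (pred1 aOut) (mark_job s).
  by rewrite /= andbT; apply: writes_seqs; apply/allP.
apply: (@wp_for M n _ Inv _ _ nM) => //.
- by move=> j st' v [p' row' h]; split=> //; apply: prepared_var.
- exact: writes_sub wr.
move=> j st1 jn vj [p1 row1 [old new]].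
apply: wp_mono (wp_frame wr (wp_mark_job s p1 vj row1 jn)) _ => st2 [[mj other] [f2 a2]].
split.
- by apply: prepared_frame p1; split=> y h; [apply: f2 | apply: a2; apply: contraNN h => /eqP->].
- by rewrite f2.
- split=> i ij; last by rewrite other ?new //; [apply: ltnW | rewrite gtn_eqF].
  have [iE|ne] := eqVneq i j.
    by rewrite iE; move: mj; rewrite /marked /assigned (new j).
  have lt : i < j by move: ij; rewrite ltnS leq_eqVlt (negbTE ne).
  by have := old i lt; rewrite /marked /assigned other.
Qed.

Lemma wp_visits s g st (A : table) : prepared st -> scal st vRow = g%:R%R ->
  scal st vCur = (enum_rank s)%:R%R -> (forall a, 7 < a -> arr st a = A a) ->
  wp M (seqs [seq visit s' | s' <- enum {: window}]) (fun st' => [/\ prepared st',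
    (forall a, 7 < a -> arr st' a = A a),
    (forall j, j < n -> marked g s (arr st aOut) (arr st' aOut) j),
    scal st' vNext = A (aNext s) g & scal st' vCode = A (aCode s) g]) st.
Proof.
move=> p row cur arrA.
pose Inv (l : seq window) st' := [/\ prepared st', scal st' vRow = g%:R%R,
  scal st' vCur = (enum_rank s)%:R%R, (forall a, 7 < a -> arr st' a = A a) &
  if s \in l then [/\ forall j, j < n -> marked g s (arr st aOut) (arr st' aOut) j,
    scal st' vNext = A (aNext s) g & scal st' vCode = A (aCode s) g]
  else arr st' aOut = arr st aOut].
apply: (@wp_seqs _ _ _ Inv) => //; last first.
  by move=> st' [p' _ _ arr' ]; rewrite mem_enum inE => -[].
move=> l1 s' l2 st1 lE [p1 row1 cur1 arr1 d1].
have sl1 : s' \notin l1.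
  by have := enum_uniq {: window}; rewrite lE cat_uniq /= => /and3P[_ /norP[]].
apply: wp_if; rewrite evalt_Eq [eval st1 (EVar _)]cur1 (eval_ops st1) eqr_nat => c; last first.
  apply: wp_skip; split=> //; rewrite mem_rcons inE.
  by have -> : (s == s') = false by apply: contraNF c => /eqP->.
have sE : s' = s by move: c => /eqP/val_inj/enum_rank_inj.
subst s'; rewrite (negbTE sl1) in d1.
have wr : writes (pred1 vJob) (pred1 aOut) (For (mark_job s)).
  by rewrite /= !andbT; apply: writes_seqs; apply/allP.
apply: wp_seq; apply: wp_mono (wp_frame wr (wp_mark s p1 row1)) _.
move=> st2 [[p2 row2 [mk _]] [f2 a2]].
have arr2 a : 7 < a -> arr st2 a = A a.
  by move=> a7; rewrite a2 ?arr1 //; apply: contraTneq a7 => ->.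
apply: wp_seq; apply: wp_var; apply: wp_var.
set st3 := set_var _ vNext _.
have n3 : eval st2 (EGet (aNext s) (EVar vRow)) = A (aNext s) g by rewrite /= row2 natrK arr2.
have c3 : eval st3 (EGet (aCode s) (EVar vRow)) = A (aCode s) g.
  by rewrite /st3 /= [upd _ _ _ _]row2 natrK arr2.
split=> //.
- by do 2!(apply: prepared_var => //).
- by rewrite /= /upd /= f2.
- rewrite mem_rcons mem_head; split.
  + by move=> j jn; rewrite -d1; apply: mk.
  + by rewrite -n3.
  + by rewrite -c3.
Qed.

Definition rows_above g := #|[pred x : 'I_n * 'I_4 | g < hb x.1 - x.2.+1]|.

Lemma rows_above_lt g g' : relevant g' -> g < g' -> rows_above g' < rows_above g.
Proof.
move=> /relevant_row[x xg _] gg; apply: proper_card; apply/properP; split.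
  by apply/subsetP => y; rewrite !inE; apply: ltn_trans.
by exists x; rewrite !inE xg ?ltnn.
Qed.

(** The state before the window [s] at row [g] is visited, [E] being the list of
    picks marked so far. The picks on the left of the window were the previous
    centre; those in its centre and on its right are still to be marked, which
    is why jobs that end within the window may be left to them. *)
Record walking (A : table) c0 (E : seq (bool * nat)) g s (v : nat) (st : store) : Prop := Walking {
  walk_next : (0 < scal st vNext)%R;
  walk_row : scal st vRow = g%:R%R;
  walk_cur : scal st vCur = (enum_rank s)%:R%R;
  walk_val : A (aVal s) g = v%:R%R;
  walk_pos : 0 < v;
  walk_rel : relevant g || (g == 0);
  walk_size : size E + v = c0.+1;
  walk_early : forall j, j < n -> act j -> hb j <= g.+2 ->
    [\/ assigned E (arr st aOut) j, hit j g.+1 s.1.2 | hit j g.+2 s.2];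
  walk_left : forall j, j < n -> act j -> hit j g s.1.1 -> assigned E (arr st aOut) j }.

Definition arrived c0 (E : seq (bool * nat)) (st : store) : Prop :=
  [/\ scal st vNext = 0%R, size E <= c0 &
      forall j, j < n -> act j -> assigned E (arr st aOut) j].

(** Marking the centres is enough, because picks on the right of a window are
    the next centre and picks on its left were the previous one. *)
Lemma walk_step A c0 E g s v st st' : filled A 0 -> walking A c0 E g s v st ->
  (forall j, j < n -> marked g s (arr st aOut) (arr st' aOut) j) ->
  scal st' vRow = A (aNext s) g -> scal st' vNext = A (aNext s) g ->
  scal st' vCur = A (aCode s) g ->
  arrived c0 (E ++ picks g.+1 s.1.2) st' \/
  exists g' s' v', [/\ relevant g', g < g' & walking A c0 (E ++ picks g.+1 s.1.2) g' s' v' st'].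
Proof.
move=> fA [nx row cur Av v0 rel sz early left] mk row' nx' cur'.
set E' := E ++ _; set out' := arr st' aOut.
have szE : size E' = size E + #|s.1.2| by rewrite size_cat size_map -cardE.
have asg j : j < n -> act j -> assigned E (arr st aOut) j \/ hit j g.+1 s.1.2 -> assigned E' out' j.
  move=> jn aj h; have := mk j jn; rewrite /marked aj /=; case: ifP => [_ [x xp hx]|nh o'].
    by exists x; rewrite // mem_cat xp orbT.
  case: h => [[x xE [Hx ox]]|]; last by rewrite nh.
  by exists x; [rewrite mem_cat xE | rewrite /out' o'].
have := fA g s (leq0n g); rewrite rel => -[v1 [Av1 _ _ ptr]].
have {}ptr : pointer A g s v (A (aNext s) g) (A (aCode s) g).
  by move: Av1; rewrite Av => /eqP; rewrite eqr_nat => /eqP vE; rewrite vE in v0 *; apply: ptr.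
case: ptr => [[nx0 fin vE]|[g' [s' [v' [nxE cdE [fol rel'] Av' [v'0 vE]]]]]].
  left; split; rewrite ?nx' ?nx0 //; first by rewrite szE; move: sz; rewrite vE; lia.
  move=> j jn aj; apply: asg => //; case/andP: fin => /eqP s2 /eqP fp.
  have [hj|hj] := leqP (hb j) g.+2.
    case: (early j jn aj hj) => [||]; [by left | by right |].
    by rewrite s2 hit_picks /picks enum_set0.
  have pj : ~~ pending g s j.
    case: (first_pendingP n act hb H g s) => [[_ /(_ j jn)] //|[i _ [pi fi _]]].
    by move: pi; rewrite /Blocks.pending -fi fp ltn0 andbF.
  move: pj; rewrite /Blocks.pending aj hj /= negbK => /or3P[h|h|]; [left; exact: left h | by right |].
  by rewrite s2 hit_picks /picks enum_set0.
right; exists g', s', v'; have gg := follows_lt fol; split=> //.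
have nxt j : j < n -> act j -> hit j g.+2 s.2 -> hit j g'.+1 s'.1.2.
  move=> jn aj; case/and3P: fol => _ + _; case: ifP => [/eqP-> _|_ /and3P[/eqP-> _ /eqP->] //].
  by rewrite hit_picks /picks enum_set0.
have lft j : j < n -> act j -> hit j g' s'.1.1 -> hit j g.+1 s.1.2.
  move=> jn aj; case/and3P: fol => _ + _; case: ifP => [_ /and4P[_ _ _ /eqP->]|_ /and3P[/eqP-> /eqP-> _] //].
  by rewrite hit_picks /picks enum_set0.
split; rewrite ?nx' ?row' ?cur' //.
- by rewrite nxE ltr0n (leq_ltn_trans _ gg).
- by rewrite rel'.
- by rewrite szE -sz vE addnAC addnA.
- move=> j jn aj hj; have [hj'|hj'] := leqP (hb j) g.+2.
    case: (early j jn aj hj') => h; [|by apply: Or31; apply: asg => //; right|].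
      by apply: Or31; apply: asg => //; left.
    by apply: Or32; apply: nxt.
  have [pj|npj] := boolP (pending g s j); last first.
    move: npj; rewrite /Blocks.pending aj hj' /= negbK => /or3P[h|h|h].
    + by apply: Or31; apply: asg => //; left; apply: left.
    + by apply: Or31; apply: asg => //; right.
    + by apply: Or32; apply: nxt.
  case/and3P: (fol) => _ _ /allP/(_ j); rewrite mem_iota add0n => /(_ jn).
  rewrite pj hj /= => /or3P[h|h|h]; [|by apply: Or32|by apply: Or33].
  by apply: Or31; apply: asg => //; right; apply: lft.
- by move=> j jn aj h; apply: asg => //; right; apply: lft.
Qed.

Lemma wp_walk st c0 : prepared st -> filled (arr st) 0 -> (forall j, arr st aOut j = 0%R) ->
  arr st (aVal (no_picks k)) 0 = c0.+1%:R%R ->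
  wp M (walk k) (fun st' => exists E, size E <= c0 /\
     forall j, j < n -> if act j then assigned E (arr st' aOut) j else arr st' aOut j = 0%R) st.
Proof.
move=> p fA out0 Av.
set A := arr st in fA Av.
do 3!(apply: wp_seq; apply: wp_var).
set st0 := set_var _ _ _.
pose Inv m st' := exists E, [/\ prepared st', (forall a, 7 < a -> arr st' a = A a),
  (forall j, j < n -> ~~ act j -> arr st' aOut j = 0%R) &
  arrived c0 E st' \/ exists g s v, walking A c0 E g s v st' /\ m = (rows_above g).+1].
apply: (@wp_while _ _ _ Inv (rows_above 0).+1).
- apply: leq_ltn_trans M_ge; apply: leq_trans (max_card _) _.
  by rewrite card_prod !card_ord.
- exists [::]; split=> //.
  + by do 3!(apply: prepared_var => //).
  + by move=> j jn _; apply: out0.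
  right; exists 0, (no_picks k), c0.+1; split=> //; split=> //.
  + by rewrite orbT.
  + by move=> j jn aj; have := end_block_ge I k j; lia.
  + by move=> j jn aj; rewrite hit_picks /picks enum_set0.
- move=> m st1 [E [p1 A1 na1 [[nx _ _]|[g [s [v [W mE]]]]]]].
    by rewrite evalt_Lt /= nx ltxx.
  move=> _; apply: wp_seq.
  apply: wp_mono (wp_visits p1 (walk_row W) (walk_cur W) A1) _ => st2 [p2 A2 mk n2 c2].
  do 2!(apply: wp_seq || apply: wp_var); apply: wp_var.
  set st3 := set_var _ _ _.
  have na3 j : j < n -> ~~ act j -> arr st3 aOut j = 0%R.
    by move=> jn aj; have := mk j jn; rewrite /marked (negbTE aj) /= => ->; apply: na1.
  have p3 : prepared st3 by do 2!(apply: prepared_var => //).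
  have [//|//|//|done|[g' [s' [v' [rel gg W']]]]] := walk_step (st' := st3) fA W mk.
    by exists 0; [rewrite mE | exists (E ++ picks g.+1 s.1.2); split=> //; left].
  exists (rows_above g').+1; first by rewrite mE ltnS; apply: rows_above_lt.
  by exists (E ++ picks g.+1 s.1.2); split=> //; right; exists g', s', v'.
- move=> m st1 [E [p1 A1 na1 [[nx sz asg]|[g [s [v [W mE]]]]]]].
    move=> _; exists E; split=> // j jn; case: ifP => [aj|/negbT aj]; first exact: asg.
    exact: na1.
  by rewrite evalt_Lt /= (walk_next W).
Qed.
End Verify.

Local Open Scope ring_scope.

(** * From the real geometry to the rational tests *)

(** A real starting time matters only through its position among finitely many
    rational endpoints, so it may be assumed to be rational. *)
Lemma rational_twin (R : realType) (l : seq rat) (s : R) : exists s' : rat,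
  forall x, x \in l -> (x <= s') = (ratr x <= s) /\ (s' <= x) = (s <= ratr x).
Proof.
have [/hasP[x _ /eqP <-]|none] := boolP (has (fun x => ratr x == s) l).
  by exists x => y _; rewrite !ler_rat.
suff [u [v [us sv uv]]] : exists u v : R, [/\ u < s, s < v &
    forall x, x \in l -> (ratr x <= u) || (v <= ratr x)].
  have [q] := rat_in_itvoo (lt_trans us sv); rewrite in_itv /= => /andP[uq qv].
  exists q => x /uv /orP[xu|vx].
    have qx : x < q by rewrite -(ltr_rat R); apply: le_lt_trans xu uq.
    have sx := le_lt_trans xu us.
    by split; [rewrite !ltW | rewrite !leNgt qx sx].
  have qx : q < x by rewrite -(ltr_rat R); apply: lt_le_trans qv vx.
  have sx := lt_le_trans sv vx.
  by split; [rewrite !leNgt qx sx | rewrite !ltW].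
elim: l none => [|x l IH] /=.
  by exists (s - 1), (s + 1); split=> //; [rewrite ltrBlDr ltrDl | rewrite ltrDl].
rewrite negb_or => /andP[xs /IH[u [v [us sv uv]]]].
have [xlt|slt] := ltrP (ratr x) s.
  exists (Num.max u (ratr x)), v; split; rewrite ?gt_max ?us //.
  move=> y; rewrite inE => /orP[/eqP->|/uv /orP[yu|->]]; rewrite ?orbT //.
    by rewrite le_max lexx orbT.
  by rewrite le_max yu.
exists u, (Num.min v (ratr x)); split=> //; first by rewrite lt_min sv lt_neqAle eq_sym xs.
move=> y; rewrite inE => /orP[/eqP->|/uv /orP[->|vy]] //; rewrite ge_min ?lexx ?vy ?orbT //.
Qed.

Section Bridge.
Variables (R : realType) (I : instance) (o : 'I_(njobs I)).
Hypothesis valid : valid_instance I.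
Notation j := (nat_of_ord o).
Notation covers := (Track.covers (jD I) (jdur I j) (jm I) (jlo I j) (jhi I j)).
Notation private := (Track.private (jD I) (jr I j) (je I j) (jdur I j) (jm I) (jlo I j) (jhi I j)).
Notation uncovered := (Track.uncovered (jD I) (jdur I j) (jm I) (jlo I j) (jhi I j)).
Notation start := (Track.start (jD I) (jdur I j) (jlo I j)).
Notation finish := (Track.finish (jD I) (jhi I j)).
Implicit Types (P : train_path I) (A : {set train_path I}).

Lemma jobnE : jobn I j = job_of I o.
Proof. by rewrite /jobn valK. Qed.

Lemma jobE : [/\ 0 <= jr I j, 0 <= jdur I j & jr I j <= je I j].
Proof.
have := valid_jobn valid j; rewrite /je /jr /jdur => -[[? ? ? ?] [? ? ?]].
by split=> //; rewrite lerBrDr.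
Qed.

Lemma D_gt0 : 0 < jD I. Proof. by case: valid => -[]. Qed.

Lemma offsets : [/\ forall d, 0 <= jlo I j d, forall d, jlo I j d <= jhi I j d,
   forall d, jhi I j d <= travel I & jhi I j true - jlo I j true = jhi I j false - jlo I j false].
Proof.
have [[L0 _ d0 _] _] := valid; have [[_ _ _ ls0] [_ lse leL]] := valid_jobn valid j.
rewrite /jlo /jhi; set a := _ * _ / _; set b := loc_end _ * _ / _.
have a0 : 0 <= a by rewrite divr_ge0 ?mulr_ge0 // ltW.
have ab : a <= b by rewrite ler_pM2r ?invr_gt0 // ler_pM2r.
have bd : b <= travel I by rewrite ler_pdivrMr // mulrC ler_pM2l.
by split=> [[]|[]|[]|]; lra.
Qed.

Definition path_pos P : bool * int := (P.1, (path_num P)%:Z).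

(** The train is at the locations of the job during the interval from [lo] to
    [hi] after its departure; the possession has to meet this interval. *)
Lemma cancelsE (s : R) P : cancels o s P <->
  ratr (start P.1 (path_num P)%:R) <= s <= ratr (finish P.1 (path_num P)%:R).
Proof.
have [[L0' D0' d0' _] _] := valid.
have L0 : 0 < ratr (corridor I) :> R by rewrite ltr0q.
have d0 : 0 < ratr (travel I) :> R by rewrite ltr0q.
have [lo0 lohi hid _] := offsets.
have p0 : 0 <= ratr (jdur I j) :> R by rewrite ler0q; case: jobE.
have loE d : ratr (jlo I j d) = (if d then ratr (loc_start (job_of I o)) * ratr (travel I) / ratr (corridor I)
  else ratr (travel I) - ratr (loc_end (job_of I o)) * ratr (travel I) / ratr (corridor I)) :> R.
  by rewrite /jlo jobnE; case: d; rewrite ?rmorphB /= fmorph_div rmorphM.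
have hiE d : ratr (jhi I j d) = (if d then ratr (loc_end (job_of I o)) * ratr (travel I) / ratr (corridor I)
  else ratr (travel I) - ratr (loc_start (job_of I o)) * ratr (travel I) / ratr (corridor I)) :> R.
  by rewrite /jhi jobnE; case: d; rewrite ?rmorphB /= fmorph_div rmorphM.
have durE : ratr (jdur I j) = ratr (duration (job_of I o)) :> R by rewrite /jdur jobnE.
have lo0' : 0 <= ratr (jlo I j P.1) :> R by rewrite ler0q.
have lohi' : ratr (jlo I j P.1) <= ratr (jhi I j P.1) :> R by rewrite ler_rat.
have hid' : ratr (jhi I j P.1) <= ratr (travel I) :> R by rewrite ler_rat.
rewrite /Track.start /Track.finish rmorphB !rmorphD !rmorphM /= ratr_nat.
move: lo0' lohi' hid' (loE P.1) (hiE P.1) p0; rewrite durE /cancels /on_path.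
set lo := ratr (jlo _ _ _); set hi := ratr (jhi _ _ _); set L := ratr (corridor I) in L0 *.
set dl := ratr (travel I) in d0 *; set p := ratr (duration _); set D : R := ratr (jD I).
set i : R := (path_num P)%:R; set ls := ratr (loc_start _); set le := ratr (loc_end _).
move=> lo0' lohi' hid' loE' hiE' p0.
have loL : lo * L = if P.1 then ls * dl else (L - le) * dl.
  by rewrite loE'; case: (P.1); field; rewrite gt_eqF.
have hiL : hi * L = if P.1 then le * dl else (L - ls) * dl.
  by rewrite hiE'; case: (P.1); field; rewrite gt_eqF.
split.
  case=> t [x [[lam [/andP[l0 l1] -> ->]] /andP[st1 ts] /andP[x1 x2]]].
  have lo_l : lo <= lam * dl.
    rewrite -(ler_pM2r L0) loL; move: x1 x2; case: (P.1) => /= x1 x2.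
      by rewrite [lam * dl * L]mulrAC ler_pM2r.
    by rewrite [lam * dl * L]mulrAC ler_pM2r //; move: x2; rewrite mulrBl mul1r; lra.
  have hi_l : lam * dl <= hi.
    rewrite -(ler_pM2r L0) hiL; move: x1 x2; case: (P.1) => /= x1 x2.
      by rewrite [lam * dl * L]mulrAC ler_pM2r.
    by rewrite [lam * dl * L]mulrAC ler_pM2r //; move: x1; rewrite mulrBl mul1r; lra.
  by lra.
move=> /andP[h1 h2].
pose t := Num.max s (i * D + lo).
have t1 : s <= t by rewrite le_max lexx.
have t2 : i * D + lo <= t by rewrite le_max lexx orbT.
have t3 : t <= s + p by rewrite ge_max; lra.
have t4 : t <= i * D + hi by rewrite ge_max; lra.
pose lam := (t - i * D) / dl.
have lamE : lam * dl = t - i * D by rewrite mulfVK // gt_eqF.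
exists t, ((if P.1 then lam else 1 - lam) * L); split; last first.
- have u1 : lo * L <= lam * L * dl by rewrite [lam * L * dl]mulrAC lamE ler_pM2r //; lra.
  have u2 : lam * L * dl <= hi * L by rewrite [lam * L * dl]mulrAC lamE ler_pM2r //; lra.
  move: u1 u2; rewrite loL hiL; case: (P.1); rewrite !ler_pM2r // ?mulrBl ?mul1r; lra.
- by rewrite t1 t3.
exists lam; split=> //; last by rewrite lamE; ring.
by rewrite -(ler_pM2r d0) -[_ <= 1](ler_pM2r d0) lamE mul0r mul1r; lra.
Qed.

Lemma path_pos_inj : injective path_pos.
Proof. by move=> [d i] [d' i'] [-> /val_inj ->]. Qed.

Lemma path_posP (d : bool) (i : int) : 1 <= (i%:~R : rat) <= jm I -> exists P, path_pos P = (d, i).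
Proof.
rewrite /jm -[(npaths I)%:R]/((npaths I)%:Z%:~R) -[1]/(1%:~R) !ler_int => /andP[].
case: i => // i; case: i => // i i1 im.
have im' : (i < npaths I)%N by [].
by exists (d, Ordinal im').
Qed.

Lemma path_num_valid P : 1 <= ((path_pos P).2%:~R : rat) <= jm I.
Proof.
rewrite /path_pos /= /path_num -[_%:~R]/(_%:R) ler1n /= ler_nat; exact: ltn_ord.
Qed.

Lemma coversE (s : rat) P : covers s (path_pos P) <->
  start P.1 (path_num P)%:R <= s <= finish P.1 (path_num P)%:R.
Proof. by split=> [[]|] // h; split=> //; exact: path_num_valid. Qed.

Lemma covers_path (s : rat) Q : covers s Q -> exists P, path_pos P = Q.
Proof. by case: Q => d i [/path_posP h _]; apply: h. Qed.

Lemma possessionP A : possession R o A <-> exists s : rat, jr I j <= s <= je I j /\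
  forall P, P \in A <-> covers s (path_pos P).
Proof.
have relE : ratr (release (job_of I o)) = ratr (jr I j) :> R by rewrite /jr jobnE.
have endE : ratr (deadline (job_of I o)) - ratr (duration (job_of I o)) = ratr (je I j) :> R.
  by rewrite /je /jdur jobnE rmorphB.
rewrite /possession relE endE; split=> -[s [rse hA]]; last first.
  exists (ratr s); rewrite !ler_rat; split=> // P; rewrite hA coversE.
  by rewrite cancelsE !ler_rat.
pose l := [:: jr I j; je I j] ++
  [seq start P.1 (path_num P)%:R | P : train_path I] ++ [seq finish P.1 (path_num P)%:R | P : train_path I].
have [s' twin] := rational_twin l s; exists s'.
have mem_start P : start P.1 (path_num P)%:R \in l.
  by rewrite !mem_cat orbC (_ : _ \in [seq _ | P : train_path I]) ?orbT //; apply/imageP; exists P.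
have mem_finish P : finish P.1 (path_num P)%:R \in l.
  by rewrite !mem_cat (_ : _ \in [seq finish _ _ | P : train_path I]) ?orbT //; apply/imageP; exists P.
split; last first.
  move=> P; rewrite hA cancelsE coversE.
  by have [-> _] := twin _ (mem_start P); have [_ ->] := twin _ (mem_finish P).
have [-> _] := twin (jr I j) ltac:(by rewrite inE eqxx).
by have [_ ->] := twin (je I j) ltac:(by rewrite !inE eqxx orbT).
Qed.

Lemma path_of_private Q : private Q -> exists P, path_pos P = Q.
Proof. by case=> s [_ /covers_path]. Qed.

Lemma private_possession P : private (path_pos P) <-> possession R o [set P].
Proof.
rewrite possessionP; split=> -[s [rse]].
  move=> cP un; exists s; split=> // P'; rewrite inE; split=> [/eqP-> //|/un].
  by move/path_pos_inj => ->.
move=> h; exists s; split=> //; first by apply/h; rewrite inE.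
move=> Q cQ; have [P' P'Q] := covers_path cQ.
by move: cQ; rewrite -P'Q => /h; rewrite inE => /eqP ->.
Qed.

Lemma discardedE : discarded R o <-> exists s : rat, jr I j <= s <= je I j /\ uncovered s.
Proof.
rewrite /discarded possessionP; split=> -[s [rse h]]; exists s; split=> //.
  move=> Q cQ; have [P PQ] := covers_path cQ.
  by move: cQ; rewrite -PQ => /h; rewrite inE.
by move=> P; rewrite inE; split=> // /h.
Qed.

Lemma min_possession_exists A : possession R o A ->
  exists2 B, min_possession R o B & B \subset A.
Proof.
move: {2}#|A| (leqnn #|A|) => N; elim: N A => [|N IH] A AN pA.
  exists A => //; split=> // B pB BA.
  move: AN; rewrite leqn0 cards_eq0 => /eqP A0; move: BA; rewrite A0 subset0 => /eqP->.
  by [].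
have [[B [pB BA BneA]]|none] := boolp.EM (exists B, [/\ possession R o B, B \subset A & B <> A]).
  have BltA : (#|B| < #|A|)%N by apply: proper_card; rewrite properEneq BA andbT; apply/eqP.
  have [|C mC CB] := IH B _ pB; first by rewrite -ltnS (leq_trans BltA).
  by exists C => //; apply: subset_trans CB BA.
exists A => //; split=> // B pB BA; have [//|/eqP ne] := eqVneq B A.
by case: none; exists B.
Qed.

Hypothesis single : singleton_possessions R I.

(** The paths cancelled at [s] contain a minimal possession. *)
Lemma singles_covered (s : rat) : ~ discarded R o -> jr I j <= s <= je I j ->
  exists2 Q, covers s Q & private Q.
Proof.
move=> nd rse.
have [A hA] : exists A : {set train_path I}, forall P, P \in A <-> covers s (path_pos P).
  exists [set P | start P.1 (path_num P)%:R <= s <= finish P.1 (path_num P)%:R].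
  by move=> P; rewrite inE coversE.
have [|B mB BA] := @min_possession_exists A; first by apply/possessionP; exists s.
have /eqP/cards1P[P BP] := single nd mB.
exists (path_pos P); first by apply/hA/(subsetP BA); rewrite BP inE.
by apply/private_possession; rewrite -BP; case: mB.
Qed.

Lemma min_possession_private P : ~ discarded R o ->
  min_possession R o [set P] <-> private (path_pos P).
Proof.
move=> nd; rewrite private_possession; split=> [[]|pP] //; split=> // B pB.
by rewrite subset1 => /orP[/eqP //|/eqP B0]; case: nd; rewrite /discarded -B0.
Qed.

Lemma min_possession_single A : ~ discarded R o -> min_possession R o A ->
  exists2 P, A = [set P] & private (path_pos P).
Proof.
move=> nd mA; have /eqP/cards1P[P AP] := single nd mA.
by exists P => //; apply/private_possession; rewrite -AP; case: mA.
Qed.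
End Bridge.

Section Core.
Variables (R : realType) (I : instance) (o : 'I_(njobs I)) (k : nat).
Hypothesis valid : valid_instance I.
Hypothesis single_pos : singleton_possessions R I.
Hypothesis ratio : travel I <= k%:R * headway I.
Notation j := (nat_of_ord o).
Notation private := (Track.private (jD I) (jr I j) (je I j) (jdur I j) (jm I) (jlo I j) (jhi I j)).
Notation B := (2 * k + 3)%N.

Lemma m_ge1 : 1 <= jm I.
Proof. by case: valid => -[_ _ _ ?] _; rewrite /jm ler1n. Qed.

Lemma activeP : ~ discarded R o <-> active I k j.
Proof.
have [l0 lh hd wd] := offsets o valid; have [r0 p0 re] := jobE o valid.
rewrite discardedE // /active.
rewrite (discardP (mz := (npaths I)%:Z) (dl := travel I) (jdur I j) (kap := k) (D_gt0 valid) re l0 lh hd m_ge1 erefl ratio).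
by split=> /negP.
Qed.

Lemma singleP (d : bool) (q : nat) : single I k j d q <-> private (d, q%:Z - (6 * B)%:Z).
Proof.
have [l0 lh hd wd] := offsets o valid; have [r0 p0 re] := jobE o valid.
rewrite (privateP (mz := (npaths I)%:Z) (D_gt0 valid) p0 re lh wd m_ge1 erefl).
by rewrite /single intrB.
Qed.

Lemma single_end d q : single I k j d q -> (q %/ B <= end_block I k j)%N.
Proof.
move=> h; apply: leq_div2r; move: h; rewrite /single /private_test => /and5P[i1 im _ ie _].
have [l0 lh hd wd] := offsets o valid; have D0 := D_gt0 valid.
set i := q%:R - (6 * B)%:R in i1 im ie.
have [q' qE] : exists q', q = (q' + 6 * B)%N.
  exists (q - 6 * B)%N; rewrite subnK // -(ler_nat rat); move: i1; rewrite /i lerBrDr.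
  by apply: le_trans; rewrite lerDr.
rewrite qE leq_add2r leq_min; have iE : i = q'%:R by rewrite /i qE natrD addrK.
rewrite -(ler_nat rat) -iE im truncn_ge_nat; last first.
  by rewrite divr_ge0 ?(ltW D0) //; have [[]] := valid_jobn valid j.
rewrite -iE ler_pdivlMr //; move: ie (l0 d); rewrite /Track.start /je /jD; lra.
Qed.

(** Two blocks apart means more than [B] indices apart. *)
Lemma single_core d q d' q' : active I k j -> single I k j d q ->
  ((q %/ B).+2 <= q' %/ B)%N -> ((q' %/ B).+2 <= end_block I k j)%N -> single I k j d' q'.
Proof.
move=> /activeP nd hq qq' q'e.
have [l0 lh hd wd] := offsets o valid; have [r0 p0 re] := jobE o valid.
have D0 := D_gt0 valid.
have Bgt : (0 < B)%N by rewrite addn3.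
have far x y : ((x %/ B).+2 <= y %/ B)%N -> (x + B <= y)%N.
  move=> xy; apply: leq_trans (leq_divM y B); apply: leq_trans (leq_mul xy (leqnn B)).
  by rewrite mulSn addnC leq_add2l ltnW // ltn_ceil.
have qB := far _ _ qq'; have q'B := far _ _ q'e.
have B0 : 2 * k%:R + 3 <= B%:R :> rat by rewrite natrD natrM.
apply/singleP; move/singleP: hq => hq.
apply: (private_core (mz := (npaths I)%:Z) D0 p0 r0 re l0 lh hd wd m_ge1 erefl ratio
  (fun s => @singles_covered R I o valid single_pos s nd) B0 d' hq).
- rewrite !intrB -![_%:Z%:~R]/(_%:R : rat).
  by rewrite addrAC lerD2r -natrD ler_nat.
- rewrite intrB -![_%:Z%:~R]/(_%:R : rat) addrAC lerBlDr -!natrD ler_nat.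
  by apply: leq_trans q'B _; rewrite leq_add2r geq_minl.
- rewrite intrB -![_%:Z%:~R]/(_%:R : rat) -ler_pdivlMr // addrAC lerBlDr -natrD.
  have -> : je I j + jdur I j = deadline (jobn I j) by rewrite /je subrK.
  apply: (@le_trans _ _ (last_index I j + 6 * B)%:R); first by rewrite ler_nat.
  rewrite natrD lerD2r; apply: (@le_trans _ _ (Num.truncn (deadline (jobn I j) / headway I))%:R).
    by rewrite ler_nat geq_minr.
  by rewrite -truncn_ge_nat // divr_ge0 ?(ltW D0) //; have [[]] := valid_jobn valid j.
Qed.
End Core.

Local Close Scope ring_scope.

(** * Optimality and running time *)

Section Main.
Variables (R : realType) (I : instance) (k : nat).
Hypothesis valid : valid_instance I.
Hypothesis single_pos : singleton_possessions R I.
Hypothesis ratio : (travel I <= k%:R * headway I)%R.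
Notation n := (njobs I).
Notation B := (2 * k + 3).
Notation act := (active I k).
Notation hb := (end_block I k).
Notation H := (single I k).
Notation route := (@route B n act hb H).

Lemma optimal_route (S : seq (bool * nat)) :
  (forall j, j < n -> act j -> exists2 x, x \in S & H j x.1 x.2) ->
  exists2 c, route 0 (no_picks k) c & c <= size S.
Proof.
have B0 : 0 < B by rewrite addn3.
have h1 j d q : j < n -> act j -> H j d q -> q %/ B <= hb j.
  by move=> jn _; apply: (single_end (o := Ordinal jn) valid).
have h2 j d q d' q' : j < n -> act j -> H j d q -> (q %/ B).+2 <= q' %/ B ->
    (q' %/ B).+2 <= hb j -> H j d' q'.
  by move=> jn; apply: (@single_core R I (Ordinal jn) k).
have h3 j : j < n -> act j -> 6 <= hb j by move=> _ _; apply: end_block_ge.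
have h4 j : j < n -> act j -> hb j < npaths I + (6 * B + 1) by move=> _ _; apply: end_block_lt.
exact: (route_optimal B0 h1 h2 h3 h4).
Qed.

Definition pick_of (P : train_path I) : bool * nat := (P.1, path_num P + 6 * B).

Lemma single_pick (o : 'I_n) P :
  H o (pick_of P).1 (pick_of P).2 <->
  private (jD I) (jr I o) (je I o) (jdur I o) (jm I) (jlo I o) (jhi I o) (path_pos P).
Proof.
rewrite /pick_of (singleP o) // /path_pos.
by rewrite PoszD addrK.
Qed.

Lemma pick_codeE P : pick_code k (pick_of P) = path_code P.
Proof. by rewrite /pick_code /pick_of /path_code natrD /= addrK. Qed.

Lemma path_code_inj : injective (@path_code I).
Proof.
have pos (P : train_path I) : (0 < (path_num P)%:R :> rat)%R by rewrite ltr0n.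
move=> P Q; rewrite /path_code; have := pos P; have := pos Q.
case: P Q => [[] p] [[] q] /= hq hp.
- by move/eqP; rewrite eqr_nat => /eqP[/val_inj ->].
- by move=> E; rewrite E oppr_gt0 ltNge (ltW hq) in hp.
- by move=> E; rewrite -E oppr_gt0 ltNge (ltW hp) in hq.
- by move/oppr_inj/eqP; rewrite eqr_nat => /eqP[/val_inj ->].
Qed.

Lemma path_code_neq0 (P : train_path I) : path_code P != 0%R :> rat.
Proof. by rewrite /path_code; case: ifP; rewrite ?oppr_eq0 pnatr_eq0. Qed.

(** The value at row 0 is positive, since the set of all paths hits every active
    job and therefore yields a route. *)
Lemma wp_scheduler : exists c0 st,
  [/\ exists2 t, exec (scheduler k) (input I) t st & t <= cost (n * 4).+1 (scheduler k),
      forall c, route 0 (no_picks k) c -> c0 <= c &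
      exists2 E, size E <= c0 & forall j, j < n ->
        if act j then @assigned I k E (arr st aOut) j else arr st aOut j = 0%R].
Proof.
pose M := (n * 4).+1.
have nM : n <= M by rewrite leqW // leq_pmulr.
have inp : inputs I (input I) by [].
have zero a i : 4 < a -> arr (input I) a i = 0%R.
  move=> a4; rewrite /= /input_arr; case: insub => // o; apply: nth_default; exact: a4.
have : wp M (scheduler k) (fun st => exists c0, (forall c, route 0 (no_picks k) c -> c0 <= c) /\
    exists2 E, size E <= c0 & forall j, j < n ->
        if act j then @assigned I k E (arr st aOut) j else arr st aOut j = 0%R) (input I).
  apply: wp_seq; apply: wp_mono (wp_prepare k valid nM inp) _ => st1 [p1 out1].
  have zero1 a i : 7 < a -> arr st1 a i = 0%R.
    by move=> a7; rewrite out1 ?zero //; [apply: leq_trans a7 | apply: contraTneq a7 => -> | apply: contraTneq a7 => ->].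
  have o1 j : arr st1 aOut j = 0%R by rewrite out1 ?zero.
  apply: wp_seq; apply: wp_mono (wp_fill (leqnn M) p1 zero1) _.
  move=> st2 [p2 fil2 out2].
  have := fil2 0 (no_picks k) (leqnn 0); rewrite eqxx orbT => -[v [vE opt rt _]].
  have [c rc _] : exists2 c, route 0 (no_picks k) c & c <= size [seq pick_of P | P : train_path I].
    apply: optimal_route => j jn aj; pose o := Ordinal jn.
    have nd : ~ discarded R o by apply/(activeP R o valid ratio).
    have [_ _ re] := jobE o valid.
    have [|Q cQ pQ] := singles_covered (s := jr I j) valid single_pos nd; first by rewrite lexx.
    have [P PQ] := path_of_private pQ; exists (pick_of P); first by apply/imageP; exists P.
    by apply/(single_pick o); rewrite PQ.
  have /andP[v0 _] := opt c rc.
  apply: wp_mono (wp_walk (leqnn M) (c0 := v.-1) p2 fil2 _ _) _.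
  - by move=> j; rewrite out2.
  - by rewrite vE prednK.
  move=> st3 [E [sE asg]]; exists v.-1; split; last by exists E.
  by move=> c' /opt/andP[_]; lia.
by move=> [t [st [e l [c0 [h1 h2]]]]]; exists c0, st; split=> //; exists t.
Qed.

Lemma activeE (o : 'I_n) : ~ discarded R o <-> act o.
Proof. exact: activeP. Qed.

(** Any solution is a hitting set, so by [optimal_route] it uses at least as
    many paths as a shortest route has picks. *)
Lemma output_optimal c0 E st : size E <= c0 ->
  (forall c, route 0 (no_picks k) c -> c0 <= c) ->
  (forall j, j < n ->
     if act j then @assigned I k E (arr st aOut) j else arr st aOut j = 0%R) ->
  optimal R (output I st).
Proof.
move=> sE best asg.
have out_active (o : 'I_n) : act o -> exists P,
    [/\ output I st o = [set P], pick_of P \in E & H o (pick_of P).1 (pick_of P).2].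
  move=> ao; have := asg o (ltn_ord o); rewrite ao => -[x xE [Hx ox]].
  have [l0 lh hd wd] := offsets o valid.
  (* a pick of the job has a positive index, so undoing the shift is exact *)
  have q6 := single_ge Hx.
  have := Hx; rewrite (singleP o) // => /path_of_private[P PE].
  have xP : x = pick_of P.
    rewrite /pick_of; move: PE => [dE qE]; rewrite dE.
    case: x q6 {xE ox Hx} dE qE => d q /= q6 dE qE; congr pair.
    by move: (6 * _) q6 qE => b q6 qE; lia.
  exists P; rewrite -xP; split=> //; apply/setP => Q; rewrite /output !inE ox xP pick_codeE.
  by rewrite (inj_eq path_code_inj).
have out_inactive (o : 'I_n) : ~~ act o -> output I st o = set0.
  move=> ao; apply/setP => Q; rewrite /output !inE.
  have := asg o (ltn_ord o); rewrite (negbTE ao) => ->.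
  by rewrite (negbTE (path_code_neq0 Q)).
split.
  move=> o; split=> [dis|nd].
    by apply: out_inactive; apply/negP => /activeE; apply.
  have [P [-> _ HP]] := out_active o (proj1 (activeE o) nd).
  by apply/(min_possession_private valid) => //; apply/single_pick.
move=> S solS; pose US := \bigcup_(o < n) S o.
have [c rc cS] : exists2 c, route 0 (no_picks k) c & c <= size [seq pick_of P | P <- enum US].
  apply: optimal_route => j jn aj; pose o := Ordinal jn.
  have nd : ~ discarded R o by apply/activeE.
  have [_ /(_ nd) mS] := solS o.
  have [P SP pP] := min_possession_single valid single_pos nd mS.
  exists (pick_of P); last by apply/(single_pick o).
  by apply: map_f; rewrite mem_enum; apply/bigcupP; exists o; rewrite // SP inE.
rewrite size_map -cardE in cS.
apply: leq_trans (leq_trans (best c rc) cS); apply: leq_trans _ sE.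
rewrite /objective cardE -(size_map pick_of); apply: uniq_leq_size.
  rewrite map_inj_uniq ?enum_uniq // => P Q PQ; apply: path_code_inj.
  by rewrite -!pick_codeE PQ.
move=> x /mapP[P]; rewrite mem_enum => /bigcupP[o _ Po] ->.
have [ao|/out_inactive o0] := boolP (act o); last by rewrite o0 inE in Po.
by have [Q [oQ QE _]] := out_active o ao; move: Po; rewrite oQ inE => /eqP->.
Qed.
End Main.

Local Open Scope ring_scope.

Theorem theorem5 (R : realType) (kappa : R) (kappa_gt0 : 0 < kappa) :
  exists (c : prog) (C : nat),
    forall I : instance,
      valid_instance I ->
      singleton_possessions R I ->
      ratr (travel I) / ratr (headway I) <= kappa ->
      exists (t : nat) (st : store),
        [/\ exec c (input I) t st,
            optimal R (output I st) &
            (t <= C * (njobs I ^ 2 + 1))%N].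
Proof.
pose k := Num.bound kappa.
exists (scheduler k), (cost 0 (scheduler k) * 32)%N => I valid single ratio.
have ratio' : travel I <= k%:R * headway I.
  have [[_ D0 _ _] _] := valid.
  rewrite -ler_pdivrMr // -(ler_rat R) fmorph_div ratr_nat.
  by apply: le_trans ratio (ltW (archi_boundP (ltW kappa_gt0))).
have [c0 [st [[t e tM] best [E sE asg]]]] := wp_scheduler valid single ratio'.
exists t, st; split=> //; first exact: (output_optimal valid single ratio' sE best asg).
apply: leq_trans tM (leq_trans (cost_pow _ (scheduler_depth k)) _).
(* loops are nested twice and iterate at most 4 n + 1 times *)
rewrite -mulnA leq_mul2l; apply/orP; right; nia.
Qed.
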